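(* Let $(M,\mathcal Q)$ be an almost quaternionic manifold of dimension $4n$ with $n\ge 2$, and let $\nabla$ be a quaternionic connection on it with torsion tensor $T^{\nabla}$. The following conditions are equivalent: (i) the almost complex structure $I_1^{\nabla}$ on the twistor space $Z$ of $(M,\mathcal Q)$ is integrable; (ii) the $(0,2)_J$-part of the torsion vanishes with respect to all almost complex structures in $\mathcal Q$: $(T^{\nabla})^{0,2}_J=0$ for all $J\in\mathcal Q$ with $J^2=-\mathrm{id}$.
   Context: An almost quaternionic structure on a $4n$-dimensional manifold $M$ is a rank-3 subbundle $\mathcal Q\subset \mathrm{End}(TM)$ which is locally spanned by triples $(J_1,J_2,J_3)$ of almost complex structures with $J_\alpha^2=-\mathrm{id}$ and $J_1J_2=-J_2J_1=J_3$; such a local triple is called an admissible basis of $\mathcal Q$. $(M,\mathcal Q)$ is then called an almost quaternionic manifold. A quaternionic connection is a linear connection $\nabla$ on $TM$ preserving $\mathcal Q$, i.e. $\nabla_X\sigma\in\Gamma(\mathcal Q)$ for every vector field $X$ and every $\sigma\in\Gamma(\mathcal Q)$; no assumption is made on its torsion. For a $TM$-valued 2-form $B$ and $J\in\mathcal Q$ with $J^2=-\mathrm{id}$, the $(0,2)_J$-part of $B$ is $$B^{0,2}_J(X,Y)=\tfrac14\big(B(JX,JY)-B(X,Y)-JB(JX,Y)-JB(X,JY)\big).$$ Twistor space: $Z=\{J\in\mathcal Q: J^2=-\mathrm{id}\}$, i.e. the $S^2$-bundle $\pi:Z\to M$ whose elements are locally $J=a_1J_1+a_2J_2+a_3J_3$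 with $a_1^2+a_2^2+a_3^2=1$. For $J\in Z$ with $\pi(J)=x$, the vertical space is $V_J=\ker \pi_{*}=\{W\in\mathcal Q_x: WJ+JW=0\}$. A quaternionic connection $\nabla$ induces a connection on the vector bundle $\mathcal Q$ which preserves $Z$, hence a horizontal distribution $H$ on $Z$ with $T_JZ=V_J\oplus H_J$ and $\pi_*:H_J\to T_xM$ an isomorphism. For $Y\in T_xM$ let $Y^h\in H_J$ denote its horizontal lift. The almost complex structure $I_1^\nabla$ on $Z$ is defined at $J\in Z$ by $I_1^\nabla(W)=JW$ for $W\in V_J$ and $I_1^\nabla(Y^h)=(JY)^h$ for $Y\in T_xM$. An almost complex structure is called integrable if its Nijenhuis tensor $N_I(U,W)=[IU,IW]-[U,W]-I[IU,W]-I[U,IW]$ vanishes. *)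

(* Defs.v *)
From HB Require Import structures.
From mathcomp Require Import all_boot all_order all_algebra.
From mathcomp Require Import all_classical all_reals all_analysis.

Set Implicit Arguments.
Unset Strict Implicit.
Unset Printing Implicit Defensive.

Import Order.TTheory GRing.Theory Num.Theory.
Import numFieldNormedType.Exports.

Local Open Scope classical_set_scope.
Local Open Scope ring_scope.

Section SmoothMaps.
Context {R : realType} {V W : normedModType R}.

(* Meant for open U and finite-dimensional V, where C^(k+1) amounts to
   differentiability with all directional derivatives of class C^k. *)
Fixpoint Ck (k : nat) (U : set V) (f : V -> W) : Prop :=
  match k with
  | 0 => forall x, U x -> {for x, continuous f}
  | k'.+1 => (forall x, U x -> differentiable f x) /\
             (forall v, Ck k' U (fun x => 'D_v f x))
  end.

Definition smooth_on (U : set V) (f : V -> W) : Prop := forall k, Ck k U f.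

Definition smooth_near (x : V) (f : V -> W) : Prop :=
  exists2 U, open_nbhs x U & smooth_on U f.

End SmoothMaps.

(* Column vectors are used throughout, so that [*m] is composition of
   endomorphisms in the usual order. *)
Definition mx_of {R : realType} {m : nat} (f : 'cV[R]_m -> 'cV[R]_m) : 'M[R]_m :=
  \matrix_(i, j) f (delta_mx j 0) i 0.

(* The smooth structure is given by an atlas containing, for each point p, a
   chosen chart [chart p] around p with inverse [unchart p]; every smooth
   structure arises from such an atlas. *)
Record manifold (R : realType) (m : nat) := Manifold {
  point_of :> topologicalType;
  dom : point_of -> set point_of;
  chart : point_of -> point_of -> 'cV[R]_m;
  unchart : point_of -> 'cV[R]_m -> point_of;
  dom_nbhs : forall p, open_nbhs p (dom p);
  chart_open : forall p, open (chart p @` dom p);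
  chartK : forall p q, dom p q -> unchart p (chart p q) = q;
  chart_continuous : forall p q, dom p q -> {for q, continuous (chart p)};
  unchart_continuous : forall p u, (chart p @` dom p) u ->
    {for u, continuous (unchart p)};
  transition_smooth : forall p q,
    smooth_on (chart p @` (dom p `&` dom q)) (chart q \o unchart p);
  manifold_hausdorff : hausdorff_space point_of;
  manifold_second_countable : @second_countable point_of
}.

Section Tensors.
Context {R : realType} {m : nat} {M : manifold R m}.
Implicit Types (p q : M) (u v : 'cV[R]_m) (f : M -> R).

(* The tangent space T_pM is represented by R^m, through the chart [chart p]
   chosen at p itself; End(T_pM) is then represented by square matrices. *)
Definition vfield : Type := M -> 'cV[R]_m.
Definition endfield : Type := M -> 'M[R]_m.
Implicit Types (X Y : vfield) (A : endfield).

(* For q in [dom p], the change of coordinates on T_qM from the chart at q to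
   the chart at p. *)
Definition tcoord p q : 'M[R]_m :=
  mx_of ('d (chart p \o unchart q) (chart q q)).

Definition vloc p X (x : 'cV[R]_m) : 'cV[R]_m :=
  tcoord p (unchart p x) *m X (unchart p x).

Definition eloc p A (x : 'cV[R]_m) : 'M[R]_m :=
  tcoord p (unchart p x) *m A (unchart p x) *m invmx (tcoord p (unchart p x)).

Definition smooth_fun p f : Prop := smooth_near (chart p p) (f \o unchart p).
Definition smooth_vfield p X : Prop := smooth_near (chart p p) (vloc p X).
Definition smooth_endfield p A : Prop := smooth_near (chart p p) (eloc p A).

(* The derivative of f along the tangent vector v at p. *)
Definition dirder p v f : R := 'D_v (f \o unchart p) (chart p p).

(* In coordinates, [X, Y]^i = X(Y^i) - Y(X^i); note that [tcoord p p] is the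
   identity, so that X p is its own coordinate vector in the chart at p. *)
Definition lie_bracket X Y : vfield := fun p =>
  'D_(X p) (vloc p Y) (chart p p) - 'D_(Y p) (vloc p X) (chart p p).

(* The vector field near p extending v with constant coefficients in the chart
   at p; it is used to evaluate tensorial expressions on tangent vectors. *)
Definition ext p v : vfield := fun q => invmx (tcoord p q) *m v.

(* A linear connection, as a covariant derivative of locally defined vector
   fields: the axioms at p concern fields that are smooth in a neighbourhood of
   p and arbitrary elsewhere. Locality follows from the Leibniz rule applied to
   the indicator function of an open set. *)
Record is_connection (nabla : vfield -> vfield -> vfield) : Prop := {
  conn_smooth : forall p X Y, smooth_vfield p X -> smooth_vfield p Y ->
    smooth_vfield p (nabla X Y);
  conn_addl : forall p X1 X2 Y,
    smooth_vfield p X1 -> smooth_vfield p X2 -> smooth_vfield p Y ->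
    nabla (fun q => X1 q + X2 q) Y p = nabla X1 Y p + nabla X2 Y p;
  conn_scalel : forall p f X Y,
    smooth_fun p f -> smooth_vfield p X -> smooth_vfield p Y ->
    nabla (fun q => f q *: X q) Y p = f p *: nabla X Y p;
  conn_addr : forall p X Y1 Y2,
    smooth_vfield p X -> smooth_vfield p Y1 -> smooth_vfield p Y2 ->
    nabla X (fun q => Y1 q + Y2 q) p = nabla X Y1 p + nabla X Y2 p;
  conn_leibniz : forall p f X Y,
    smooth_fun p f -> smooth_vfield p X -> smooth_vfield p Y ->
    nabla X (fun q => f q *: Y q) p
      = f p *: nabla X Y p + dirder p (X p) f *: Y p
}.

Definition torsion (nabla : vfield -> vfield -> vfield) p u v : 'cV[R]_m :=
  nabla (ext p u) (ext p v) p - nabla (ext p v) (ext p u) p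
  - lie_bracket (ext p u) (ext p v) p.

(* (nabla_X A)(v) = nabla_X (A v) - A (nabla_X v). *)
Definition nabla_end (nabla : vfield -> vfield -> vfield) X A : endfield :=
  fun p => mx_of (fun v =>
    nabla X (fun q => A q *m ext p v q) p - A p *m nabla X (ext p v) p).

Definition part02 (J : 'M[R]_m) (B : 'cV[R]_m -> 'cV[R]_m -> 'cV[R]_m) u v :
    'cV[R]_m :=
  4%:R^-1 *: (B (J *m u) (J *m v) - B u v
              - J *m B (J *m u) v - J *m B u (J *m v)).

Definition admissible (J1 J2 J3 : 'M[R]_m) : Prop :=
  [/\ J1 *m J1 = - 1%:M, J2 *m J2 = - 1%:M, J3 *m J3 = - 1%:M,
      J1 *m J2 = J3 & J2 *m J1 = - J3].

(* Such J1, J2, J3 are automatically linearly independent when m > 0, so that Q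
   has rank 3. *)
Definition almost_quaternionic (Q : M -> set 'M[R]_m) : Prop :=
  forall p, exists J1 J2 J3 : endfield,
    [/\ smooth_endfield p J1, smooth_endfield p J2, smooth_endfield p J3 &
      \forall q \near p, admissible (J1 q) (J2 q) (J3 q) /\
        Q q = [set A | exists a1 a2 a3 : R,
                 A = a1 *: J1 q + a2 *: J2 q + a3 *: J3 q]].

Definition quaternionic_connection (Q : M -> set 'M[R]_m)
    (nabla : vfield -> vfield -> vfield) : Prop :=
  is_connection nabla /\
  forall p X A, smooth_vfield p X -> smooth_endfield p A ->
    (\forall q \near p, Q q (A q)) -> Q p (nabla_end nabla X A p).

End Tensors.

Arguments vfield {R m} M.
Arguments endfield {R m} M.

(* Spaces given by their smooth functions: [S z f] means that f is smooth in a
   neighbourhood of z. Tangent vectors are velocities of smooth curves, seen as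
   operators on functions; they are set to 0 on the functions that are not
   smooth near the base point, so that equality of operators is equality of
   tangent vectors. *)
Section SmoothSpaces.
Context {R : realType} {Z : Type} (S : Z -> (Z -> R) -> Prop).

Definition oper : Type := (Z -> R) -> R.

Definition at_smooth (z : Z) (D : oper) : oper :=
  fun f => if `[< S z f >] then D f else 0.

Definition smooth_curve (c : R -> Z) : Prop :=
  forall f, S (c 0) f -> smooth_near (0 : R) (f \o c).

Definition velocity (c : R -> Z) : oper :=
  at_smooth (c 0) (fun f => 'D_1 (f \o c) 0).

Definition tangent (z : Z) : set oper :=
  [set xi | exists c, [/\ smooth_curve c, c 0 = z & xi = velocity c]].

Definition smooth_vf (z : Z) (U : Z -> oper) : Prop :=
  (forall z', tangent z' (U z')) /\
  (forall f, S z f -> S z (fun z' => U z' f)).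

Definition bracket (U W : Z -> oper) : Z -> oper := fun z =>
  at_smooth z (fun f => U z (fun z' => W z' f) - W z (fun z' => U z' f)).

Definition nijenhuis (I : Z -> oper -> oper) (U W : Z -> oper) (z : Z) : oper :=
  let IU z' := I z' (U z') in
  let IW z' := I z' (W z') in
  fun f => bracket IU IW z f - bracket U W z f
           - I z (bracket IU W z) f - I z (bracket U IW z) f.

Definition acs_integrable (I : Z -> oper -> oper) : Prop :=
  forall z U W, smooth_vf z U -> smooth_vf z W ->
    forall f, nijenhuis I U W z f = 0.

End SmoothSpaces.

Section Twistor.
Context {R : realType} {m : nat} {M : manifold R m}.
Variables (Q : M -> set 'M[R]_m) (nabla : vfield M -> vfield M -> vfield M).

Definition twistor : Type :=
  {z : M * 'M[R]_m | Q z.1 z.2 /\ z.2 *m z.2 = - 1%:M}.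

Definition base (z : twistor) : M := (proj1_sig z).1.
Definition fib (z : twistor) : 'M[R]_m := (proj1_sig z).2.

(* The coordinates of z in the bundle chart of End(TM) over [dom p]. *)
Definition end_coord (p : M) (z : twistor) : 'cV[R]_m * 'M[R]_m :=
  let D := tcoord p (base z) in
  (chart p (base z), D *m fib z *m invmx D).

(* Z is a submanifold of the total space of End(TM), so its smooth functions are
   locally the restrictions of the smooth functions on End(TM). *)
Definition twistor_smooth (z : twistor) (f : twistor -> R) : Prop :=
  exists2 g : 'cV[R]_m * 'M[R]_m -> R, smooth_near (end_coord (base z) z) g &
    forall z', dom (base z) (base z') -> f z' = g (end_coord (base z) z').

Definition vertical (z : twistor) : set 'M[R]_m :=
  [set W | Q (base z) W /\ W *m fib z + fib z *m W = 0].

(* W in V_J as a tangent vector to Z: the velocity of a curve in the fibre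
   through J with derivative W. *)
Definition is_vlift (z : twistor) (W : 'M[R]_m) (xi : oper) : Prop :=
  exists c : R -> twistor,
    [/\ smooth_curve twistor_smooth c, c 0 = z, forall t, base (c t) = base z,
        is_derive (0 : R) 1 (fun t => fib (c t)) W &
        xi = velocity twistor_smooth c].

(* The horizontal lift of Y: the image of Y by the differential of a local
   section s of Z through J with nabla_Y s = 0. *)
Definition is_hlift (z : twistor) (Y : 'cV[R]_m) (xi : oper) : Prop :=
  exists s : M -> twistor,
    [/\ forall q, base (s q) = q, s (base z) = z,
        smooth_endfield (base z) (fib \o s),
        nabla_end nabla (ext (base z) Y) (fib \o s) (base z) = 0 &
        xi = at_smooth twistor_smooth z
               (fun f => dirder (base z) Y (f \o s))].

(* eta = I1 xi, i.e. xi = W + Y^h and eta = J W + (J Y)^h. *)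
Definition I1_rel (z : twistor) (xi eta : oper) : Prop :=
  exists W Y xiv xih etav etah,
    [/\ vertical z W, is_vlift z W xiv /\ is_hlift z Y xih,
        is_vlift z (fib z *m W) etav /\ is_hlift z (fib z *m Y) etah,
        xi = (fun f => xiv f + xih f) & eta = (fun f => etav f + etah f)].

(* Since T_J Z is the direct sum of V_J and H_J, eta is unique, and it exists
   for every tangent vector xi; elsewhere I1 is set to 0. *)
Definition I1 (z : twistor) (xi : oper) : oper :=
  xget (fun=> 0) (I1_rel z xi).

End Twistor.

(* Main.v *)
From HB Require Import structures.
Require Import Defs.
From mathcomp Require Import all_boot all_order all_algebra.
From mathcomp Require Import all_classical all_reals all_analysis.
From mathcomp Require Import lra ring.

(** Everything is read in the chart around one point [p] of M. There the connection
is given by Christoffel matrices [Gam x u], linear in the vector [u], and a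
point of the total space of End(TM) has coordinates (x, A) in the vector space
E = R^m x M_m(R), of which the twistor space is locally a submanifold. A tangent
vector of Z, which is an operator on functions, becomes a vector of E
([represents]). The horizontal vectors at (x, A) are the (u, - [Gam x u, A]), so
that the vertical part of a vector (u, B) is C = B + [Gam x u, A], and I_1
becomes the field [acs_local] of endomorphisms of E

   (u, B) |-> (A u, A C - [Gam x (A u), A]).

That I_1 has this expression on every tangent vector ([I1_represents]) requires
existence of the two kinds of lifts. Vertical lifts are velocities of circles in
the fibre; for a horizontal lift ([hlift_exists]), a section of Z with constant
coordinates on a local frame of Q is rotated so as to cancel its covariant
derivative. Conversely, a represented vector (0, C) is vertical
([vertical_of_represents]), because Z is defined by equations that can be
differentiated.

The bracket of two vector fields of Z is represented by the bracket of the
vector fields of E that represent them, by the symmetry of second derivatives.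
Since the endomorphism above has square -1 as soon as A^2 = -1, the Nijenhuis
tensor of I_1 is then computed by the usual algebraic formula
([local_nijenhuisE]), with the following result at tangent vectors projecting
to u and w.
 - Its projection to M is - tau(u, w), where tau is four times the (0,2)-part of
   the torsion with respect to A ([nijenhuis_tensor1]); the torsion has the
   expected expression in the chart by [torsion_chart].
 - Its vertical part is F(u, w) = [R(u, w) - R(A u, A w), A]
   + A [R(A u, w) + R(u, A w), A], with R the curvature ([nijenhuis_tensor2]).

If I_1 is integrable, the first formula, applied to the horizontal lifts of
constant fields, shows that the (0,2)-part of the torsion vanishes.

Conversely, if it vanishes for all J in Z, only F has to be shown to vanish. The
Bianchi identity writes the cyclic sum of R(u, v) w as the cyclic sum of
(nabla_u T)(v, w) + T(T(v, w), u). Since tau vanishes on Z, so does its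
derivative along horizontal directions, and it follows that the cyclic sum of
F(u, v) w is zero ([vertical_part_bianchi]):

   F(u, v) w = - F(v, w) u - F(w, u) v.

Now F takes its values in Q, being the vertical part of a tangent vector of Z.
Hence, u and v being fixed, the image of F(u, v) lies in the span of the six
vectors J_k u and J_k v, for J_1, J_2, J_3 an admissible basis at p. But a nonzero
element of Q is invertible, with an image of dimension 4 n > 6 as n >= 2. So
F(u, v) = 0 ([span3_small_image], [vertical_part0]). *)

Set Implicit Arguments.
Unset Strict Implicit.
Unset Printing Implicit Defensive.

Import Order.TTheory GRing.Theory Num.Theory.
Import numFieldNormedType.Exports.

Local Open Scope classical_set_scope.
Local Open Scope ring_scope.

(** * Calculus in normed modules *)

Section MatrixEntries.
Context {R : realType} {n p : nat}.
Implicit Types A B : 'M[R]_(n, p).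

Lemma mx_entryD A B i j : (A + B) i j = A i j + B i j.
Proof. by rewrite mxE. Qed.

Lemma mx_entryN A i j : (- A) i j = - A i j.
Proof. by rewrite mxE. Qed.

End MatrixEntries.

(** An identity between integer combinations of noncommutative monomials holds
    entry by entry, in a commutative ring of which the entries of the monomials
    are the variables. *)
Ltac mx_ring := apply/matrixP => ? ?; rewrite !(mx_entryD, mx_entryN); ring.

(** The filter of neighbourhoods of a matrix is defined entrywise; these lemmas
    are stated for an abstract topology, where it does not unfold. *)
Section Near.
Variables (T : topologicalType) (x : T).

Lemma near_all (P : T -> Prop) : (forall y, P y) -> \forall y \near x, P y.
Proof. by move=> h; apply: nearW. Qed.

Lemma near_mono (P Q : T -> Prop) : (forall y, P y -> Q y) ->
  (\forall y \near x, P y) -> \forall y \near x, Q y.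
Proof. by move=> h; apply: filterS. Qed.

Lemma near_mono2 (P Q S : T -> Prop) : (forall y, P y -> Q y -> S y) ->
  (\forall y \near x, P y) -> (\forall y \near x, Q y) -> \forall y \near x, S y.
Proof. by move=> h; apply: filterS2. Qed.

Lemma near_self (P : T -> Prop) : (\forall y \near x, P y) -> P x.
Proof. exact: nbhs_singleton. Qed.

Lemma near_near (P : T -> Prop) : (\forall y \near x, P y) ->
  \forall y \near x, \forall z \near y, P z.
Proof. by move/nbhs_interior; apply: filterS. Qed.

End Near.

Section Derivatives.
Context {R : realType}.
Implicit Types U V W : normedModType R.

Lemma linear_sumE V W (I : finType) (L : V -> W) (F : I -> V) : linear L ->
  L (\sum_i F i) = \sum_i L (F i).
Proof.
move=> Llin; pose LM := GRing.isLinear.Build _ _ _ _ _ Llin.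
pose L' : {linear V -> W} := HB.pack L LM.
exact: (linear_sum L').
Qed.

Lemma linear_scaleE V W (L : V -> W) : linear L -> forall a v, L (a *: v) = a *: L v.
Proof.
move=> Llin; pose LM := GRing.isLinear.Build _ _ _ _ _ Llin.
pose L' : {linear V -> W} := HB.pack L LM.
move=> a v; exact: (linearZ_LR L').
Qed.

Lemma linear_is_diff V W (L : V -> W) x : linear L -> continuous L ->
  is_diff x L L.
Proof.
move=> Llin Lc; pose LM := GRing.isLinear.Build _ _ _ _ _ Llin.
pose L' : {linear V -> W} := HB.pack L LM.
by split; [exact: (@linear_differentiable _ _ _ L')|exact: (@diff_lin _ _ _ L')].
Qed.

Lemma near_eq_differentiable V W (f g : V -> W) x :
  (\near x, f x = g x) -> differentiable f x -> differentiable g x.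
Proof.
move=> fg df; have gx : f x = g x := nbhs_singleton fg.
have e' : g \o shift x = cst (g x) + 'd f x +o_ (0:V) id.
  apply/eqaddoP => _/posnumP[e0].
  have /eqaddoP /(_ e0%:num) /(_ [gt0 of e0%:num]) := diff_locally df.
  apply: filter_app.
  have : \forall y \near 0, f (y + x) = g (y + x).
    by move: fg; rewrite (near_shift 0) /= subr0.
  by apply: filterS => y /= ye; rewrite !fctE /= -ye -gx.
apply/diff_locallyP.
have -> : 'd g x = 'd f x :> (V -> W).
  by apply: diff_unique => //; exact: diff_continuous.
by split => //; exact: diff_continuous.
Qed.

Lemma derive_comp V U W (f : V -> U) (g : U -> W) x v :
  differentiable f x -> differentiable g (f x) ->
  'D_v (g \o f) x = 'D_('D_v f x) g (f x).
Proof.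
move=> df dg; rewrite !deriveE//; last exact: differentiable_comp.
by rewrite diff_comp.
Qed.

Lemma derive_lin V U W (f : V -> U) (L : U -> W) x v :
  linear L -> continuous L -> differentiable f x ->
  differentiable (L \o f) x /\ 'D_v (L \o f) x = L ('D_v f x).
Proof.
move=> Llin Lc df; have dL := linear_is_diff (f x) Llin Lc.
split; first by apply: differentiable_comp.
by rewrite derive_comp// [LHS]deriveE// diff_val.
Qed.

Lemma derive_direction_lin V W (f : V -> W) x a u v : differentiable f x ->
  'D_(a *: u + v) f x = a *: 'D_u f x + 'D_v f x.
Proof. by move=> df; rewrite !deriveE// linearP. Qed.

Lemma derive_bilin V U1 U2 W (b : U1 -> U2 -> W) (f : V -> U1) (g : V -> U2) x v :
  (forall y, linear (b y)) -> (forall y, linear (b ^~ y)) ->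
  continuous (fun p => b p.1 p.2) ->
  differentiable f x -> differentiable g x ->
  differentiable (fun y => b (f y) (g y)) x /\
  'D_v (fun y => b (f y) (g y)) x = b ('D_v f x) (g x) + b (f x) ('D_v g x).
Proof.
move=> linr linl bc df dg.
have bP : bilinear_for
    (GRing.Scale.Law.clone _ _ *:%R _) (GRing.Scale.Law.clone _ _ *:%R _) b.
  by split=> [u'|u] a y z; [exact: linl|exact: linr].
pose bM := bilinear_isBilinear.Build R U1 U2 W _ _ b bP.
pose B : {bilinear U1 -> U2 -> W} := HB.pack b bM.
have dB : is_diff (f x, g x) (fun q => B q.1 q.2) (fun q => B (f x) q.2 + B q.1 (g x)).
  apply: DiffDef; first exact: differentiable_bilin.
  exact: diff_bilin.
have dP := is_diff_pair (differentiableP df) (differentiableP dg).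
have dC := is_diff_comp dP dB.
have e : (fun y => b (f y) (g y)) = ((fun q => B q.1 q.2) \o (fun y => (f y, g y))) by [].
rewrite e; split; first exact: ex_diff.
by rewrite deriveE// diff_val /= addrC !deriveE.
Qed.

End Derivatives.

Section CkTheory.
Context {R : realType}.
Implicit Types U V W : normedModType R.

Lemma Ck_sub V W k (A B : set V) (f : V -> W) : A `<=` B -> Ck k B f -> Ck k A f.
Proof.
move=> AB; elim: k f => [|k IH] f /=; first by move=> h x /AB/h.
by move=> [h1 h2]; split=> [x /AB/h1//|v]; apply: IH.
Qed.

Lemma Ck_eq V W k (A : set V) (f g : V -> W) : open A ->
  (forall x, A x -> f x = g x) -> Ck k A f -> Ck k A g.
Proof.
move=> Ao; elim: k f g => [|k IH] f g fg /=.
  move=> h x Ax; have := h x Ax; rewrite /prop_for /continuous_at -(fg x Ax).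
  apply: cvg_trans; apply: near_eq_cvg.
  by apply: filterS (open_nbhs_nbhs (conj Ao Ax)) => y /fg.
have fgn x : A x -> \near x, f x = g x.
  by move=> Ax; apply: filterS (open_nbhs_nbhs (conj Ao Ax)) => y /fg.
move=> [h1 h2]; split=> [x Ax|v].
  exact: near_eq_differentiable (fgn _ Ax) (h1 _ Ax).
apply: (IH ('D_v f)) => // x Ax.
by apply: near_eq_derive; exact: fgn.
Qed.

Lemma Ck_pred V W k (A : set V) (f : V -> W) : Ck k.+1 A f -> Ck k A f.
Proof.
elim: k f => [|k IH] f.
  by move=> [df _] x Ax; exact/differentiable_continuous/df.
by move=> [df Df]; split=> // v; exact: IH (Df v).
Qed.

Lemma Ck_cst V W k (A : set V) (w : W) : Ck k A (cst w).
Proof.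
elim: k w => [|k IH] w /=; first by move=> x _; exact: cst_continuous.
split=> // v; have -> : (fun x => 'D_v (cst w) x) = cst 0 :> (V -> W).
  by apply/funext => x; rewrite derive_cst.
exact: IH.
Qed.

Lemma Ck_lin V U W k (A : set V) (f : V -> U) (L : U -> W) : open A ->
  linear L -> continuous L -> Ck k A f -> Ck k A (L \o f).
Proof.
move=> Ao Ll Lc; elim: k f => [|k IH] f /=.
  by move=> fc x Ax; apply: continuous_comp (fc x Ax) (Lc _).
move=> [df Df]; split=> [x Ax|v]; first exact: (derive_lin 0 Ll Lc (df x Ax)).1.
apply: (Ck_eq Ao _ (IH _ (Df v))) => x Ax.
by rewrite [RHS](derive_lin v Ll Lc (df x Ax)).2.
Qed.

Lemma Ck_id V k (A : set V) : open A -> Ck k A (@id V).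
Proof.
case: k => [|k] Ao; first by move=> x _; exact: cvg_id.
split=> // v; apply: (Ck_eq Ao _ (Ck_cst _ _ v)) => x _.
by rewrite derive_id.
Qed.

Lemma Ck_add V W k (A : set V) (f g : V -> W) : open A ->
  Ck k A f -> Ck k A g -> Ck k A (fun x => f x + g x).
Proof.
move=> Ao; elim: k f g => [|k IH] f g /=.
  by move=> fc gc x Ax; exact: continuousD (fc x Ax) (gc x Ax).
move=> [df Df] [dg Dg]; split=> [x Ax|v].
  exact: (differentiableD (df x Ax) (dg x Ax)).
apply: (Ck_eq Ao _ (IH _ _ (Df v) (Dg v))) => x Ax.
by rewrite deriveD//; apply: diff_derivable; [exact: df|exact: dg].
Qed.

Lemma Ck_sum V W (I : finType) k (A : set V) (f : I -> V -> W) : open A ->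
  (forall i, Ck k A (f i)) -> Ck k A (fun x => \sum_i f i x).
Proof.
move=> Ao fC; have : forall s : seq I, Ck k A (fun x => \sum_(i <- s) f i x).
  elim=> [|i s IH].
    apply: (Ck_eq Ao _ (Ck_cst _ _ 0)) => x _; by rewrite big_nil.
  apply: (Ck_eq Ao _ (Ck_add Ao (fC i) IH)) => x _; by rewrite big_cons.
exact.
Qed.

Lemma Ck_bilin V U1 U2 W k (A : set V) (b : U1 -> U2 -> W) (f : V -> U1)
    (g : V -> U2) : open A ->
  (forall y, linear (b y)) -> (forall y, linear (b ^~ y)) ->
  continuous (fun p => b p.1 p.2) ->
  Ck k A f -> Ck k A g -> Ck k A (fun x => b (f x) (g x)).
Proof.
move=> Ao bl br bc; elim: k f g => [|k IH] f g.
  move=> fc gc x Ax.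
  have e : (fun x => b (f x) (g x)) = (fun p => b p.1 p.2) \o (fun x => (f x, g x)) by [].
  rewrite e; apply: continuous_comp; last exact: bc.
  by apply: cvg_pair; [exact: fc|exact: gc].
move=> fC gC; have [[df Df] [dg Dg]] := (fC, gC); split=> [x Ax|v].
  exact: (derive_bilin 0 bl br bc (df x Ax) (dg x Ax)).1.
have h1 := IH _ _ (Df v) (Ck_pred gC); have h2 := IH _ _ (Ck_pred fC) (Dg v).
apply: (Ck_eq Ao _ (Ck_add Ao h1 h2)) => x Ax.
by rewrite [RHS](derive_bilin v bl br bc (df x Ax) (dg x Ax)).2.
Qed.

Lemma scale_linr V (y : R) : linear (fun v : V => y *: v).
Proof. by move=> a u v; rewrite scalerDr !scalerA mulrC. Qed.

Lemma scale_linl V (y : V) : linear (fun a : R => a *: y).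
Proof. by move=> a u v; rewrite scalerDl scalerA. Qed.

Lemma Ck_scale V W k (A : set V) (h : V -> R) (f : V -> W) : open A ->
  Ck k A h -> Ck k A f -> Ck k A (fun x => h x *: f x).
Proof.
move=> Ao hC fC.
apply: (@Ck_bilin V R W W k A (fun a w => a *: w) h f) => //.
- by move=> y; exact: scale_linr.
- by move=> y; exact: scale_linl.
- exact: scale_continuous.
Qed.

Lemma Ck_inv V k (A : set V) (f : V -> R) : open A ->
  (forall x, A x -> f x != 0) -> Ck k A f -> Ck k A (fun x => (f x)^-1).
Proof.
move=> Ao f0; elim: k f f0 => [|k IH] f f0.
  by move=> fc x Ax; apply: continuousV; [exact: f0|exact: fc].
move=> fC; have [df Df] := fC; split=> [x Ax|v].
  by apply: differentiableV; [exact: df|exact: f0].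
have hI := IH f f0 (Ck_pred fC).
have h2 : Ck k A (fun x => (f x)^-1 *: ((f x)^-1 *: 'D_v f x)).
  apply: (Ck_scale Ao hI (Ck_scale Ao hI (Df v))).
have h3 : Ck k A (fun x => (-1 : R) *: ((f x)^-1 *: ((f x)^-1 *: 'D_v f x))).
  by apply: (Ck_scale (h := cst (-1))) => //; exact: Ck_cst.
apply: (Ck_eq Ao _ h3) => x Ax.
rewrite deriveV; [|exact: f0|by apply: diff_derivable; exact: df].
by rewrite scaleN1r scalerA -invfM -expr2 scaleNr.
Qed.

End CkTheory.

(** * Smooth maps between finite-dimensional spaces *)

(** The form in which finite dimension is used: a finite family of vectors with
    continuous linear coordinates. It is a class, so that it is inferred for the
    products of matrix spaces in which the twistor space has its coordinates. *)
Class framed (R : realType) (W : normedModType R) := Framed {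
  fidx : finType;
  fvec : fidx -> W;
  fcoord : fidx -> W -> R;
  fcoord_linear : forall i, linear (fcoord i);
  fcoord_continuous : forall i, continuous (fcoord i);
  frameE : forall w, w = \sum_i fcoord i w *: fvec i
}.
Arguments fidx {R} W {framed}.
Arguments fvec {R W framed}.
Arguments fcoord {R W framed}.

Section Frames.
Context {R : realType}.

Lemma frame_R_subproof (w : R) : w = \sum_(i : unit) w *: 1.
Proof. by rewrite (big_pred1 tt) ?[_ *: _]mulr1//; case. Qed.

#[global] Instance framed_R : framed R :=
  @Framed R R unit (fun=> 1) (fun _ x => x) (fun _ a x y => erefl)
    (fun _ => (fun x => cvg_id)) frame_R_subproof.

Lemma mx_coord_linear m n (p : 'I_m * 'I_n) :
  linear (fun A : 'M[R]_(m, n) => A p.1 p.2).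
Proof. by move=> a A B; rewrite !mxE. Qed.

Lemma frame_mx_subproof m n (A : 'M[R]_(m, n)) :
  A = \sum_(p : 'I_m * 'I_n) A p.1 p.2 *: delta_mx p.1 p.2.
Proof.
by rewrite {1}(matrix_sum_delta A) pair_bigA.
Qed.

#[global] Instance framed_mx m n : framed 'M[R]_(m, n) :=
  @Framed R 'M[R]_(m, n) ('I_m * 'I_n)%type (fun p => delta_mx p.1 p.2)
    (fun p A => A p.1 p.2) (@mx_coord_linear m n)
    (fun p => @coord_continuous R m n p.1 p.2) (@frame_mx_subproof m n).

Section Prod.
Variables (V W : normedModType R) (fV : framed V) (fW : framed W).

Definition prod_vec (i : fidx V + fidx W) : V * W :=
  match i with inl j => (fvec j, 0) | inr j => (0, fvec j) end.

Definition prod_coord (i : fidx V + fidx W) (w : V * W) : R :=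
  match i with inl j => fcoord j w.1 | inr j => fcoord j w.2 end.

Lemma prod_coord_linear i : linear (prod_coord i).
Proof. by case: i => i a u v /=; apply: fcoord_linear. Qed.

Lemma prod_coord_continuous i : continuous (prod_coord i).
Proof.
case: i => i u /=.
  apply: (@continuous_comp _ _ _ fst (fcoord i)); first exact: cvg_fst.
  exact: fcoord_continuous.
apply: (@continuous_comp _ _ _ snd (fcoord i)); first exact: cvg_snd.
exact: fcoord_continuous.
Qed.

Lemma pair_sum (I : finType) (F : I -> V * W) :
  \sum_i F i = (\sum_i (F i).1, \sum_i (F i).2).
Proof.
elim/big_rec3: _ => // i v w y _ ->.
by case: (F i).
Qed.

Lemma frame_prod_subproof w : w = \sum_i prod_coord i w *: prod_vec i.
Proof.
case: w => v w; rewrite big_sumType /= !pair_sum; congr pair => /=.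
  by rewrite [X in _ + X]big1 ?addr0 -?frameE// => i _; rewrite scaler0.
by rewrite [X in X + _]big1 ?add0r -?frameE// => i _; rewrite scaler0.
Qed.

#[global] Instance framed_prod : framed (V * W)%type :=
  @Framed R (V * W)%type (fidx V + fidx W)%type prod_vec prod_coord
    prod_coord_linear prod_coord_continuous frame_prod_subproof.

End Prod.

Context {U V W : normedModType R} {fU : framed U} {fV : framed V}.

Lemma framed_linear_continuous (L : U -> W) : linear L -> continuous L.
Proof.
move=> Ll; have -> : L = fun u => \sum_i fcoord i u *: L (fvec i).
  apply/funext => u; rewrite {1}(frameE u) linear_sumE//.
  by apply: eq_bigr => i _; rewrite linear_scaleE.
pose F (i : @fidx R U fU) u := @fcoord R U fU i u *: L (@fvec R U fU i).
suff h : Ck 0 setT (fun u => \sum_i F i u) by move=> u; exact: h.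
apply: Ck_sum => [|i]; first exact: openT.
apply: (@Ck_scale _ _ _ 0 _ _ (cst (L (fvec i)))); first exact: openT.
  by move=> x _; exact: fcoord_continuous.
exact: Ck_cst.
Qed.

Lemma framed_bilinear_continuous (b : U -> V -> W) :
  (forall y, linear (b y)) -> (forall y, linear (b ^~ y)) ->
  continuous (fun p => b p.1 p.2).
Proof.
move=> br bl.
have -> : (fun p => b p.1 p.2) = fun p =>
    \sum_i \sum_j fcoord i p.1 *: (fcoord j p.2 *: b (fvec i) (fvec j)).
  apply/funext => -[u v] /=; rewrite {1}(frameE u) (linear_sumE _ (bl v)).
  apply: eq_bigr => i _; rewrite (linear_scaleE (bl v)) {1}(frameE v) (linear_sumE _ (br _)) scaler_sumr.
  by apply: eq_bigr => j _; rewrite linear_scaleE.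
pose F (i : @fidx R U fU) (j : @fidx R V fV) (p : U * V) :=
  @fcoord R U fU i p.1 *: (@fcoord R V fV j p.2 *: b (@fvec R U fU i) (@fvec R V fV j)).
suff h : Ck 0 setT (fun p => \sum_i \sum_j F i j p) by move=> u; exact: h.
apply: (Ck_sum (f := fun i p => \sum_j F i j p)) => [|i]; first exact: openT.
apply: (Ck_sum (f := F i)) => [|j]; first exact: openT.
apply: (@Ck_scale _ _ _ 0 _ (fun p : U * V => fcoord i p.1)); first exact: openT.
  move=> x _; apply: (@continuous_comp _ _ _ fst (fcoord i)); first exact: cvg_fst.
  exact: fcoord_continuous.
apply: (@Ck_scale _ _ _ 0 _ (fun p : U * V => fcoord j p.2) (cst (b (fvec i) (fvec j)))); first exact: openT.
  move=> x _; apply: (@continuous_comp _ _ _ snd (fcoord j)); first exact: cvg_snd.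
  exact: fcoord_continuous.
exact: Ck_cst.
Qed.

End Frames.

Section SmoothNear.
Context {R : realType}.
Implicit Types U V W : normedModType R.

Lemma smooth_near_near V W x (f : V -> W) : smooth_near x f ->
  \forall y \near x, smooth_near y f.
Proof.
move=> [A [Ao Ax] fA]; apply: filterS (open_nbhs_nbhs (conj Ao Ax)) => y Ay.
by exists A.
Qed.

Lemma smooth_near_eq V W x (f g : V -> W) : (\near x, f x = g x) ->
  smooth_near x f -> smooth_near x g.
Proof.
rewrite -[X in X -> _]/(nbhs x [set y | f y = g y]) nbhsE.
move=> -[B [Bo Bx] fg] [A [Ao Ax] fA].
exists (A `&` B); first by split; [exact: openI|].
move=> k; apply: (Ck_eq (f := f)); first exact: openI.
  by move=> y [_ /fg].
by apply: Ck_sub (fA k) => y [].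
Qed.

Lemma smooth_near_diff V W x (f : V -> W) : smooth_near x f -> differentiable f x.
Proof. by move=> [A [_ Ax] /(_ 1) [df _]]; exact: df. Qed.

Lemma smooth_near_cont V W x (f : V -> W) : smooth_near x f -> {for x, continuous f}.
Proof. by move=> /smooth_near_diff/differentiable_continuous. Qed.

Lemma smooth_near_derive V W x (f : V -> W) v : smooth_near x f ->
  smooth_near x (fun y => 'D_v f y).
Proof. by move=> [A Ax fA]; exists A => // k; exact: (fA k.+1).2. Qed.

Lemma smooth_near_cst V W (x : V) (w : W) : smooth_near x (fun=> w).
Proof. by exists setT => [|k]; [split=> //; exact: openT|exact: Ck_cst]. Qed.

Lemma smooth_near_id V (x : V) : smooth_near x (fun y => y).
Proof. by exists setT => [|k]; [split=> //; exact: openT|apply: Ck_id; exact: openT]. Qed.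

Lemma smooth_near_lin V U W {fU : framed U} x (f : V -> U) (L : U -> W) :
  linear L -> smooth_near x f -> smooth_near x (fun y => L (f y)).
Proof.
move=> Ll [A [Ao Ax] fA]; exists A => // k.
by apply: Ck_lin => //; exact: framed_linear_continuous.
Qed.

Lemma smooth_nearD V W x (f g : V -> W) : smooth_near x f -> smooth_near x g ->
  smooth_near x (fun y => f y + g y).
Proof.
move=> [A [Ao Ax] fA] [B [Bo Bx] gB]; have ABo := openI Ao Bo.
exists (A `&` B) => // k; apply: Ck_add => //.
  by apply: Ck_sub (fA k) => y [].
by apply: Ck_sub (gB k) => y [].
Qed.

Lemma smooth_near_bilin V U1 U2 W {fU1 : framed U1} {fU2 : framed U2} x
    (b : U1 -> U2 -> W) (f : V -> U1) (g : V -> U2) :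
  (forall y, linear (b y)) -> (forall y, linear (b ^~ y)) ->
  smooth_near x f -> smooth_near x g -> smooth_near x (fun y => b (f y) (g y)).
Proof.
move=> br bl [A [Ao Ax] fA] [B [Bo Bx] gB]; have ABo := openI Ao Bo.
exists (A `&` B) => // k; apply: Ck_bilin => //.
- exact: framed_bilinear_continuous.
- by apply: Ck_sub (fA k) => y [].
- by apply: Ck_sub (gB k) => y [].
Qed.

Lemma smooth_nearZ V W x (h : V -> R) (f : V -> W) :
  smooth_near x h -> smooth_near x f -> smooth_near x (fun y => h y *: f y).
Proof.
move=> [A [Ao Ax] fA] [B [Bo Bx] gB]; have ABo := openI Ao Bo.
exists (A `&` B) => // k; apply: Ck_scale => //.
- by apply: Ck_sub (fA k) => y [].
- by apply: Ck_sub (gB k) => y [].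
Qed.

Lemma smooth_nearN V W x (f : V -> W) : smooth_near x f ->
  smooth_near x (fun y => - f y).
Proof.
move=> fx.
have h : smooth_near x (fun y => (-1 : R) *: f y).
  by apply: (smooth_nearZ (h := fun=> -1)) fx; exact: smooth_near_cst.
apply: smooth_near_eq h.
by apply: nearW => y; rewrite scaleN1r.
Qed.

Lemma smooth_nearB V W x (f g : V -> W) : smooth_near x f -> smooth_near x g ->
  smooth_near x (fun y => f y - g y).
Proof. by move=> fx gx; apply: smooth_nearD => //; exact: smooth_nearN. Qed.

Lemma smooth_near_sum V W (I : finType) x (f : I -> V -> W) :
  (forall i, smooth_near x (f i)) -> smooth_near x (fun y => \sum_i f i y).
Proof.
move=> fI.
have : forall s : seq I, smooth_near x (fun y => \sum_(i <- s) f i y).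
  elim=> [|i s IH].
    apply: smooth_near_eq (smooth_near_cst x 0).
    by apply: nearW => y; rewrite big_nil.
  apply: smooth_near_eq (smooth_nearD (fI i) IH).
  by apply: nearW => y; rewrite big_cons.
exact.
Qed.

Lemma smooth_nearV V x (f : V -> R) : f x != 0 ->
  smooth_near x f -> smooth_near x (fun y => (f y)^-1).
Proof.
move=> fx0 [A [Ao Ax] fA].
pose B := A `&` [set y | f y != 0].
have Bo : open B.
  rewrite openE => y [Ay fy0].
  have fc : {for y, continuous f} by exact: (fA 0).
  have h1 : nbhs y A by exact: open_nbhs_nbhs.
  have h2 : \forall z \near y, f z != 0 by exact: cvgr_neq0 fc fy0.
  exact: filterI h1 h2.
exists B => // k; apply: Ck_inv => //; first by move=> y [].
by apply: Ck_sub (fA k) => y [].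
Qed.

Lemma smooth_near_pair V U W {fU : framed U} {fW : framed W} x (f : V -> U)
    (g : V -> W) : smooth_near x f -> smooth_near x g ->
  smooth_near x (fun y => (f y, g y)).
Proof.
move=> fx gx.
have l1 : linear (fun u : U => (u, 0 : W)).
  by move=> a u v; apply/pair_equal_spec; rewrite /= scaler0 addr0.
have l2 : linear (fun u : W => (0 : U, u)).
  by move=> a u v; apply/pair_equal_spec; rewrite /= scaler0 addr0.
apply: smooth_near_eq (smooth_nearD (smooth_near_lin l1 fx) (smooth_near_lin l2 gx)).
by apply: nearW => y; apply/pair_equal_spec; rewrite /= addr0 add0r.
Qed.

Lemma smooth_near_fst V U W {fU : framed U} {fW : framed W} x (f : V -> U * W) :
  smooth_near x f -> smooth_near x (fun y => (f y).1).
Proof. exact: (smooth_near_lin (L := fst)). Qed.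

Lemma smooth_near_snd V U W {fU : framed U} {fW : framed W} x (f : V -> U * W) :
  smooth_near x f -> smooth_near x (fun y => (f y).2).
Proof. exact: (smooth_near_lin (L := snd)). Qed.

Lemma smooth_near_proj1 U W {fU : framed U} {fW : framed W} (y0 : U * W) :
  smooth_near y0 (fun y : U * W => y.1).
Proof. by apply: (smooth_near_fst (f := id)); exact: smooth_near_id. Qed.

Lemma smooth_near_proj2 U W {fU : framed U} {fW : framed W} (y0 : U * W) :
  smooth_near y0 (fun y : U * W => y.2).
Proof. by apply: (smooth_near_snd (f := id)); exact: smooth_near_id. Qed.

Lemma smooth_near_mulmx V m n p x (f : V -> 'M[R]_(m, n)) (g : V -> 'M[R]_(n, p)) :
  smooth_near x f -> smooth_near x g -> smooth_near x (fun y => f y *m g y).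
Proof.
apply: (smooth_near_bilin (b := @mulmx R m n p)) => y a u v.
  by rewrite mulmxDr -scalemxAr.
by rewrite mulmxDl -scalemxAl.
Qed.

Lemma smooth_near_entry V m n x (f : V -> 'M[R]_(m, n)) i j :
  smooth_near x f -> smooth_near x (fun y => f y i j).
Proof.
move=> fx; apply: (smooth_near_lin (L := fun A : 'M[R]_(m, n) => A i j)) fx.
by move=> a A B; rewrite !mxE.
Qed.

Lemma smooth_near_coord V W {fW : framed W} x (f : V -> W) :
  (forall i, smooth_near x (fun y => fcoord i (f y))) -> smooth_near x f.
Proof.
move=> fx.
have h := smooth_near_sum (fun i => smooth_nearZ (fx i) (smooth_near_cst x (fvec i))).
by apply: smooth_near_eq h; apply: nearW => y; rewrite -frameE.
Qed.

Lemma derive_dir_frame V W {fV : framed V} x (f : V -> W) v : differentiable f x ->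
  'D_v f x = \sum_i fcoord i v *: 'D_(fvec i) f x.
Proof.
move=> df; rewrite deriveE// {1}(frameE v) linear_sumE; last first.
  by move=> a u w; rewrite linearP.
by apply: eq_bigr => i _; rewrite linearZ deriveE.
Qed.

(** By the chain rule and [derive_dir_frame], a directional derivative of [g \o f]
    is a finite sum of products of coordinates of the derivative of [f] and of
    compositions of a partial derivative of [g] with [f], to which the induction
    hypothesis applies. *)
Lemma Ck_comp V U W {fU : framed U} k (A : set V) (B : set U) (f : V -> U)
    (g : U -> W) : open A -> (forall x, A x -> B (f x)) ->
  Ck k A f -> Ck k B g -> Ck k A (g \o f).
Proof.
move=> Ao AB; elim: k f g AB => [|k IH] f g AB.
  move=> fc gc x Ax; apply: continuous_comp; first exact: fc.
  by apply: gc; exact: AB.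
move=> fC gC; have [[df Df] [dg Dg]] := (fC, gC); split=> [x Ax|v].
  by apply: differentiable_comp; [exact: df|apply: dg; exact: AB].
have h i : Ck k A (fun x => fcoord i ('D_v f x) *: ('D_(fvec i) g \o f) x).
  apply: Ck_scale => //; last exact: IH (Ck_pred fC) (Dg _).
  exact: (Ck_lin Ao (@fcoord_linear _ _ _ i) (@fcoord_continuous _ _ _ i) (Df v)).
apply: (Ck_eq Ao _ (Ck_sum Ao h)) => x Ax.
rewrite derive_comp; [|exact: df|by apply: dg; exact: AB].
by rewrite derive_dir_frame//; apply: dg; exact: AB.
Qed.

Lemma smooth_near_comp V U W {fU : framed U} x (f : V -> U) (g : U -> W) :
  smooth_near x f -> smooth_near (f x) g -> smooth_near x (fun y => g (f y)).
Proof.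
move=> [A [Ao Ax] fA] [B [Bo Bx] gB].
pose C := A `&` [set y | B (f y)].
have Co : open C.
  rewrite openE => y [Ay By].
  have fc : {for y, continuous f} by exact: (fA 0).
  have h1 : nbhs y A by exact: open_nbhs_nbhs.
  have h2 : \forall z \near y, B (f z) by apply: fc; exact: open_nbhs_nbhs.
  exact: filterI h1 h2.
exists C => // k; apply: (Ck_comp (B := B) (g := g)) => //; first by move=> y [].
by apply: Ck_sub (fA k) => y [].
Qed.

Lemma smooth_near_derive_dir V W {fV : framed V} x (f : V -> W) (v : V -> V) :
  smooth_near x f -> smooth_near x v -> smooth_near x (fun y => 'D_(v y) f y).
Proof.
move=> fx vx.
have h i : smooth_near x (fun y => fcoord i (v y) *: 'D_(fvec i) f y).
  apply: smooth_nearZ; last exact: smooth_near_derive.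
  by apply: smooth_near_lin vx; exact: fcoord_linear.
apply: smooth_near_eq (smooth_near_sum h).
apply: filterS (smooth_near_near fx) => y /smooth_near_diff fy.
by rewrite -derive_dir_frame.
Qed.

Lemma smooth_near_preimage V W x (A : set W) (f : V -> W) :
  smooth_near x f -> (\forall y \near f x, A y) -> \forall y \near x, A (f y).
Proof. by move=> /smooth_near_cont; apply. Qed.

Lemma smooth_near_fcoord W (fW : framed W) (i : fidx W) (x : W) :
  smooth_near x (fcoord i).
Proof.
apply: (smooth_near_lin (f := id)); first exact: fcoord_linear.
exact: smooth_near_id.
Qed.

Lemma derive_fcoord W (fW : framed W) (i : fidx W) (x v : W) :
  'D_v (fcoord i) x = fcoord i v.
Proof.
have d := linear_is_diff x (@fcoord_linear _ _ fW i) (@fcoord_continuous _ _ fW i).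
by rewrite deriveE ?diff_val//; exact: ex_diff.
Qed.

Lemma continuous_norm_lt1 V (x : V) (f : V -> R) :
  {for x, continuous f} -> f x = 0 -> \forall y \near x, `|f y| < 1.
Proof.
move=> fc fx; have h := proj1 (cvgrPdist_lt _ _) fc _ ltr01.
near=> y.
have : `|f x - f y| < 1 by near: y; exact: h.
by rewrite fx sub0r normrN.
Unshelve. all: by end_near. Qed.

End SmoothNear.

(** * Symmetry of second derivatives *)

Section Schwarz.
Context {R : realType}.
Implicit Types U V W : normedModType R.

Lemma line_is_diff V (a u : V) (t : R) :
  is_diff t (fun s : R => a + s *: u) (fun s => s *: u).
Proof.
have h := is_diffD (is_diff_cst a t) (is_diff_scalel t u).
by apply: is_diff_eq; apply/funext => s; rewrite !fctE /= add0r.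
Qed.

Lemma line_derive V W (f : V -> W) a u (t : R) : differentiable f (a + t *: u) ->
  is_derive t 1 (fun s : R => f (a + s *: u)) ('D_u f (a + t *: u)).
Proof.
move=> df; have dl := line_is_diff a u t.
have dc : differentiable (f \o (fun s : R => a + s *: u)) t.
  by apply: differentiable_comp; first exact: ex_diff.
split; first exact: diff_derivable.
have dl' : differentiable (fun s : R => a + s *: u) t by exact: ex_diff.
rewrite [LHS](derive_comp (1 : R) dl' df) (deriveE _ dl').
by rewrite diff_val scale1r.
Qed.

(** The mean value theorem is applied twice: in the direction [u] to the difference
    of [f] along the side [s *: v], then in the direction [v] to the derivative
    that it yields. *)
Lemma second_difference V (f : V -> R) x u v (s : R) : 0 < s ->
  (forall a b : R, 0 <= a <= s -> 0 <= b <= s ->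
     differentiable f (x + a *: u + b *: v) /\
     differentiable (fun y => 'D_u f y) (x + a *: u + b *: v)) ->
  exists a b : R, [/\ 0 <= a <= s, 0 <= b <= s &
    f (x + s *: u + s *: v) - f (x + s *: u) - f (x + s *: v) + f x
    = 'D_v (fun y => 'D_u f y) (x + a *: u + b *: v) * s * s].
Proof.
move=> s0 H.
have ss : 0 <= s <= s by rewrite lexx ltW.
have zs : 0 <= (0:R) <= s by rewrite lexx ltW.
pose phi (a : R) := f (x + s *: v + a *: u) - f (x + a *: u).
pose dphi (a : R) := 'D_u f (x + s *: v + a *: u) - 'D_u f (x + a *: u).
have dphiP (a : R) : 0 <= a <= s -> is_derive a 1 phi (dphi a).
  move=> as_; apply: is_deriveB.
    by apply: line_derive; rewrite addrAC; exact: (H _ _ as_ ss).1.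
  by apply: line_derive; have := (H _ _ as_ zs).1; rewrite scale0r addr0.
have [a /[!in_itv] /= as_ ea] : exists2 c, c \in `[0, s]%R & phi s - phi 0 = dphi c * (s - 0).
  apply: MVT_segment => [|a /[!in_itv] /= /andP[a0 a1]|]; first exact: ltW.
    by apply: dphiP; rewrite !ltW.
  apply: derivable_within_continuous => a /[!in_itv] /= as_.
  by have [] := dphiP a as_.
pose psi (b : R) := 'D_u f (x + a *: u + b *: v).
pose dpsi (b : R) := 'D_v (fun y => 'D_u f y) (x + a *: u + b *: v).
have dpsiP (b : R) : 0 <= b <= s -> is_derive b 1 psi (dpsi b).
  by move=> bs; apply: (line_derive (f := fun y => 'D_u f y)); exact: (H _ _ as_ bs).2.
have [b /[!in_itv] /= bs eb] : exists2 c, c \in `[0, s]%R & psi s - psi 0 = dpsi c * (s - 0).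
  apply: MVT_segment => [|b /[!in_itv] /= /andP[b0 b1]|]; first exact: ltW.
    by apply: dpsiP; rewrite !ltW.
  apply: derivable_within_continuous => b /[!in_itv] /= bs.
  by have [] := dpsiP b bs.
exists a, b; split=> //.
have e1 : dphi a = psi s - psi 0.
  by rewrite /dphi /psi scale0r addr0 addrAC.
rewrite -[X in X * s * s]/(dpsi b) -[X in _ = X * s * s]/(dpsi b).
rewrite -[X in _ = _ * X * s](subr0 s) -eb -e1 -[X in _ = _ * X](subr0 s) -ea.
rewrite /phi scale0r !addr0 (addrAC x (s *: v)); ring.
Qed.

(** By [second_difference] in both orders, one and the same second difference is
    [s * s] times each of the two mixed derivatives, at points of a given ball
    around [x]; both derivatives are continuous at [x]. *)
Lemma schwarz V (f : V -> R) x u v : smooth_near x f ->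
  'D_u (fun y => 'D_v f y) x = 'D_v (fun y => 'D_u f y) x.
Proof.
move=> fx.
have fu := smooth_near_derive u fx; have fv := smooth_near_derive v fx.
have cu := smooth_near_cont (smooth_near_derive v fu).
have cv := smooth_near_cont (smooth_near_derive u fv).
set F := fun y => 'D_v (fun y => 'D_u f y) y in cu.
set G := fun y => 'D_u (fun y => 'D_v f y) y in cv.
rewrite -[LHS]/(G x) -[RHS]/(F x).
apply/eqP; rewrite -subr_eq0 -normr_eq0 eq_le normr_ge0 andbT.
apply/ler_addgt0Pr => e e0; rewrite add0r.
have e2 : 0 < e / 2 by rewrite divr_gt0.
have n1 : \forall y \near x, `|F x - F y| < e / 2.
  exact: (proj1 (cvgrPdist_lt _ _) cu _ e2).
have n2 : \forall y \near x, `|G x - G y| < e / 2.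
  exact: (proj1 (cvgrPdist_lt _ _) cv _ e2).
have n3 : \forall y \near x, differentiable f y.
  by apply: filterS (smooth_near_near fx) => y /smooth_near_diff.
have n4 : \forall y \near x, differentiable (fun y => 'D_u f y) y.
  by apply: filterS (smooth_near_near fu) => y /smooth_near_diff.
have n5 : \forall y \near x, differentiable (fun y => 'D_v f y) y.
  by apply: filterS (smooth_near_near fv) => y /smooth_near_diff.
have : \forall y \near x, (`|F x - F y| < e / 2 /\ `|G x - G y| < e / 2) /\
   (differentiable f y /\
   (differentiable (fun y => 'D_u f y) y /\ differentiable (fun y => 'D_v f y) y)).
  exact: filterI (filterI n1 n2) (filterI n3 (filterI n4 n5)).
move=> /nbhs_ballP[d /= d0 Hd].
(* With this s, the parallelogram at x with sides s *: u and s *: v lies in the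
   ball of radius d. *)
pose k := `|u| + `|v| + 1.
have k0 : 0 < k by rewrite ltr_wpDl// addr_ge0.
pose s := d / k / 2.
have s0 : 0 < s by rewrite !divr_gt0.
have inb (a b : R) : 0 <= a <= s -> 0 <= b <= s -> ball x d (x + a *: u + b *: v).
  move=> /andP[a0 as_] /andP[b0 bs]; rewrite -ball_normE /=.
  rewrite -addrA opprD addNKr normrN.
  apply: le_lt_trans (ler_normD _ _) _; rewrite !normrZ !ger0_norm//.
  apply: (@le_lt_trans _ _ (s * (`|u| + `|v|))).
    by rewrite mulrDr lerD// ler_wpM2r.
  apply: (@lt_le_trans _ _ (s * k)); first by rewrite ltr_pM2l// /k ltrDl.
  have -> : s * k = d / 2 by rewrite /s; field; rewrite gt_eqF.
  by lra.
have inb' (a b : R) : 0 <= a <= s -> 0 <= b <= s -> ball x d (x + a *: v + b *: u).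
  by move=> ? ?; rewrite addrAC; exact: inb.
have [a [b [as_ bs e1]]] : exists a b : R, [/\ 0 <= a <= s, 0 <= b <= s &
    f (x + s *: u + s *: v) - f (x + s *: u) - f (x + s *: v) + f x
    = F (x + a *: u + b *: v) * s * s].
  apply: second_difference => // a b as_ bs.
  by have [_ [? [? _]]] := Hd _ (inb a b as_ bs).
have [a' [b' [as' bs' e3]]] : exists a b : R, [/\ 0 <= a <= s, 0 <= b <= s &
    f (x + s *: v + s *: u) - f (x + s *: v) - f (x + s *: u) + f x
    = G (x + a *: v + b *: u) * s * s].
  apply: second_difference => // a' b' as' bs'.
  by have [_ [? [_ ?]]] := Hd _ (inb' a' b' as' bs').
have eFG : F (x + a *: u + b *: v) = G (x + a' *: v + b' *: u).
  have sn : s != 0 by rewrite gt_eqF.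
  move: e1 e3; rewrite (addrAC x (s *: v)).
  move: (F _) (G _) (f (_ + s *: v)) (f (_ + s *: v)) (f (x + s *: u)) (f x) => F0 G0 f1 f2 f3 f4 e1 e3.
  apply: (mulIf sn); apply: (mulIf sn); rewrite -e1 -e3.
  ring.
have [[h1 _] _] := Hd _ (inb a b as_ bs).
have [[_ h2] _] := Hd _ (inb' a' b' as' bs').
rewrite eFG in h1.
set q := G _ in h1; rewrite -/q in h2.
move: h1 h2; set g := G x; set h := F x => h1 h2.
apply: ltW; rewrite (_ : g - h = (g - q) - (h - q)); last by rewrite opprB addrA subrK.
apply: le_lt_trans (ler_normB _ _) _.
by rewrite (splitr e); exact: (ltrD h2 h1).
Qed.

End Schwarz.

(* Unfolding these, unification would compare differentials of charts. *)
Local Opaque diff derive mx_of.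

(** * Rules for directional derivatives *)

Section DeriveRules.
Context {R : realType}.
Implicit Types V W : normedModType R.

Lemma derive_scale V W (h : V -> R) (f : V -> W) x v :
  differentiable h x -> differentiable f x ->
  'D_v (fun y => h y *: f y) x = 'D_v h x *: f x + h x *: 'D_v f x.
Proof.
move=> dh df.
exact: (derive_bilin v (@scale_linr R W) (@scale_linl R W) (@scale_continuous R W) dh df).2.
Qed.

Lemma derive_mulmx V m n p (f : V -> 'M[R]_(m, n)) (g : V -> 'M[R]_(n, p)) x v :
  differentiable f x -> differentiable g x ->
  'D_v (fun y => f y *m g y) x = 'D_v f x *m g x + f x *m 'D_v g x.
Proof.
move=> df dg.
have l1 (A : 'M[R]_(m, n)) : linear (fun B : 'M[R]_(n, p) => A *m B).
  by move=> a u w; rewrite mulmxDr -scalemxAr.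
have l2 (B : 'M[R]_(n, p)) : linear (fun A : 'M[R]_(m, n) => A *m B).
  by move=> a u w; rewrite mulmxDl -scalemxAl.
exact: (derive_bilin v l1 l2 (framed_bilinear_continuous l1 l2) df dg).2.
Qed.

Lemma derive_fun_lin V U W {fU : framed U} (f : V -> U) (L : U -> W) x v :
  linear L -> differentiable f x -> 'D_v (fun y => L (f y)) x = L ('D_v f x).
Proof.
move=> Ll df.
exact: (derive_lin v Ll (framed_linear_continuous Ll) df).2.
Qed.

Lemma derive_linear U W {fU : framed U} (L : U -> W) x v : linear L -> 'D_v L x = L v.
Proof.
move=> Ll; have d := linear_is_diff x Ll (framed_linear_continuous Ll).
by rewrite deriveE ?diff_val//; exact: ex_diff.
Qed.

Lemma derive_pair V U W {fU : framed U} {fW : framed W} (f : V -> U * W) x v :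
  differentiable f x ->
  'D_v f x = ('D_v (fun y => (f y).1) x, 'D_v (fun y => (f y).2) x).
Proof.
by move=> df; rewrite !derive_fun_lin//; case: ('D_v f x).
Qed.

(** For maps that are affine along one line only, such as quadratic expressions
    along a direction in which they are linear. *)
Lemma derive_line_unique V W (f : V -> W) x v w : differentiable f x ->
  (forall t : R, f (x + t *: v) = f x + t *: w) -> 'D_v f x = w.
Proof.
move=> df fl.
have df0 : differentiable f (x + (0 : R) *: v) by rewrite scale0r addr0.
have := @derive_val _ _ _ _ _ _ _ (line_derive df0); rewrite scale0r addr0 => <-.
rewrite (_ : (fun s : R => _) = (fun s => f x + s *: w)); last by apply/funext.
have dl := line_is_diff (f x) w (0 : R).
by rewrite deriveE ?diff_val ?scale1r//; exact: ex_diff.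
Qed.

Lemma derive_add V W (f g : V -> W) x v : differentiable f x -> differentiable g x ->
  'D_v (fun y => f y + g y) x = 'D_v f x + 'D_v g x.
Proof. by move=> df dg; apply: deriveD; exact: diff_derivable. Qed.

Lemma derive_sub V W (f g : V -> W) x v : differentiable f x -> differentiable g x ->
  'D_v (fun y => f y - g y) x = 'D_v f x - 'D_v g x.
Proof. by move=> df dg; apply: deriveB; exact: diff_derivable. Qed.

End DeriveRules.

Section Families.
Context {R : realType}.
Implicit Types V W : normedModType R.

Lemma smooth_near_family V U W {fU : framed U} x (L : V -> U -> W) (w : V -> U) :
  (\forall y \near x, linear (L y)) -> (forall u, smooth_near x (fun y => L y u)) ->
  smooth_near x w -> smooth_near x (fun y => L y (w y)).
Proof.
move=> Ll sL sw.
have h i : smooth_near x (fun y => fcoord i (w y) *: L y (fvec i)).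
  apply: smooth_nearZ (sL _); apply: smooth_near_lin sw; exact: fcoord_linear.
apply: smooth_near_eq (smooth_near_sum h); apply: near_mono Ll => y Ly.
rewrite [in RHS](frameE (w y)) (linear_sumE _ Ly).
by apply: eq_bigr => i _; rewrite (linear_scaleE Ly).
Qed.

Lemma derive_sum V W (I : finType) (f : I -> V -> W) x v :
  (forall i, differentiable (f i) x) ->
  'D_v (fun y => \sum_i f i y) x = \sum_i 'D_v (f i) x.
Proof.
move=> df.
suff h (s : seq I) : differentiable (fun y => \sum_(i <- s) f i y) x /\
    'D_v (fun y => \sum_(i <- s) f i y) x = \sum_(i <- s) 'D_v (f i) x.
  exact: (h _).2.
elim: s => [|i s [IH1 IH2]].
  rewrite (_ : (fun y => _) = cst 0); last by apply/funext => y; rewrite big_nil.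
  by rewrite big_nil derive_cst; split; first exact: differentiable_cst.
rewrite (_ : (fun y => _) = (f i + (fun y => \sum_(j <- s) f j y))); last first.
  by apply/funext => y; rewrite big_cons.
split; first exact: differentiableD.
by rewrite deriveD ?IH2 ?big_cons//; exact: diff_derivable.
Qed.

(** The product rule for Christoffel matrices and for the almost complex structure
    of the twistor space, which are families of linear maps depending smoothly
    on the point rather than one bilinear map. *)
Lemma derive_family V U W {fU : framed U} x (L : V -> U -> W) (w : V -> U) v :
  (\forall y \near x, linear (L y)) -> (forall u, smooth_near x (fun y => L y u)) ->
  smooth_near x w ->
  'D_v (fun y => L y (w y)) x = 'D_v (fun y => L y (w x)) x + L x ('D_v w x).
Proof.
move=> Ll sL sw; have Lx := near_self Ll.
have dL u := smooth_near_diff (sL u); have dw := smooth_near_diff sw.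
have expand (w' : V -> U) : smooth_near x w' ->
    'D_v (fun y => L y (w' y)) x =
    \sum_i ('D_v (fun y => fcoord i (w' y)) x *: L x (fvec i) +
            fcoord i (w' x) *: 'D_v (fun y => L y (fvec i)) x).
  move=> sw'.
  have sc i : smooth_near x (fun y => fcoord i (w' y)).
    by apply: smooth_near_lin sw'; exact: fcoord_linear.
  have e : \forall y \near x, L y (w' y) = \sum_i fcoord i (w' y) *: L y (fvec i).
    apply: near_mono Ll => y Ly; rewrite {1}(frameE (w' y)) (linear_sumE _ Ly).
    by apply: eq_bigr => i _; rewrite (linear_scaleE Ly).
  rewrite (near_eq_derive v e) derive_sum => [|i].
    by apply: eq_bigr => i _; apply: derive_scale; [exact: smooth_near_diff|exact: dL].
  exact: smooth_near_diff (smooth_nearZ (sc i) (sL _)).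
rewrite (expand w sw) (expand (fun=> w x) (smooth_near_cst x (w x))).
rewrite [in RHS](frameE ('D_v w x)) (linear_sumE _ Lx) -big_split /=.
apply: eq_bigr => i _; rewrite derive_cst scale0r add0r addrC; congr (_ + _).
by rewrite (linear_scaleE Lx) (derive_fun_lin v (@fcoord_linear _ _ fU i) dw).
Qed.

Lemma near_linear_derive V W x (g : V -> W) : smooth_near x g ->
  \forall y \near x, linear (fun v => 'D_v g y).
Proof.
move=> /smooth_near_near; apply: near_mono => y /smooth_near_diff dg a u v.
exact: derive_direction_lin.
Qed.

Lemma derive_derive_dir V W {fV : framed V} x (g : V -> W) (w : V -> V) a :
  smooth_near x g -> smooth_near x w ->
  'D_a (fun y => 'D_(w y) g y) x =
  'D_a (fun y => 'D_(w x) g y) x + 'D_('D_a w x) g x.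
Proof.
move=> sg sw.
exact: (derive_family a (near_linear_derive sg) (fun u => smooth_near_derive u sg) sw).
Qed.

Lemma schwarz_mx V k n (f : V -> 'M[R]_(k, n)) x a b : smooth_near x f ->
  'D_a (fun y => 'D_b f y) x = 'D_b (fun y => 'D_a f y) x.
Proof.
move=> sf; apply/matrixP => i j.
have Ll : linear (fun A : 'M[R]_(k, n) => A i j) by move=> c A B; rewrite !mxE.
have h c d : ('D_c (fun y => 'D_d f y) x) i j = 'D_c (fun y => 'D_d (fun y => f y i j) y) x.
  rewrite -(derive_fun_lin c Ll (smooth_near_diff (smooth_near_derive d sf))).
  apply: near_eq_derive; apply: near_mono (smooth_near_near sf) => y /smooth_near_diff df.
  by rewrite (derive_fun_lin d Ll df).
by apply: etrans (h a b) (etrans _ (esym (h b a))); apply: schwarz; exact: smooth_near_entry.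
Qed.

Definition vf_bracket V (a b : V -> V) (x : V) : V := 'D_(a x) b x - 'D_(b x) a x.

(** The second derivatives of [g] cancel by Schwarz's theorem: a commutator of
    derivations is the derivation along the bracket of the vector fields. *)
Lemma derive_commutator V {fV : framed V} x (g : V -> R) (a b : V -> V) :
  smooth_near x g -> smooth_near x a -> smooth_near x b ->
  'D_(a x) (fun y => 'D_(b y) g y) x - 'D_(b x) (fun y => 'D_(a y) g y) x =
  'D_(vf_bracket a b x) g x.
Proof.
move=> sg sa sb; rewrite (derive_derive_dir (a x) sg sb) (derive_derive_dir (b x) sg sa).
rewrite (schwarz (a x) (b x) sg).
rewrite opprD addrACA subrr add0r /vf_bracket.
have h := derive_direction_lin (-1) ('D_(b x) a x) ('D_(a x) b x) (smooth_near_diff sg).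
by rewrite !scaleN1r addrC in h; rewrite h addrC.
Qed.

End Families.


(** * Charts *)

Section Charts.
Context {R : realType} {m : nat} {M : manifold R m}.
Implicit Types (p q r : M) (x v : 'cV[R]_m).

Lemma mx_ofE (f : 'cV[R]_m -> 'cV[R]_m) v : linear f -> mx_of f *m v = f v.
Proof.
move=> fl; rewrite [in RHS](matrix_sum_delta v).
under eq_bigr do rewrite big_ord1.
rewrite (linear_sumE _ fl); apply/matrixP => i j; rewrite !ord1 !mxE summxE.
by apply: eq_bigr => k _; rewrite linear_scaleE// !mxE mulrC.
Qed.

Lemma mx_of_unique (f : 'cV[R]_m -> 'cV[R]_m) (A : 'M[R]_m) :
  (forall v, f v = A *m v) -> mx_of f = A.
Proof.
move=> fA; apply/matrixP => i j; rewrite mxE fA mxE (bigD1 j)//= big1 => [|k kj].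
  by rewrite mxE !eqxx mulr1 addr0.
by rewrite mxE (negPf kj) mulr0.
Qed.

Lemma mulmx_ext (A B : 'M[R]_m) : (forall v : 'cV[R]_m, A *m v = B *m v) -> A = B.
Proof.
move=> AB; apply/matrixP => i j.
by have := AB (delta_mx j 0); rewrite -!colE => /colP/(_ i); rewrite !mxE.
Qed.

Lemma invmx_mul (A B : 'M[R]_m) : A \in unitmx -> B \in unitmx ->
  invmx (A *m B) = invmx B *m invmx A.
Proof.
move=> uA uB; have uAB : A *m B \in unitmx by rewrite unitmx_mul uA.
by rewrite -[RHS](mulmxK uAB) !mulmxA (mulmxKV uA) (mulVmx uB) mul1mx.
Qed.

Lemma dom_self p : dom p p.
Proof. by have [] := dom_nbhs p. Qed.
Hint Resolve dom_self : core.

Lemma dom_near p r : dom p r -> \forall q \near r, dom p q.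
Proof. by move=> pr; apply: open_nbhs_nbhs; split=> //; have [] := dom_nbhs p. Qed.

Lemma unchart_near p r (A : set M) : dom p r -> (\forall q \near r, A q) ->
  \forall x \near chart p r, A (unchart p x).
Proof.
move=> pr rA.
have : {for chart p r, continuous (unchart p)}.
  by apply: unchart_continuous; exists r.
by apply; rewrite chartK.
Qed.

Lemma chart_near p r : dom p r ->
  \forall x \near chart p r, dom p (unchart p x) /\ chart p (unchart p x) = x.
Proof.
move=> pr; have : nbhs (chart p r) (chart p @` dom p).
  by apply: open_nbhs_nbhs; split; [exact: chart_open|exists r].
by apply: near_mono => x [q pq <-]; rewrite chartK.
Qed.

Definition trans p q : 'cV[R]_m -> 'cV[R]_m := chart q \o unchart p.

Lemma transE p q r : dom p r -> trans p q (chart p r) = chart q r.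
Proof. by move=> pr; rewrite /trans /= chartK. Qed.

Lemma trans_smooth p q r : dom p r -> dom q r -> smooth_near (chart p r) (trans p q).
Proof.
move=> pr qr.
have : nbhs (chart p r) (chart p @` (dom p `&` dom q)).
  apply: near_mono2 (chart_near pr) (unchart_near pr (dom_near qr)) => x [px xe] qx.
  by exists (unchart p x).
rewrite nbhsE => -[A Ax Asub]; exists A => // k.
by apply: Ck_sub (@transition_smooth _ _ M p q k).
Qed.

(** Locked, since otherwise unification unfolds it to a differential. *)
Definition jac_def p q x : 'M[R]_m := mx_of ('d (trans p q) x).
Fact jac_key : unit. Proof. by []. Qed.
Definition jac := locked_with jac_key jac_def.
Canonical jac_unlockable := [unlockable fun jac].

Lemma tcoordE p q : tcoord p q = jac q p (chart q q).
Proof. by rewrite unlock. Qed.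

Lemma jacE p q x v : differentiable (trans p q) x ->
  jac p q x *m v = 'D_v (trans p q) x.
Proof.
by move=> d; rewrite unlock mx_ofE ?deriveE// => a u w; rewrite linearP.
Qed.

Lemma jac_comp p q s r : dom p r -> dom q r -> dom s r ->
  jac q s (chart q r) *m jac p q (chart p r) = jac p s (chart p r).
Proof.
move=> pr qr sr; apply: mulmx_ext => v; rewrite -mulmxA.
have d1 := smooth_near_diff (trans_smooth pr qr).
have d2 := smooth_near_diff (trans_smooth qr sr).
have d3 := smooth_near_diff (trans_smooth pr sr).
rewrite (jacE v d1) (jacE _ d2) (jacE v d3).
have e : trans p q (chart p r) = chart q r := transE q pr.
rewrite -e in d2 *; rewrite -(derive_comp v d1 d2).
apply: near_eq_derive.
apply: near_mono (unchart_near pr (dom_near qr)) => x qx.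
by rewrite /trans /= chartK.
Qed.

Lemma jac_id p r : dom p r -> jac p p (chart p r) = 1%:M.
Proof.
move=> pr; apply: mulmx_ext => v; rewrite mul1mx jacE; last first.
  exact: smooth_near_diff (trans_smooth pr pr).
rewrite -[RHS](derive_id (chart p r) v); apply: near_eq_derive.
by apply: near_mono (chart_near pr) => x [].
Qed.

Lemma tcoord_id p : tcoord p p = 1%:M.
Proof. by rewrite tcoordE jac_id. Qed.

Lemma tcoord_jac p q r : dom p r -> dom q r ->
  jac p q (chart p r) *m tcoord p r = tcoord q r.
Proof. by move=> pr qr; rewrite !tcoordE jac_comp. Qed.

Lemma jac_unit p q r : dom p r -> dom q r -> jac p q (chart p r) \in unitmx.
Proof.
move=> pr qr; suff /mulmx1_unit[] : jac p q (chart p r) *m jac q p (chart q r) = 1%:M by [].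
by rewrite jac_comp// jac_id.
Qed.

Lemma jac_inv p q r : dom p r -> dom q r ->
  invmx (jac p q (chart p r)) = jac q p (chart q r).
Proof.
move=> pr qr; have u := jac_unit pr qr.
rewrite -[RHS]mulmx1 -(mulmxV u) mulmxA jac_comp// jac_id// mul1mx//.
Qed.

Lemma tcoord_unit p r : dom p r -> tcoord p r \in unitmx.
Proof. by move=> pr; rewrite tcoordE jac_unit. Qed.

Lemma jac_smooth p q r : dom p r -> dom q r -> smooth_near (chart p r) (jac p q).
Proof.
move=> pr qr; have ts := trans_smooth pr qr.
apply: smooth_near_coord => -[i j] /=.
have h : smooth_near (chart p r) (fun x => 'D_(delta_mx j 0) (trans p q) x i 0).
  by apply: smooth_near_entry; exact: smooth_near_derive.
apply: smooth_near_eq h; apply: near_mono (smooth_near_near ts) => x /smooth_near_diff d.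
by rewrite unlock mxE deriveE.
Qed.

Lemma smooth_near_chart (W : normedModType R) p q r (h : M -> W) :
  dom p r -> dom q r ->
  smooth_near (chart p r) (h \o unchart p) -> smooth_near (chart q r) (h \o unchart q).
Proof.
move=> pr qr hp.
have h1 : smooth_near (chart q r) (fun x => (h \o unchart p) (trans q p x)).
  by apply: smooth_near_comp; [exact: trans_smooth|rewrite transE].
apply: smooth_near_eq h1.
apply: near_mono (unchart_near qr (dom_near pr)) => x px.
by rewrite /= /trans /= chartK.
Qed.

Lemma derive_chart (W : normedModType R) p q r (h : M -> W) v :
  dom p r -> dom q r -> smooth_near (chart p r) (h \o unchart p) ->
  'D_v (h \o unchart q) (chart q r) =
  'D_(jac q p (chart q r) *m v) (h \o unchart p) (chart p r).
Proof.
move=> pr qr hp; have ts := smooth_near_diff (trans_smooth qr pr).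
have dh := smooth_near_diff hp.
have e : trans q p (chart q r) = chart p r := transE p qr.
rewrite (jacE v ts); rewrite -e in dh *; rewrite -(derive_comp v ts dh).
apply: near_eq_derive.
apply: near_mono (unchart_near qr (dom_near pr)) => x px.
by rewrite /= /trans /= chartK.
Qed.

Lemma vloc_chart p q r (X : vfield M) : dom p r -> dom q r ->
  \forall x \near chart q r,
    vloc q X x = jac p q (trans q p x) *m vloc p X (trans q p x).
Proof.
move=> pr qr.
apply: near_mono2 (chart_near qr) (unchart_near qr (dom_near pr)) => x [qx _] px.
by rewrite /vloc mulmxA /trans /= chartK// tcoord_jac.
Qed.

Lemma smooth_vloc p q r (X : vfield M) : dom p r -> dom q r ->
  smooth_near (chart p r) (vloc p X) -> smooth_near (chart q r) (vloc q X).
Proof.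
move=> pr qr sX.
apply: (@smooth_near_eq _ _ _ _ (fun x => jac p q (trans q p x) *m vloc p X (trans q p x))).
  by apply: near_mono (vloc_chart X pr qr) => x ->.
apply: smooth_near_mulmx; apply: smooth_near_comp; rewrite ?transE//; try exact: trans_smooth.
exact: jac_smooth.
Qed.

Lemma eloc_chart p q r (A : endfield M) : dom p r -> dom q r ->
  \forall x \near chart q r,
    eloc q A x = jac p q (trans q p x) *m eloc p A (trans q p x) *m jac q p x.
Proof.
move=> pr qr.
apply: near_mono2 (chart_near qr) (unchart_near qr (dom_near pr)) => x [qx xe] px.
rewrite /eloc /trans /= chartK// -[X in jac q p X]xe.
rewrite -(tcoord_jac px qx) -(jac_inv px qx) !mulmxA.
have u1 := jac_unit px qx; have u2 := tcoord_unit px.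
by rewrite invmx_mul// !mulmxA.
Qed.

Lemma smooth_eloc p q r (A : endfield M) : dom p r -> dom q r ->
  smooth_near (chart p r) (eloc p A) -> smooth_near (chart q r) (eloc q A).
Proof.
move=> pr qr sA.
apply: (@smooth_near_eq _ _ _ _ (fun x => jac p q (trans q p x) *m eloc p A (trans q p x) *m jac q p x)).
  by apply: near_mono (eloc_chart A pr qr) => x ->.
apply: smooth_near_mulmx; last exact: jac_smooth.
apply: smooth_near_mulmx; apply: smooth_near_comp; rewrite ?transE//; try exact: trans_smooth.
exact: jac_smooth.
Qed.

End Charts.

(** * Linear connections in a chart *)

Lemma conj_mulmx (F : comUnitRingType) m k (D A : 'M[F]_m) (v : 'M[F]_(m, k)) :
  D \in unitmx -> (D *m A *m invmx D) *m (D *m v) = D *m (A *m v).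
Proof. by move=> u; rewrite -!mulmxA (mulKmx u). Qed.

Lemma conj_mulmx_mul (F : comUnitRingType) m (D A B : 'M[F]_m) : D \in unitmx ->
  (D *m A *m invmx D) *m (D *m B *m invmx D) = D *m (A *m B) *m invmx D.
Proof. by move=> u; rewrite -!mulmxA (mulKmx u). Qed.

Section Connection.
Context {R : realType} {m : nat} {M : manifold R m}.
Variable nabla : vfield M -> vfield M -> vfield M.
Hypothesis hn : is_connection nabla.
Implicit Types (p q r : M) (x v u : 'cV[R]_m) (X Y : vfield M).

Lemma smooth_vfield_eq p X Y : (\forall q \near p, X q = Y q) ->
  smooth_vfield p X -> smooth_vfield p Y.
Proof.
move=> XY; have h := unchart_near (dom_self p) XY.
apply: (@smooth_near_eq _ _ _ _ (vloc p X)).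
by apply: near_mono h => x e; rewrite /vloc e.
Qed.

Lemma smooth_vfieldD p X Y : smooth_vfield p X -> smooth_vfield p Y ->
  smooth_vfield p (fun q => X q + Y q).
Proof.
move=> sX sY; apply: smooth_near_eq (smooth_nearD sX sY).
by apply: near_all => x; rewrite /vloc mulmxDr.
Qed.

Lemma smooth_vfieldZ p f X : smooth_fun p f -> smooth_vfield p X ->
  smooth_vfield p (fun q => f q *: X q).
Proof.
move=> sf sX; apply: smooth_near_eq (smooth_nearZ sf sX).
by apply: near_all => x; rewrite /vloc -scalemxAr.
Qed.

Lemma smooth_vfield0 p : smooth_vfield (M := M) p (fun=> 0).
Proof.
apply: smooth_near_eq (smooth_near_cst _ 0).
by apply: near_all => x; rewrite /vloc mulmx0.
Qed.

Lemma smooth_vfield_sum p (I : finType) (s : seq I) (X : I -> vfield M) :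
  (forall i, smooth_vfield p (X i)) ->
  smooth_vfield p (fun q => \sum_(i <- s) X i q).
Proof.
move=> sX; elim: s => [|i s IH].
  by apply: smooth_vfield_eq (smooth_vfield0 p); apply: near_all => q; rewrite big_nil.
apply: smooth_vfield_eq (smooth_vfieldD (sX i) IH).
by apply: near_all => q; rewrite big_cons.
Qed.

Lemma smooth_fun_cst p (c : R) : smooth_fun (M := M) p (fun=> c).
Proof. exact: smooth_near_cst. Qed.

(** Multiplying a field by this function changes nothing near [p] and erases what
    the field is away from [A]: the Leibniz rule then makes a connection local. *)
Lemma indic_smooth p (A : set M) : (\forall q \near p, A q) ->
  smooth_fun p (fun q => `[< A q >]%:R : R) /\
  forall v, dirder p v (fun q => `[< A q >]%:R : R) = 0.
Proof.
move=> pA; have h := unchart_near (dom_self p) pA.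
have e : \forall x \near chart p p, 1 = ((fun q => `[< A q >]%:R : R) \o unchart p) x.
  by apply: near_mono h => x Ax; rewrite /= asboolT.
split; first exact: (@smooth_near_eq _ _ _ _ (fun=> 1 : R) _ e (smooth_near_cst _ (1 : R))).
move=> v; rewrite /dirder -[RHS](derive_cst (1 : R) (chart p p) v).
by apply/esym; apply: near_eq_derive.
Qed.

Lemma conn_locall p X X' Y : smooth_vfield p X -> smooth_vfield p Y ->
  (\forall q \near p, X q = X' q) -> nabla X Y p = nabla X' Y p.
Proof.
move=> sX sY XX'; have [sf _] := indic_smooth XX'.
have sX' := smooth_vfield_eq XX' sX.
have := conn_scalel hn sf sX sY; have := conn_scalel hn sf sX' sY.
rewrite asboolT; last exact: near_self XX'.
rewrite !scale1r => <- <-; congr (nabla _ Y p); apply/funext => q.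
by case: asboolP => [->|]; rewrite ?scale0r.
Qed.

Lemma conn_localr p X Y Y' : smooth_vfield p X -> smooth_vfield p Y ->
  (\forall q \near p, Y q = Y' q) -> nabla X Y p = nabla X Y' p.
Proof.
move=> sX sY YY'; have [sf df] := indic_smooth YY'.
have sY' := smooth_vfield_eq YY' sY.
have := conn_leibniz hn sf sX sY; have := conn_leibniz hn sf sX sY'.
rewrite asboolT; last exact: near_self YY'.
rewrite !df !scale0r !addr0 !scale1r => <- <-; congr (nabla X _ p); apply/funext => q.
by case: asboolP => [->|]; rewrite ?scale0r.
Qed.

Lemma conn_zerol p Y : smooth_vfield p Y -> nabla (fun=> 0) Y p = 0.
Proof.
move=> sY; have := conn_scalel hn (smooth_fun_cst p 0) (smooth_vfield0 p) sY.
by rewrite /= !scale0r.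
Qed.

Lemma dirder_cst p v (c : R) : dirder (M := M) p v (fun=> c) = 0.
Proof. exact: derive_cst. Qed.

Lemma conn_zeror p X : smooth_vfield p X -> nabla X (fun=> 0) p = 0.
Proof.
move=> sX; have := conn_leibniz hn (smooth_fun_cst p 0) sX (smooth_vfield0 p).
by rewrite dirder_cst /= !scale0r addr0.
Qed.

Lemma conn_suml p (I : finType) (X : I -> vfield M) Y :
  (forall i, smooth_vfield p (X i)) -> smooth_vfield p Y ->
  nabla (fun q => \sum_i X i q) Y p = \sum_i nabla (X i) Y p.
Proof.
move=> sX sY.
suff h (s : seq I) : nabla (fun q => \sum_(i <- s) X i q) Y p = \sum_(i <- s) nabla (X i) Y p.
  exact: h.
elim: s => [|i s IH].
  have -> : (fun q => \sum_(i <- [::]) X i q) = (fun=> 0) by apply/funext => q; rewrite big_nil.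
  by rewrite big_nil conn_zerol.
rewrite big_cons -IH -conn_addl//; last exact: smooth_vfield_sum.
by congr (nabla _ Y p); apply/funext => q; rewrite big_cons.
Qed.

Lemma conn_sumr p (I : finType) X (Y : I -> vfield M) :
  (forall i, smooth_vfield p (Y i)) -> smooth_vfield p X ->
  nabla X (fun q => \sum_i Y i q) p = \sum_i nabla X (Y i) p.
Proof.
move=> sY sX.
suff h (s : seq I) : nabla X (fun q => \sum_(i <- s) Y i q) p = \sum_(i <- s) nabla X (Y i) p.
  exact: h.
elim: s => [|i s IH].
  have -> : (fun q => \sum_(i <- [::]) Y i q) = (fun=> 0) by apply/funext => q; rewrite big_nil.
  by rewrite big_nil conn_zeror.
rewrite big_cons -IH -conn_addr//; last exact: smooth_vfield_sum.
by congr (nabla X _ p); apply/funext => q; rewrite big_cons.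
Qed.

Lemma vloc_ext p r v : dom p r -> \forall x \near chart p r, vloc p (ext p v) x = v.
Proof.
move=> pr; apply: near_mono (chart_near pr) => x [px _].
by rewrite /vloc /ext mulKVmx// tcoord_unit.
Qed.

Lemma vloc_ext_center p r v : dom p r -> vloc p (ext r v) (chart p r) = tcoord p r *m v.
Proof. by move=> pr; rewrite /vloc (chartK pr) /ext tcoord_id invmx1 mul1mx. Qed.

Lemma smooth_ext p r v : dom p r -> smooth_vfield r (ext p v).
Proof.
move=> pr; apply: (smooth_vloc pr (dom_self r)).
by apply: smooth_near_eq (smooth_near_cst _ v); apply: near_mono (vloc_ext v pr) => x ->.
Qed.

Variable p0 : M.

(** The matrix of [v |-> nabla_u v] on the coordinate fields of the chart at [p0]. The
    sum over the coordinates of [u] makes it linear in [u] at every [x], also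
    outside of the image of the chart. *)
Definition christoffel x u : 'M[R]_m := \sum_i u i 0 *:
  \matrix_(k, j) vloc p0 (nabla (ext p0 (delta_mx i 0)) (ext p0 (delta_mx j 0))) x k 0.

Lemma christoffel_linear x : linear (christoffel x).
Proof.
move=> a u v; rewrite /christoffel scaler_sumr -big_split /=.
by apply: eq_bigr => i _; rewrite !mxE scalerDl scalerA.
Qed.

Lemma christoffel_smooth r u : dom p0 r ->
  smooth_near (chart p0 r) (fun x => christoffel x u).
Proof.
move=> pr; apply: smooth_near_sum => i; apply: smooth_nearZ; first exact: smooth_near_cst.
apply: smooth_near_coord => -[k j] /=.
have := conn_smooth hn (smooth_ext (delta_mx i 0) pr) (smooth_ext (delta_mx j 0) pr).
move=> /(smooth_vloc (dom_self r) pr).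
move=> /(smooth_near_entry k 0) h.
by apply: smooth_near_eq h; apply: near_all => x; rewrite mxE.
Qed.

Lemma field_expand r X : dom p0 r ->
  \forall q \near r, X q =
    \sum_j vloc p0 X (chart p0 q) j 0 *: ext p0 (delta_mx j 0) q.
Proof.
move=> pr; apply: near_mono (dom_near pr) => q pq.
rewrite /ext; under eq_bigr do rewrite scalemxAr.
rewrite -mulmx_sumr -(_ : vloc p0 X (chart p0 q) = \sum_j _); last first.
  by rewrite [LHS]matrix_sum_delta; apply: eq_bigr => j _; rewrite big_ord1.
by rewrite /vloc chartK// mulKmx// tcoord_unit.
Qed.

Lemma smooth_coordinate r X j : dom p0 r -> smooth_vfield r X ->
  smooth_fun r (fun q => vloc p0 X (chart p0 q) j 0).
Proof.
move=> pr sX; apply: (smooth_near_chart pr (dom_self r)).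
have h : smooth_near (chart p0 r) (fun x => vloc p0 X x j 0).
  by apply: smooth_near_entry; exact: smooth_vloc (dom_self r) pr sX.
apply: smooth_near_eq h; apply: near_mono (chart_near pr) => x [_ e].
by rewrite /= e.
Qed.

(** Both fields are expanded in the coordinate fields of the chart, [Y] by the
    Leibniz rule and [X] by tensoriality. *)
Lemma connE r X Y : dom p0 r -> smooth_vfield r X -> smooth_vfield r Y ->
  tcoord p0 r *m nabla X Y r =
    'D_(vloc p0 X (chart p0 r)) (vloc p0 Y) (chart p0 r)
    + christoffel (chart p0 r) (vloc p0 X (chart p0 r)) *m vloc p0 Y (chart p0 r).
Proof.
move=> pr sX sY; set x := chart p0 r.
have u := tcoord_unit pr.
have sE j : smooth_vfield r (ext p0 (delta_mx j 0)) by exact: smooth_ext.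
have sYj j := smooth_coordinate j pr sY; have sXj j := smooth_coordinate j pr sX.
rewrite (conn_localr sX sY (field_expand Y pr)) conn_sumr//; last first.
  by move=> j; exact: smooth_vfieldZ.
have sYl : smooth_near x (vloc p0 Y) by exact: smooth_vloc (dom_self r) pr sY.
have e1 j : tcoord p0 r *m nabla X (fun q => vloc p0 Y (chart p0 q) j 0 *: ext p0 (delta_mx j 0) q) r
    = vloc p0 Y x j 0 *: (christoffel x (vloc p0 X x) *m delta_mx j 0)
      + ('D_(vloc p0 X x) (vloc p0 Y) x) j 0 *: delta_mx j 0.
  rewrite (conn_leibniz hn (sYj j) sX (sE j)) mulmxDr -!scalemxAr; congr (_ *: _ + _ *: _).
  - rewrite (conn_locall sX (sE j) (field_expand X pr)) conn_suml//; last first.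
      by move=> i; exact: smooth_vfieldZ.
    rewrite mulmx_sumr mulmx_suml; apply: eq_bigr => i _.
    rewrite (conn_scalel hn (sXj i) (sE i) (sE j)) -scalemxAr -scalemxAl; congr (_ *: _).
    by rewrite -colE; apply/colP => k; rewrite !mxE /vloc /x chartK// !mxE.
  - rewrite /dirder (derive_chart _ pr (dom_self r)); last first.
      exact: (smooth_near_chart (dom_self r) pr (sYj j)).
    rewrite -tcoordE -/x (_ : tcoord p0 r *m X r = vloc p0 X x); last by rewrite /vloc /x chartK.
    have dY := smooth_near_diff sYl.
    have Ll : linear (fun A : 'cV[R]_m => A j 0) by move=> a A B; rewrite !mxE.
    rewrite -(derive_lin (vloc p0 X x) Ll (framed_linear_continuous Ll) dY).2.
    by apply: near_eq_derive; apply: near_mono (chart_near pr) => y [_ e] /=; rewrite e.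
  - by rewrite /ext mulKVmx.
rewrite mulmx_sumr; under eq_bigr do rewrite e1.
rewrite big_split /= addrC; congr (_ + _).
  by rewrite [RHS]matrix_sum_delta; apply: eq_bigr => j _; rewrite big_ord1.
under eq_bigr do rewrite scalemxAr.
rewrite -mulmx_sumr; congr (_ *m _).
by rewrite [RHS]matrix_sum_delta; apply: eq_bigr => j _; rewrite big_ord1.
Qed.

(** It follows from [connE] and the product rule for the field [A q *m ext r v q]. *)
Lemma nabla_endE r X A : dom p0 r -> smooth_vfield r X -> smooth_endfield r A ->
  let x := chart p0 r in let G := christoffel x (vloc p0 X x) in
  tcoord p0 r *m nabla_end nabla X A r *m invmx (tcoord p0 r) =
    'D_(vloc p0 X x) (eloc p0 A) x + (G *m eloc p0 A x - eloc p0 A x *m G).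
Proof.
move=> pr sX sA x G.
have u := tcoord_unit pr.
have sAl : smooth_near x (eloc p0 A) by exact: smooth_eloc (dom_self r) pr sA.
set K := (RHS); suff -> : nabla_end nabla X A r = invmx (tcoord p0 r) *m K *m tcoord p0 r.
  by rewrite mulmxA mulKVmx// mulmxK.
apply: mx_of_unique => v.
have sv : smooth_vfield r (ext r v) by exact: smooth_ext (dom_self r).
have svl : smooth_near x (vloc p0 (ext r v)) by exact: smooth_vloc (dom_self r) pr sv.
have vA : \forall y \near x, eloc p0 A y *m vloc p0 (ext r v) y
     = vloc p0 (fun q => A q *m ext r v q) y.
  apply: near_mono (chart_near pr) => y [py _].
  by rewrite /eloc /vloc (conj_mulmx _ _ (tcoord_unit py)).
have sAv : smooth_near x (vloc p0 (fun q => A q *m ext r v q)).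
  exact: smooth_near_eq vA (smooth_near_mulmx sAl svl).
have {sAv} sAv : smooth_vfield r (fun q => A q *m ext r v q).
  exact: smooth_vloc pr (dom_self r) sAv.
rewrite -[LHS](mulKmx u) -!mulmxA; congr (_ *m _); rewrite mulmxBr.
rewrite (connE pr sX sAv) -/x.
rewrite -(near_self vA) -(near_eq_derive _ vA).
have -> : tcoord p0 r *m (A r *m nabla X (ext r v) r) =
   eloc p0 A x *m (tcoord p0 r *m nabla X (ext r v) r).
  by rewrite /eloc /x chartK// (conj_mulmx _ _ u).
rewrite (connE pr sX sv) -/x -/G.
have ew : vloc p0 (ext r v) x = tcoord p0 r *m v := vloc_ext_center v pr.
rewrite ew.
set w := tcoord p0 r *m v.
have dA := smooth_near_diff sAl; have dv := smooth_near_diff svl.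
have l1 (B : 'M[R]_m) : linear (fun w : 'cV[R]_m => B *m w).
  by move=> a y z; rewrite mulmxDr -scalemxAr.
have l2 (w' : 'cV[R]_m) : linear (fun B : 'M[R]_m => B *m w').
  by move=> a y z; rewrite mulmxDl -scalemxAl.
rewrite (derive_bilin (vloc p0 X x) l1 l2 (framed_bilinear_continuous l1 l2) dA dv).2.
rewrite ew -/w.
have abel (a b c d : 'cV[R]_m) : a + b + c - (b + d) = a + (c - d).
  by rewrite (addrAC a b c) opprD addrA addrK addrA.
by rewrite /K mulmxDl mulmxBl mulmxDr -!mulmxA abel.
Qed.

Lemma eloc_center q A : eloc q A (chart q q) = A q.
Proof. by rewrite /eloc (chartK (dom_self q)) tcoord_id invmx1 mul1mx mulmx1. Qed.

End Connection.

Lemma nabla_end_center {R : realType} {m : nat} {M : manifold R m}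
    (nabla : vfield M -> vfield M -> vfield M) (q : M) (Y : 'cV[R]_m) (A : endfield M) :
  is_connection nabla -> smooth_endfield q A ->
  let G := christoffel nabla q (chart q q) Y in
  nabla_end nabla (ext q Y) A q =
    'D_Y (eloc q A) (chart q q) + (G *m A q - A q *m G).
Proof.
move=> hn sA; have qq := dom_self q.
have h := nabla_endE hn qq (smooth_ext Y qq) sA; cbv zeta in h; cbv zeta.
by rewrite tcoord_id invmx1 mul1mx mulmx1 (vloc_ext_center Y qq) tcoord_id mul1mx eloc_center in h.
Qed.

(** * The twistor space in a chart *)

Section TwistorCoordinates.
Context {R : realType} {m : nat} {M : manifold R m} {Q : M -> set 'M[R]_m}.
Notation E := ('cV[R]_m * 'M[R]_m)%type.
Notation tw := (twistor Q).
Implicit Types (p q : M) (z : tw) (y : E) (f : tw -> R) (g : E -> R).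

Definition chart_change p q (y : E) : E :=
  (trans p q y.1, jac p q y.1 *m y.2 *m jac q p (trans p q y.1)).

Lemma end_coord1 p z : (end_coord p z).1 = chart p (base z).
Proof. by []. Qed.

Lemma end_coord_change p q z : dom p (base z) -> dom q (base z) ->
  end_coord q z = chart_change p q (end_coord p z).
Proof.
move=> pz qz; rewrite /end_coord /chart_change /= transE//.
have u1 := jac_unit pz qz; have u2 := tcoord_unit pz.
rewrite -(tcoord_jac pz qz) -(jac_inv pz qz) invmx_mul//.
by congr (_, _); rewrite !mulmxA.
Qed.

Lemma end_coord_base z : end_coord (base z) z = (chart (base z) (base z), fib z).
Proof. by rewrite /end_coord tcoord_id invmx1 mul1mx mulmx1. Qed.

Lemma twistorP z : Q (base z) (fib z) /\ fib z *m fib z = - 1%:M.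
Proof. exact: proj2_sig z. Qed.

Lemma chart_change_smooth p q z : dom p (base z) -> dom q (base z) ->
  smooth_near (end_coord p z) (chart_change p q).
Proof.
move=> pz qz.
have s1 : smooth_near (end_coord p z) (fun y : E => y.1) by exact: smooth_near_proj1.
have s2 : smooth_near (end_coord p z) (fun y : E => y.2) by exact: smooth_near_proj2.
have st : smooth_near (end_coord p z) (fun y : E => trans p q y.1).
  by apply: smooth_near_comp => //; exact: trans_smooth.
apply: smooth_near_pair => //; apply: smooth_near_mulmx.
  by apply: smooth_near_mulmx => //; apply: smooth_near_comp => //; exact: jac_smooth.
apply: (smooth_near_comp st); rewrite end_coord1 transE//; exact: jac_smooth.
Qed.

(** The properties that hold at all points of the twistor space near [z]. There is
    no topology on [twistor]: nearness is that of the coordinates in the chart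
    [p], and only the points over its domain count. *)
Definition tnear p z (P : tw -> Prop) : Prop :=
  \forall y \near end_coord p z, forall z', dom p (base z') ->
    end_coord p z' = y -> P z'.

Lemma tnear_all p z (P : tw -> Prop) : (forall z', dom p (base z') -> P z') -> tnear p z P.
Proof. by move=> h; apply: near_all => y z' pz' _; exact: h. Qed.

Lemma tnear_mono p z (P P' : tw -> Prop) :
  (forall z', dom p (base z') -> P z' -> P' z') -> tnear p z P -> tnear p z P'.
Proof. by move=> h; apply: near_mono => y Py z' pz' e; apply: h => //; exact: Py. Qed.

Lemma tnear_mono2 p z (P P' P'' : tw -> Prop) :
  (forall z', dom p (base z') -> P z' -> P' z' -> P'' z') ->
  tnear p z P -> tnear p z P' -> tnear p z P''.
Proof.
move=> h; apply: near_mono2 => y Py P'y z' pz' e.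
by apply: h => //; [exact: Py|exact: P'y].
Qed.

Lemma tnear_forall p z (I : finType) (P : I -> tw -> Prop) :
  (forall i, tnear p z (P i)) -> tnear p z (fun z' => forall i, P i z').
Proof.
move=> h.
have : forall s : seq I, tnear p z (fun z' => forall i, i \in s -> P i z').
  elim=> [|i s IH]; first by apply: tnear_all.
  apply: tnear_mono2 (h i) IH => z' _ Pi Ps j; rewrite inE => /orP[/eqP->//|]; exact: Ps.
move=> /(_ (enum I)); apply: tnear_mono => z' _ H i; apply: H; exact: mem_enum.
Qed.

Lemma tnear_self p z (P : tw -> Prop) : dom p (base z) -> tnear p z P -> P z.
Proof. by move=> pz /near_self; apply. Qed.

Lemma tnear_near p z (P : tw -> Prop) : tnear p z P -> tnear p z (fun z' => tnear p z' P).
Proof. by move=> /near_near; apply: near_mono => y h z' pz' e; rewrite /tnear e. Qed.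

Lemma tnear_coord p z (P : E -> Prop) : (\forall y \near end_coord p z, P y) ->
  tnear p z (fun z' => P (end_coord p z')).
Proof. by apply: near_mono => y Py z' _ ->. Qed.

Lemma tnear_base p z (P : M -> Prop) : dom p (base z) -> (\forall r \near base z, P r) ->
  tnear p z (fun z' => P (base z')).
Proof.
move=> pz /(unchart_near pz) h.
have s1 : smooth_near (end_coord p z) (fun y : E => y.1) by exact: smooth_near_proj1.
have := smooth_near_preimage s1 h.
by apply: near_mono => y Py z' pz' e; move: Py; rewrite -e end_coord1 chartK.
Qed.

Lemma tnear_change p q z (P : tw -> Prop) : dom p (base z) -> dom q (base z) ->
  tnear p z P -> tnear q z P.
Proof.
move=> pz qz.
rewrite /tnear (end_coord_change qz pz).
move=> /(smooth_near_preimage (chart_change_smooth qz pz)) h.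
have h2 := tnear_base qz (dom_near pz).
move: h h2; apply: near_mono2 => y h hp z' qz' e.
have pz' := hp z' qz' e.
by apply: (h z' pz'); rewrite (end_coord_change qz' pz') e.
Qed.

Lemma twistor_eq z z' : base z = base z' -> fib z = fib z' -> z = z'.
Proof.
case: z z' => [[q A] PA] [[q' A'] PA']; rewrite /base /fib /= => e1 e2.
by case: q' / e1 PA' => PA'; case: A' / e2 PA' => PA'; rewrite (Prop_irrelevance PA PA').
Qed.

Lemma end_coord_inj p z z' : dom p (base z) -> dom p (base z') ->
  end_coord p z = end_coord p z' -> z = z'.
Proof.
move=> pz pz' e.
have e1 : base z = base z'.
  by have := congr1 (unchart p \o fst) e; rewrite /= !chartK.
have e2 : fib z = fib z'.
  have := congr1 snd e; rewrite /end_coord /= -e1.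
  move: (tcoord_unit pz); move: (tcoord p (base z)) (fib z) (fib z') => D A A' u.
  move=> /(congr1 (fun X => invmx D *m X *m D)).
  by rewrite -!mulmxA !(mulKmx u) (mulVmx u) !mulmx1.
exact: twistor_eq.
Qed.

(** [g] is an extension of [f] from the twistor space, seen as a submanifold of [E]
    through the chart [p], to a neighbourhood in [E]; it is far from unique. *)
Definition coord_expr p z f g : Prop :=
  smooth_near (end_coord p z) g /\ tnear p z (fun z' => f z' = g (end_coord p z')).

Lemma coord_expr_change p q z f g : dom p (base z) -> dom q (base z) ->
  coord_expr p z f g -> coord_expr q z f (fun y => g (chart_change q p y)).
Proof.
move=> pz qz [sg fg]; split.
  by apply: smooth_near_comp; [exact: chart_change_smooth|rewrite -end_coord_change].
have h := tnear_change pz qz fg; have h2 := tnear_base qz (dom_near pz).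
move: h h2; apply: tnear_mono2 => z' qz' e pz'.
by rewrite -(end_coord_change qz' pz').
Qed.

(** Smoothness can be tested in any chart around the point. By definition, an
    expression of [f] in the chart at [base z] must be valid at all points over
    the domain of this chart, not only near [z]: away from [z] it is therefore
    replaced by the values of [f], which makes sense as [end_coord] is injective. *)
Lemma twistor_smoothP p z f : dom p (base z) ->
  (twistor_smooth z f <-> exists g, coord_expr p z f g).
Proof.
move=> pz; have bz := dom_self (base z); split.
  move=> [g sg fg]; exists (fun y => g (chart_change p (base z) y)).
  by apply: (coord_expr_change bz pz); split=> //; apply: tnear_all => z'; exact: fg.
move=> [g /(coord_expr_change pz bz)]; set q := base z; set h := (fun y => _) => -[sh fh].
exists (fun y => xget (h y) [set c | exists z', [/\ dom q (base z'), end_coord q z' = y & c = f z']]).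
  apply: smooth_near_eq sh; apply: near_mono fh => y hy.
  case: xgetP => [c _ [z' [qz' e ->]]|//].
  by rewrite (hy z' qz' e) e.
move=> z' qz'; case: xgetP => [c _ [z'' [qz'' e ->]]|].
  by rewrite (end_coord_inj qz'' qz' e).
by move=> /(_ (f z')) []; exists z'.
Qed.

Lemma coord_expr_smooth p z f g : dom p (base z) -> coord_expr p z f g -> twistor_smooth z f.
Proof. by move=> pz fg; apply/(twistor_smoothP f pz); exists g. Qed.

Lemma coord_expr_coord p z g : smooth_near (end_coord p z) g ->
  coord_expr p z (fun z' => g (end_coord p z')) g.
Proof. by move=> sg; split=> //; exact: tnear_all. Qed.

Lemma coord_expr_near p z f g : coord_expr p z f g -> tnear p z (fun z' => coord_expr p z' f g).
Proof.
move=> [/smooth_near_near/tnear_coord sg /tnear_near fg].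
by move: sg fg; apply: tnear_mono2 => z' _; split.
Qed.

(** The operator [xi] is, in the coordinates of the chart [p], the derivation along
    the vector [v] of [E]. The first clause is the convention that operators are
    zero on the functions that are not smooth at [z]. *)
Definition represents p z (v : E) (xi : @oper R tw) : Prop :=
  (forall f, ~ twistor_smooth z f -> xi f = 0) /\
  (forall f g, coord_expr p z f g -> xi f = 'D_v g (end_coord p z)).

Lemma represents_lin p z a v v' xi xi' : represents p z v xi -> represents p z v' xi' ->
  represents p z (a *: v + v') (fun f => a * xi f + xi' f).
Proof.
move=> [n1 r1] [n2 r2]; split=> f; first by move=> nf; rewrite n1// n2// mulr0 addr0.
move=> g fg; rewrite (r1 _ _ fg) (r2 _ _ fg) derive_direction_lin//.
exact: smooth_near_diff fg.1.
Qed.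

Lemma representsD p z v v' xi xi' : represents p z v xi -> represents p z v' xi' ->
  represents p z (v + v') (fun f => xi f + xi' f).
Proof.
move=> r r'; have := represents_lin 1 r r'; rewrite scale1r.
by under [fun f => _ + _]funext do rewrite mul1r.
Qed.

Lemma representsB p z v v' xi xi' : represents p z v xi -> represents p z v' xi' ->
  represents p z (v - v') (fun f => xi f - xi' f).
Proof.
move=> r r'; have := represents_lin (-1) r' r; rewrite scaleN1r addrC.
by under [fun f => _ + _]funext do rewrite mulN1r addrC.
Qed.

Lemma represents_unique p z v xi xi' : dom p (base z) ->
  represents p z v xi -> represents p z v xi' -> xi = xi'.
Proof.
move=> pz [n r] [n' r']; apply/funext => f.
have [sf|nf] := pselect (twistor_smooth z f); last by rewrite n// n'.
by have [g fg] := (twistor_smoothP f pz).1 sf; rewrite (r _ _ fg) (r' _ _ fg).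
Qed.

Lemma represents_coord p z v xi (i : fidx E) : represents p z v xi ->
  xi (fun z' => fcoord i (end_coord p z')) = fcoord i v.
Proof.
move=> [_ r]; have h := coord_expr_coord (smooth_near_fcoord i (end_coord p z)).
by apply: etrans (r _ _ h) _; exact: derive_fcoord.
Qed.

(** The coordinates are themselves smooth functions on the twistor space. *)
Lemma represents_inj p z v v' xi : represents p z v xi -> represents p z v' xi -> v = v'.
Proof.
move=> r r'; rewrite (frameE v) (frameE v'); apply: eq_bigr => i _.
by rewrite -(represents_coord i r) -(represents_coord i r').
Qed.

(** Equations of the twistor space can be differentiated along its tangent vectors. *)
Lemma represents_tangent (W : normedModType R) {fW : framed W} p z v xi (G : E -> W) :
  represents p z v xi -> smooth_near (end_coord p z) G ->
  tnear p z (fun z' => G (end_coord p z') = 0) -> 'D_v G (end_coord p z) = 0.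
Proof.
move=> [_ r] sG G0; rewrite (frameE ('D_v G (end_coord p z))) big1// => i _.
have L := @fcoord_linear _ _ fW i; have L0 := linear_scaleE L 0 0; rewrite !scale0r in L0.
have sg : smooth_near (end_coord p z) (fun y : E => fcoord i (G y)) by exact: smooth_near_lin L sG.
rewrite -(derive_fun_lin v L (smooth_near_diff sG)).
rewrite -(r _ _ (coord_expr_coord sg)) (r _ (fun=> 0)); first by rewrite derive_cst scale0r.
split; first exact: smooth_near_cst.
by apply: tnear_mono G0 => z' _ e; apply: etrans (congr1 (fcoord i) e) L0.
Qed.

Lemma represents_change p q z v xi : dom p (base z) -> dom q (base z) ->
  represents p z v xi ->
  represents q z ('D_v (chart_change p q) (end_coord p z)) xi.
Proof.
move=> pz qz [n r]; split; first exact: n.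
move=> f g fg; have fg' := coord_expr_change qz pz fg.
rewrite (r _ _ fg').
have d1 := smooth_near_diff (chart_change_smooth pz qz).
have d2 := smooth_near_diff fg.1.
rewrite (end_coord_change pz qz) in d2 *.
by rewrite -(derive_comp v d1 d2).
Qed.

Lemma curve_coord_smooth p z (c : R -> tw) : dom p (base z) ->
  smooth_curve (@twistor_smooth _ _ _ Q) c -> c 0 = z ->
  smooth_near (0 : R) (fun t => end_coord p (c t)) /\
  (\forall t \near (0 : R), dom p (base (c t))).
Proof.
move=> pz cs c0; split.
  apply: smooth_near_coord => i.
  apply: (cs (fun z' => fcoord i (end_coord p z'))); rewrite c0.
  exact: coord_expr_smooth pz (coord_expr_coord (smooth_near_fcoord i (end_coord p z))).
(* This function is smooth at z, where it vanishes, and takes the values 0 and 1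
   only: so it is 0 along the curve for small t, and the curve stays in the
   chart. *)
pose f (z' : tw) : R := if `[< dom p (base z') >] then 0 else 1.
have sf : twistor_smooth (c 0) f.
  rewrite c0; apply: (@coord_expr_smooth p z f (fun=> 0)) => //; split.
    exact: smooth_near_cst.
  by apply: tnear_all => z' pz'; rewrite /f asboolT.
have h : \forall t \near (0 : R), `|(f \o c) t| < 1.
  apply: continuous_norm_lt1 (smooth_near_cont (cs f sf)) _.
  by rewrite /= c0 /f asboolT.
apply: near_mono h => t; rewrite /= /f; case: asboolP => // _.
by rewrite normr1 ltxx.
Qed.

Lemma curve_represents p z (c : R -> tw) : dom p (base z) ->
  smooth_curve (@twistor_smooth _ _ _ Q) c -> c 0 = z ->
  represents p z ('D_1 (fun t => end_coord p (c t)) 0)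
    (velocity (@twistor_smooth _ _ _ Q) c).
Proof.
move=> pz cs c0; have [se pc] := curve_coord_smooth pz cs c0.
split=> [f nf|f g fg]; first by rewrite /velocity /at_smooth c0 asboolF.
have sf := coord_expr_smooth pz fg.
rewrite /velocity /at_smooth c0 asboolT//.
have d1 := smooth_near_diff se.
have d2 := smooth_near_diff fg.1.
rewrite -c0 in d2 *; rewrite -(derive_comp (1 : R) d1 d2).
apply: near_eq_derive.
have [_] := fg; rewrite /tnear -c0 => /(smooth_near_preimage se) h.
by move: h pc; apply: near_mono2 => t h pct; exact: h.
Qed.

End TwistorCoordinates.

(** * Quaternionic algebra *)

Section QuaternionAlgebra.
Context {R : realType} {m : nat}.
Implicit Types J A B X Y W : 'M[R]_m.

Definition span3 J1 J2 J3 : set 'M[R]_m :=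
  [set X | exists a1 a2 a3 : R, X = a1 *: J1 + a2 *: J2 + a3 *: J3].

Variables (J1 J2 J3 : 'M[R]_m).
Hypothesis adm : admissible J1 J2 J3.

Lemma admissible_mul : [/\ J2 *m J3 = J1, J3 *m J2 = - J1, J3 *m J1 = J2 & J1 *m J3 = - J2].
Proof.
case: adm => e11 e22 e33 e12 e21.
have e32 : J3 *m J2 = - J1 by rewrite -e12 -mulmxA e22 mulmxN mulmx1.
have e13 : J1 *m J3 = - J2 by rewrite -e12 mulmxA e11 mulNmx mul1mx.
split=> //; first by rewrite -[in LHS]e12 mulmxA e21 mulNmx e32 opprK.
by rewrite -[in LHS]e12 -mulmxA e21 mulmxN e13 opprK.
Qed.

Lemma quat_mul (a1 a2 a3 b1 b2 b3 : R) :
  (a1 *: J1 + a2 *: J2 + a3 *: J3) *m (b1 *: J1 + b2 *: J2 + b3 *: J3) =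
  (- (a1 * b1 + a2 * b2 + a3 * b3)) *: 1%:M +
  ((a2 * b3 - a3 * b2) *: J1 + (a3 * b1 - a1 * b3) *: J2 + (a1 * b2 - a2 * b1) *: J3).
Proof.
case: adm => e11 e22 e33 e12 e21; case: admissible_mul => e23 e32 e31 e13.
rewrite !mulmxDl !mulmxDr -!scalemxAl -!scalemxAr.
rewrite e11 e22 e33 e12 e21 e23 e32 e31 e13.
by apply/matrixP => i j; rewrite !mxE; ring.
Qed.

Lemma span3_lin a X Y : span3 J1 J2 J3 X -> span3 J1 J2 J3 Y ->
  span3 J1 J2 J3 (a *: X + Y).
Proof.
move=> [a1 [a2 [a3 ->]]] [b1 [b2 [b3 ->]]].
exists (a * a1 + b1), (a * a2 + b2), (a * a3 + b3).
by apply/matrixP => i j; rewrite !mxE; ring.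
Qed.

Lemma span3_sqr X : span3 J1 J2 J3 X -> exists2 r : R, 0 <= r & X *m X = - (r *: 1%:M).
Proof.
move=> [a1 [a2 [a3 ->]]]; exists (a1 * a1 + a2 * a2 + a3 * a3).
  by rewrite -!expr2 !addr_ge0// sqr_ge0.
rewrite quat_mul scaleNr -[RHS]addr0; congr (_ + _).
by apply/matrixP => i j; rewrite !mxE; ring.
Qed.

(** For anticommuting [X] and [Y] the product is half the commutator, in which the
    scalar part of the product of quaternions cancels. *)
Lemma span3_mul X Y : span3 J1 J2 J3 X -> span3 J1 J2 J3 Y -> X *m Y + Y *m X = 0 ->
  span3 J1 J2 J3 (X *m Y).
Proof.
move=> [a1 [a2 [a3 eX]]] [b1 [b2 [b3 eY]]] XY.
exists (a2 * b3 - a3 * b2), (a3 * b1 - a1 * b3), (a1 * b2 - a2 * b1).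
have -> : X *m Y = 2^-1 *: (X *m Y - Y *m X).
  have -> : Y *m X = - (X *m Y) by apply/eqP; rewrite -addr_eq0 addrC XY.
  have h : 2^-1 + 2^-1 = 1 :> R by field.
  by rewrite opprK scalerDr -scalerDl h scale1r.
rewrite eX eY !quat_mul; apply/matrixP => i j; rewrite !mxE.
by field.
Qed.

Lemma quat_trace : [/\ \tr J1 = 0, \tr J2 = 0 & \tr J3 = 0].
Proof.
case: adm => e11 e22 e33 e12 e21; case: admissible_mul => e23 e32 e31 e13.
have h X Y Z : X *m Y = Z -> Y *m X = - Z -> \tr Z = 0 :> R.
  move=> XY YX; have : \tr Z = - \tr Z by rewrite -{1}XY mxtrace_mulC YX raddfN.
  by move=> e; lra.
by split; [exact: h e23 e32|exact: h e31 e13|exact: h e12 e21].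
Qed.

End QuaternionAlgebra.

(** The orthogonal projection for the form - tr(XY) / m, for which an admissible
    triple is orthonormal. Being a polynomial in the triple, it makes membership
    in Q a smooth equation. *)
Definition span3_proj {R : realType} {m : nat} (J1 J2 J3 X : 'M[R]_m) : 'M[R]_m :=
  (- (m%:R)^-1) *: (\tr (X *m J1) *: J1 + \tr (X *m J2) *: J2 + \tr (X *m J3) *: J3).

Section Projection.
Context {R : realType} {m : nat} (m0 : (0 < m)%N).
Variables (J1 J2 J3 : 'M[R]_m).

Lemma span3_projP X : span3 J1 J2 J3 (span3_proj J1 J2 J3 X).
Proof.
exists (- (m%:R)^-1 * \tr (X *m J1)), (- (m%:R)^-1 * \tr (X *m J2)),
  (- (m%:R)^-1 * \tr (X *m J3)).
by rewrite /span3_proj !scalerDr !scalerA.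
Qed.

Hypothesis adm : admissible J1 J2 J3.

Lemma span3_proj_id X : span3 J1 J2 J3 X -> span3_proj J1 J2 J3 X = X.
Proof.
move=> [a1 [a2 [a3 ->]]]; rewrite /span3_proj.
case: (adm) => e11 e22 e33 e12 e21; case: (admissible_mul adm) => e23 e32 e31 e13.
case: (quat_trace adm) => t1 t2 t3.
rewrite !mulmxDl -!scalemxAl e11 e22 e33 e12 e21 e23 e32 e31 e13.
rewrite !mxtraceD !mxtraceZ !raddfN /= mxtrace1 t1 t2 t3 !oppr0 !mulr0 !addr0 !add0r.
have mn : (m%:R : R) != 0 by rewrite pnatr_eq0 -lt0n.
by apply/matrixP => i j; rewrite !mxE; field.
Qed.

Lemma admissible_conj (D : 'M[R]_m) : D \in unitmx ->
  admissible (D *m J1 *m invmx D) (D *m J2 *m invmx D) (D *m J3 *m invmx D).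
Proof.
move=> u; case: adm => e11 e22 e33 e12 e21.
have h X Y := conj_mulmx_mul X Y u.
split; rewrite h ?e11 ?e22 ?e33 ?e12 ?e21 ?mulmxN ?mulNmx ?mulmx1 ?(mulmxV u)//.
Qed.

End Projection.

Lemma span3_conj {R : realType} {m : nat} (J1 J2 J3 X D : 'M[R]_m) :
  span3 J1 J2 J3 X ->
  span3 (D *m J1 *m invmx D) (D *m J2 *m invmx D) (D *m J3 *m invmx D)
    (D *m X *m invmx D).
Proof.
move=> [a1 [a2 [a3 ->]]]; exists a1, a2, a3.
by rewrite !mulmxDr !mulmxDl -!scalemxAr -!scalemxAl.
Qed.

Section Cayley.
Context {R : realType} {m : nat}.
Implicit Types A B : 'M[R]_m.

(** For A^2 = -1, B^2 = - r and A B + B A = 0, this is a rational parametrisation, by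
    [t], of the circle of complex structures through A with velocity 2 B at
    t = 0; it is smooth also where B vanishes. *)
Definition cayley (r t : R) A B : 'M[R]_m :=
  (1 + r * (t * t))^-1 *: ((1 - r * (t * t)) *: A + (2 * t) *: B).

Lemma cayley_den (r t : R) : 0 <= r -> 1 + r * (t * t) != 0.
Proof.
move=> r0; have : 0 <= r * (t * t) by rewrite mulr_ge0// -expr2 sqr_ge0.
by move=> h; rewrite gt_eqF//; lra.
Qed.

Lemma cayley0 (r : R) A B : cayley r 0 A B = A.
Proof. by rewrite /cayley !mulr0 addr0 subr0 invr1 !scale1r scale0r addr0. Qed.

Lemma cayley_mul (r t : R) A B C D :
  cayley r t (C *m A *m D) (C *m B *m D) = C *m cayley r t A B *m D.
Proof.
by rewrite /cayley -scalemxAr -scalemxAl mulmxDr mulmxDl -!scalemxAr -!scalemxAl.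
Qed.

Lemma cayley_sqr (r t : R) A B : 0 <= r -> A *m A = - 1%:M -> B *m B = - (r *: 1%:M) ->
  A *m B + B *m A = 0 -> cayley r t A B *m cayley r t A B = - 1%:M.
Proof.
move=> r0 A2 B2 /eqP; rewrite addr_eq0 => /eqP AB.
have h := cayley_den t r0.
rewrite /cayley -scalemxAl -scalemxAr mulmxDl !mulmxDr -!scalemxAl -!scalemxAr A2 B2 AB.
by apply/matrixP => i j; rewrite !mxE; field.
Qed.

Lemma cayley_span J1 J2 J3 (r t : R) A B : span3 J1 J2 J3 A -> span3 J1 J2 J3 B ->
  span3 J1 J2 J3 (cayley r t A B).
Proof.
move=> [a1 [a2 [a3 ->]]] [b1 [b2 [b3 ->]]].
set k := (1 + r * (t * t))^-1.
exists (k * ((1 - r * (t * t)) * a1 + (2 * t) * b1)),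
  (k * ((1 - r * (t * t)) * a2 + (2 * t) * b2)),
  (k * ((1 - r * (t * t)) * a3 + (2 * t) * b3)).
by rewrite /cayley -/k; apply/matrixP => i j; rewrite !mxE; ring.
Qed.

End Cayley.

Section CayleySmooth.
Context {R : realType}.
Implicit Types V W : normedModType R.

Lemma cayley_smooth V (r : R) x (tau : V -> R) m (A B : V -> 'M[R]_m) : 0 <= r ->
  smooth_near x tau -> smooth_near x A -> smooth_near x B ->
  smooth_near x (fun y => cayley r (tau y) (A y) (B y)).
Proof.
move=> r0 st sA sB; have h := cayley_den (tau x) r0.
have ss : smooth_near x (fun y => tau y * tau y) by apply: smooth_nearZ.
have sr : smooth_near x (fun y => r * (tau y * tau y)).
  exact: smooth_nearZ (smooth_near_cst x r) ss.
have s1 : smooth_near x (fun=> 1 : R) by exact: smooth_near_cst.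
apply: smooth_nearZ; first by apply: smooth_nearV => //; exact: smooth_nearD.
apply: smooth_nearD; apply: smooth_nearZ => //; first exact: smooth_nearB.
exact: smooth_nearZ (smooth_near_cst x (2 : R)) st.
Qed.

(** As [tau] vanishes at [x], the factors that depend on the square of [tau] do not
    contribute. *)
Lemma cayley_derive V (r : R) x v (tau : V -> R) m (A B : V -> 'M[R]_m) : 0 <= r ->
  smooth_near x tau -> smooth_near x A -> smooth_near x B -> tau x = 0 ->
  'D_v (fun y => cayley r (tau y) (A y) (B y)) x = 'D_v A x + (2 * 'D_v tau x) *: B x.
Proof.
move=> r0 st sA sB t0.
pose s y := tau y *: tau y.
have ss : smooth_near x s by exact: smooth_nearZ.
have sx : s x = 0 by rewrite /s t0 scale0r.
have dt := smooth_near_diff st; have dA := smooth_near_diff sA; have dB := smooth_near_diff sB.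
have ds : 'D_v s x = 0 by rewrite /s derive_scale// t0 scaler0 scale0r addr0.
have key (g : R -> R) : smooth_near (0 : R) g ->
    smooth_near x (g \o s) /\ 'D_v (g \o s) x = 0.
  move=> sg; rewrite -sx in sg; split; first exact: smooth_near_comp.
  rewrite (derive_comp v (smooth_near_diff ss) (smooth_near_diff sg)) ds.
  exact: derive0.
have s1 : smooth_near (0 : R) (fun=> 1 : R) by exact: smooth_near_cst.
have si : smooth_near (0 : R) (fun u : R => r * u).
  exact: smooth_nearZ (smooth_near_cst _ r) (smooth_near_id _).
have [sk dk] : smooth_near x ((fun u : R => (1 + r * u)^-1) \o s) /\
    'D_v ((fun u : R => (1 + r * u)^-1) \o s) x = 0.
  by apply: key; apply: smooth_nearV; [rewrite mulr0 addr0 oner_neq0|exact: smooth_nearD].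
have [sf df] : smooth_near x ((fun u : R => 1 - r * u) \o s) /\
    'D_v ((fun u : R => 1 - r * u) \o s) x = 0.
  by apply: key; exact: smooth_nearB.
set k := (_ \o _) in sk dk; set f := (_ \o _) in sf df.
have s2 : smooth_near x (fun y => 2 * tau y).
  exact: smooth_nearZ (smooth_near_cst x (2 : R)) st.
have d2 : 'D_v (fun y => 2 * tau y) x = 2 * 'D_v tau x.
  apply: (derive_fun_lin v (f := tau) (L := fun u : R => 2 * u)); last exact: smooth_near_diff.
  by move=> a u w; rewrite mulrDr scalerAr.
have sfA := smooth_nearZ sf sA; have stB := smooth_nearZ s2 sB.
have dkx := smooth_near_diff sk; have dfx := smooth_near_diff sf.
rewrite -[LHS]/('D_v (fun y => k y *: (f y *: A y + (2 * tau y) *: B y)) x).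
rewrite (derive_scale v dkx (smooth_near_diff (smooth_nearD sfA stB))).
rewrite dk scale0r add0r.
rewrite (derive_add v (smooth_near_diff sfA) (smooth_near_diff stB)).
rewrite (derive_scale v dfx dA) (derive_scale v (smooth_near_diff s2) dB).
rewrite df d2 scale0r add0r t0 mulr0 scale0r addr0.
by rewrite /k /f /= sx mulr0 addr0 subr0 invr1 !scale1r.
Qed.

End CayleySmooth.

(** * Vertical and horizontal lifts *)

Section Lifts.
Context {R : realType} {m : nat} {M : manifold R m} {Q : M -> set 'M[R]_m}.
Variable nabla : vfield M -> vfield M -> vfield M.
Hypothesis hn : is_connection nabla.
Notation E := ('cV[R]_m * 'M[R]_m)%type.
Notation tw := (twistor Q).
Implicit Types (p q : M) (z : tw) (y : E) (f : tw -> R) (g : E -> R).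

(** In the chart [p] a section of the twistor space is a graph over the base, along
    which expressions of functions can be evaluated. *)
Lemma smooth_section_coord p z (s : M -> tw) : dom p (base z) ->
  (forall q, base (s q) = q) -> s (base z) = z -> smooth_endfield (base z) (@fib _ _ _ Q \o s) ->
  let sl := eloc p (@fib _ _ _ Q \o s) in let x := chart p (base z) in
  [/\ smooth_near x sl, (x, sl x) = end_coord p z &
   forall f g, coord_expr p z f g ->
    \forall x' \near x, g (x', sl x') = ((f \o s) \o unchart p) x'].
Proof.
move=> pz bs sz ss sl x.
have sls : smooth_near x sl by exact: smooth_eloc (dom_self _) pz ss.
have ecs x' : chart p (unchart p x') = x' -> end_coord p (s (unchart p x')) = (x', sl x').
  by move=> e; rewrite /end_coord bs e.
have ex : unchart p x = base z := chartK pz.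
have e0 : (x, sl x) = end_coord p z.
  by apply: etrans (esym (ecs x (congr1 (chart p) ex))) _; rewrite ex sz.
clearbody sl; split; [exact: sls|exact: e0|move=> f g [sg fg]].
have sp : smooth_near x (fun x' : 'cV[R]_m => (x', sl x')).
  exact: smooth_near_pair (smooth_near_id _) sls.
have h : \forall x' \near x, forall z', dom p (base z') ->
    end_coord p z' = (x', sl x') -> f z' = g (end_coord p z').
  by move: fg; rewrite /tnear -e0 => /(smooth_near_preimage sp).
apply: near_mono2 (chart_near pz) h => x' [px' e] /(_ (s (unchart p x'))) h.
have bs' : base (s (unchart p x')) = unchart p x' := bs _.
rewrite bs' in h; have ec := ecs x' e.
by apply: etrans (esym (etrans (h px' ec) (congr1 g ec))).
Qed.

(** By [nabla_endE], a section [s] that is parallel along [Y] at the base point has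
    the derivative - [Gam w, s] there, which is the second component of the
    velocity of its graph. *)
Lemma hlift_represents p z (Y : 'cV[R]_m) xi : dom p (base z) -> is_hlift nabla z Y xi ->
  let w := tcoord p (base z) *m Y in
  let G := christoffel nabla p (chart p (base z)) w in
  represents p z (w, - (G *m (end_coord p z).2 - (end_coord p z).2 *m G)) xi.
Proof.
move=> pz [s [bs sz ss ns ->]] w G; have [sls e0 hfg] := smooth_section_coord pz bs sz ss.
set x := chart p (base z) in G sls e0 hfg *.
set sl := eloc p _ in sls e0 hfg.
split=> [f nf|f g fg]; first by rewrite /at_smooth asboolF.
rewrite /at_smooth asboolT; last exact: coord_expr_smooth pz fg.
have sp : smooth_near x (fun x' : 'cV[R]_m => (x', sl x')).
  exact: smooth_near_pair (smooth_near_id _) sls.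
have sg := fg.1; rewrite -e0 in sg.
have near_e := hfg f g fg.
have sfs : smooth_near x ((f \o s) \o unchart p).
  apply: smooth_near_eq near_e _; exact: (smooth_near_comp sp sg).
rewrite /dirder (derive_chart Y pz (dom_self _) sfs) -tcoordE -/w -/x.
rewrite -(near_eq_derive w near_e).
have dp := smooth_near_diff sp; have dg := smooth_near_diff sg.
rewrite [LHS](derive_comp w dp dg) -e0; congr ('D__ g _).
rewrite (derive_pair w dp) derive_id; congr (_, _).
have sE := smooth_ext Y (dom_self (base z)).
have eX : vloc p (ext (base z) Y) x = w := vloc_ext_center Y pz.
have h := nabla_endE hn pz sE ss; cbv zeta in h.
rewrite ns mulmx0 mul0mx -/x eX -/sl -/G in h.
by move/esym/eqP: h; rewrite addr_eq0 => /eqP.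
Qed.

(** The section maps a segment of the chart to a curve with the required velocity. *)
Lemma hlift_tangent z (Y : 'cV[R]_m) xi : is_hlift nabla z Y xi ->
  tangent (@twistor_smooth _ _ _ Q) z xi.
Proof.
move=> [s [bs sz ss ns ->]]; set q := base z.
have qz := dom_self q; have [sls e0 hfg] := smooth_section_coord qz bs sz ss.
set x := chart q q in sls e0 hfg; set sl := eloc q _ in sls e0 hfg.
have sp : smooth_near x (fun x' : 'cV[R]_m => (x', sl x')).
  exact: smooth_near_pair (smooth_near_id _) sls.
pose l (t : R) : 'cV[R]_m := x + t *: Y.
pose c (t : R) := s (unchart q (l t)).
have l0 : l 0 = x by rewrite /l scale0r addr0.
have c0 : c 0 = z by rewrite /c l0 /x chartK.
have sl0 : smooth_near (0 : R) l.
  apply: smooth_nearD; first exact: smooth_near_cst.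
  by apply: smooth_nearZ; [exact: smooth_near_id|exact: smooth_near_cst].
have sfs f : twistor_smooth z f -> smooth_near x ((f \o s) \o unchart q).
  move=> /(twistor_smoothP f qz)[g fg].
  have sg := fg.1; rewrite -e0 in sg.
  apply: smooth_near_eq (hfg f g fg) _; exact: (smooth_near_comp sp sg).
exists c; split; [|exact: c0|].
  move=> f; rewrite c0 => /sfs sf.
  rewrite -l0 in sf; exact: (smooth_near_comp sl0 sf).
apply/funext => f; rewrite /velocity /at_smooth c0.
case: asboolP => [/sfs sf|_]; last reflexivity.
rewrite /dirder -/q -/x.
have dl := smooth_near_diff sl0; have df := smooth_near_diff sf.
have dlY : 'D_(1 : R) l 0 = Y.
  apply: (derive_line_unique dl) => t; rewrite /l add0r scale0r addr0.
  by congr (_ + _ *: _); exact: mulr1.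
rewrite -l0 in df.
have h : 'D_(1 : R) (f \o c) (0 : R) = 'D_('D_(1 : R) l 0) ((f \o s) \o unchart q) (l 0).
  exact: (derive_comp (1 : R) dl df).
rewrite dlY l0 in h; apply: etrans (esym h); reflexivity.
Qed.

Lemma vlift_represents p z (W : 'M[R]_m) xi : dom p (base z) -> is_vlift z W xi ->
  let D := tcoord p (base z) in
  represents p z (0, D *m W *m invmx D) xi.
Proof.
move=> pz [c [cs c0 bc dc ->]] D.
have [se _] := curve_coord_smooth pz cs c0.
have e : (fun t => end_coord p (c t)) =
    (fun t => (chart p (base z), D *m fib (c t) *m invmx D)).
  by apply/funext => t; rewrite /end_coord bc.
have df : differentiable (fun t => fib (c t)) (0 : R).
  by apply/derivable1_diffP; exact: ex_derive.
have dval : 'D_(1 : R) (fun t => fib (c t)) (0 : R) = W := @derive_val _ _ _ _ _ _ _ dc.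
have Ll : linear (fun A : 'M[R]_m => D *m A *m invmx D).
  by move=> a u v; rewrite mulmxDr mulmxDl -scalemxAr -scalemxAl.
have dv : 'D_(1 : R) (fun t => end_coord p (c t)) (0 : R) = (0, D *m W *m invmx D).
  rewrite e in se *; rewrite (derive_pair (1 : R) (smooth_near_diff se)).
  congr (_, _); first exact: derive_cst.
  apply: etrans (congr1 (fun A : 'M[R]_m => D *m A *m invmx D) dval).
  exact: (derive_fun_lin (1 : R) Ll df).
by rewrite -dv; exact: curve_represents.
Qed.

Hypothesis m0 : (0 < m)%N.
Hypothesis hQ : almost_quaternionic Q.

Lemma twistor_frame (q : M) : exists J1 J2 J3 : endfield M,
  [/\ smooth_endfield q J1, smooth_endfield q J2, smooth_endfield q J3 &
   \forall r \near q, admissible (J1 r) (J2 r) (J3 r) /\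
     Q r = span3 (J1 r) (J2 r) (J3 r)].
Proof. exact: hQ. Qed.

Lemma twistor_frame_at (q : M) : exists J1 J2 J3 : 'M[R]_m,
  admissible J1 J2 J3 /\ Q q = span3 J1 J2 J3.
Proof.
have [J1 [J2 [J3 [_ _ _ /near_self h]]]] := twistor_frame q.
by exists (J1 q), (J2 q), (J3 q).
Qed.

Lemma vertical_mul z W : vertical z W -> vertical z (fib z *m W).
Proof.
move=> [QW anti]; have [J1 [J2 [J3 [adm eQ]]]] := twistor_frame_at (base z).
have [QJ JJ] := twistorP z.
split.
  by move: QW QJ; rewrite eQ => QW QJ; apply: (span3_mul adm) => //; rewrite addrC.
have e : W *m fib z = - (fib z *m W) by apply/eqP; rewrite -addr_eq0 anti.
by rewrite -mulmxA e mulmxN addNr.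
Qed.

Definition mk_twistor q A (QA : Q q A) (A2 : A *m A = - 1%:M) : tw :=
  exist _ (q, A) (conj QA A2).

(** The curve is the circle [cayley] with B = W / 2. *)
Lemma vlift_exists z W : vertical z W -> exists xi, is_vlift z W xi.
Proof.
move=> [QW anti]; set q := base z.
have [J1 [J2 [J3 [adm eQ]]]] := twistor_frame_at q.
have [QJ JJ] := twistorP z.
rewrite eQ in QJ; rewrite eQ in QW.
pose B := 2^-1 *: W.
have QB : span3 J1 J2 J3 B.
  by rewrite /B -[_ *: _]addr0; apply: span3_lin => //; exists 0, 0, 0; rewrite !scale0r !addr0.
have [r r0 BB] := span3_sqr adm QB.
have AB : fib z *m B + B *m fib z = 0.
  by rewrite /B -scalemxAr -scalemxAl -scalerDr addrC anti scaler0.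
have Qc (t : R) : Q q (cayley r t (fib z) B) by rewrite eQ; exact: cayley_span.
have cc (t : R) := cayley_sqr t r0 JJ BB AB.
pose c t := mk_twistor (Qc t) (cc t).
exists (velocity (@twistor_smooth _ _ _ Q) c), c.
have c0 : c 0 = z.
  apply: (@end_coord_inj _ _ _ _ q) => //; first exact: dom_self.
    exact: dom_self.
  by rewrite /end_coord /c /base /fib /= cayley0.
have sA : smooth_near (0 : R) (fun=> fib z) by exact: smooth_near_cst.
have sB : smooth_near (0 : R) (fun=> B) by exact: smooth_near_cst.
have st := smooth_near_id (0 : R).
have sc := cayley_smooth r0 st sA sB.
split; [|exact: c0|by []| |by []].
- move=> f; rewrite c0 => /(twistor_smoothP f (dom_self q))[g fg].
  have se : smooth_near (0 : R) (fun t => end_coord q (c t)).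
    have sD (A : 'M[R]_m) : smooth_near (0 : R) (fun=> A) by exact: smooth_near_cst.
    have sx : smooth_near (0 : R) (fun=> chart q q) by exact: smooth_near_cst.
    exact (smooth_near_pair sx (smooth_near_mulmx
      (smooth_near_mulmx (sD (tcoord q q)) sc) (sD (invmx (tcoord q q))))).
  have h : \forall t \near (0 : R), forall z', dom q (base z') ->
      end_coord q z' = end_coord q (c t) -> f z' = g (end_coord q z').
    by have := fg.2; rewrite /tnear -c0 => /(smooth_near_preimage se).
  have sg := fg.1; rewrite -c0 in sg.
  apply: smooth_near_eq (smooth_near_comp se sg).
  apply: near_mono h => t h; apply/esym.
  by apply: (h (c t)) => //; exact: dom_self.
- have dc := smooth_near_diff sc.
  split; first exact: diff_derivable.
  rewrite (cayley_derive (1 : R) r0 st sA sB)// derive_cst derive_id add0r mulr1.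
  by rewrite /B scalerA mulfV ?scale1r.
Qed.

(** In the total space, the twistor space satisfies the equations A^2 = -1 and
    A = pr(A), where pr is the projection [span3_proj] of a smooth local frame
    of Q. By [represents_tangent] both can be differentiated along (0, W): the
    first gives the anticommutation and the second W = pr(W). *)
Lemma vertical_of_represents z W xi : represents (base z) z (0, W) xi -> vertical z W.
Proof.
set q := base z => r.
have qq := dom_self q.
have [J1 [J2 [J3 [s1 s2 s3 fr]]]] := twistor_frame q.
have [adm eQ] := near_self fr.
have [QJ JJ] := twistorP z.
have ez : end_coord q z = (chart q q, fib z) := end_coord_base z.
have tan (G : E -> 'M[R]_m) : smooth_near (end_coord q z) G ->
    tnear q z (fun z' => G (end_coord q z') = 0) -> 'D_(0, W) G (end_coord q z) = 0.
  exact: represents_tangent r.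
have sy2 : smooth_near (end_coord q z) (fun y : E => y.2) by exact: smooth_near_proj2.
have sy1 : smooth_near (end_coord q z) (fun y : E => y.1) by exact: smooth_near_proj1.
have dy2 : 'D_(0, W) (fun y : E => y.2) (end_coord q z) = W.
  have Ls : linear (fun y : E => y.2) by [].
  exact: (derive_linear (end_coord q z) (0, W) Ls).
split.
- have el1 : smooth_near (end_coord q z) (fun y : E => eloc q J1 y.1).
    apply: (smooth_near_comp sy1); rewrite ez; exact: s1.
  have el2 : smooth_near (end_coord q z) (fun y : E => eloc q J2 y.1).
    apply: (smooth_near_comp sy1); rewrite ez; exact: s2.
  have el3 : smooth_near (end_coord q z) (fun y : E => eloc q J3 y.1).
    apply: (smooth_near_comp sy1); rewrite ez; exact: s3.
  pose G (y : E) := y.2 - span3_proj (eloc q J1 y.1) (eloc q J2 y.1) (eloc q J3 y.1) y.2.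
  have sG : smooth_near (end_coord q z) G.
    apply: smooth_nearB => //; apply: smooth_nearZ; first exact: smooth_near_cst.
    have h (J : E -> 'M[R]_m) : smooth_near (end_coord q z) J ->
        smooth_near (end_coord q z) (fun y : E => \tr (y.2 *m J y) *: J y).
      move=> sJ; apply: smooth_nearZ => //.
      apply: (smooth_near_lin (L := fun X : 'M[R]_m => \tr X)).
        by move=> a u v; rewrite mxtraceD mxtraceZ.
      exact: smooth_near_mulmx.
    by apply: smooth_nearD; [apply: smooth_nearD|]; exact: h.
  have G0 : tnear q z (fun z' => G (end_coord q z') = 0).
    have fr' := tnear_base qq fr.
    apply: tnear_mono fr' => z' qz' [adm' eQ'].
    have [QJ' _] := twistorP z'.
    rewrite eQ' in QJ'; apply/eqP; rewrite subr_eq0; apply/eqP/esym.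
    rewrite /end_coord /eloc /= chartK//.
    apply: span3_proj_id => //; first exact: admissible_conj (tcoord_unit qz').
    exact: span3_conj.
  have := tan G sG G0.
  have P0 : 'D_(0, W) G (end_coord q z) = W - span3_proj (J1 q) (J2 q) (J3 q) W.
    apply: derive_line_unique; first exact: smooth_near_diff.
    move=> t; rewrite ez /G /= scaler0 addr0 /eloc chartK// tcoord_id invmx1 !mul1mx !mulmx1.
    rewrite /span3_proj !mulmxDl -!scalemxAl !mxtraceD !mxtraceZ.
    by apply/matrixP => i j; rewrite !mxE; ring.
  rewrite P0 => /eqP; rewrite subr_eq0 => /eqP ->; rewrite eQ.
  exact: span3_projP.
- pose G (y : E) := y.2 *m y.2 + 1%:M.
  have sGs : smooth_near (end_coord q z) (fun y : E => y.2 *m y.2) by exact: smooth_near_mulmx.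
  have sG : smooth_near (end_coord q z) G.
    by apply: smooth_nearD => //; exact: smooth_near_cst.
  have G0 : tnear q z (fun z' => G (end_coord q z') = 0).
    apply: tnear_all => z' qz'.
    have [_ JJ'] := twistorP z'.
    rewrite /G /end_coord /=; move: (tcoord_unit qz'); move: (tcoord q (base z')) => D u.
    by rewrite conj_mulmx_mul// JJ' mulmxN mulNmx mulmx1 (mulmxV u) addNr.
  have := tan G sG G0.
  have -> : 'D_(0, W) G (end_coord q z) = 'D_(0, W) (fun y : E => y.2 *m y.2) (end_coord q z) + 0.
    rewrite -[X in _ + X](derive_cst (1%:M : 'M[R]_m) (end_coord q z) (0, W)).
    apply: deriveD; apply: diff_derivable; first exact: smooth_near_diff.
    exact: differentiable_cst.
  rewrite addr0 derive_mulmx; [|exact: smooth_near_diff sy2..].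
  by rewrite dy2 ez /=.
Qed.

End Lifts.

(** * Existence of horizontal lifts *)

Section Anticommute.
Context {R : realType} {m : nat} (m0 : (0 < m)%N).
Variables (J1 J2 J3 : 'M[R]_m).

Lemma quat_anticomm (a1 a2 a3 b1 b2 b3 : R) : admissible J1 J2 J3 ->
  let X := a1 *: J1 + a2 *: J2 + a3 *: J3 in
  let Y := b1 *: J1 + b2 *: J2 + b3 *: J3 in
  X *m Y + Y *m X = 0 <-> a1 * b1 + a2 * b2 + a3 * b3 = 0.
Proof.
move=> adm X Y.
have -> : X *m Y + Y *m X = (- 2 * (a1 * b1 + a2 * b2 + a3 * b3)) *: 1%:M.
  by rewrite /X /Y !(quat_mul adm); apply/matrixP => i j; rewrite !mxE; ring.
split=> [|->]; last by rewrite mulr0 scale0r.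
move=> /matrixP/(_ (Ordinal m0) (Ordinal m0)); rewrite !mxE eqxx mulr1 => h; lra.
Qed.

End Anticommute.

(** A function with derivative 1 along [Y], except for [Y = 0], when no such function
    exists; a single statement for both cases lets [hlift_exists] treat them
    together. *)
Lemma dual_coordinate (R : realType) (m : nat) (x Y : 'cV[R]_m) : exists tau : 'cV[R]_m -> R,
  [/\ smooth_near x tau, tau x = 0 & Y = 0 \/ 'D_Y tau x = 1].
Proof.
have [->|Y0] := eqVneq Y 0.
  by exists (fun=> 0); split; [exact: smooth_near_cst|by []|left].
have [k Yk] : exists k, Y k 0 != 0.
  apply/existsP; apply: contra_neqT Y0; rewrite negb_exists => /forallP h.
  by apply/colP => k; rewrite mxE; apply/eqP; move: (h k); rewrite negbK.
have sk : smooth_near x (fun y : 'cV[R]_m => y k 0).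
  by apply: smooth_near_entry; exact: smooth_near_id.
have sB : smooth_near x (fun y : 'cV[R]_m => y k 0 - x k 0).
  by apply: smooth_nearB => //; exact: smooth_near_cst.
have st : smooth_near x (fun y : 'cV[R]_m => (Y k 0)^-1 * (y k 0 - x k 0)).
  exact: smooth_nearZ (smooth_near_cst x ((Y k 0)^-1)) sB.
exists (fun y => (Y k 0)^-1 * (y k 0 - x k 0)); split => //.
  by rewrite subrr mulr0.
right; apply: derive_line_unique; first exact: smooth_near_diff.
move=> t; rewrite !mxE subrr mulr0 add0r addrAC subrr add0r mulrCA mulVf//.
Qed.

Section HorizontalLifts.
Context {R : realType} {m : nat} {M : manifold R m} {Q : M -> set 'M[R]_m}.
Variable nabla : vfield M -> vfield M -> vfield M.
Hypothesis hnabla : quaternionic_connection Q nabla.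
Hypothesis m0 : (0 < m)%N.
Hypothesis hQ : almost_quaternionic Q.
Notation E := ('cV[R]_m * 'M[R]_m)%type.
Notation tw := (twistor Q).
Implicit Types (p q : M) (z : tw) (A B : endfield M).

Lemma eloc_combination p (a1 a2 a3 : R) A1 A2 A3 x :
  eloc p (fun r => a1 *: A1 r + a2 *: A2 r + a3 *: A3 r) x =
  a1 *: eloc p A1 x + a2 *: eloc p A2 x + a3 *: eloc p A3 x.
Proof. by rewrite /eloc !mulmxDr !mulmxDl -!scalemxAr -!scalemxAl. Qed.

Lemma smooth_endfield_comb p (a1 a2 a3 : R) A1 A2 A3 :
  smooth_endfield p A1 -> smooth_endfield p A2 -> smooth_endfield p A3 ->
  smooth_endfield p (fun r => a1 *: A1 r + a2 *: A2 r + a3 *: A3 r).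
Proof.
move=> s1 s2 s3.
have c (a : R) : smooth_near (chart p p) (fun=> a) by exact: smooth_near_cst.
have h := smooth_nearD (smooth_nearD (smooth_nearZ (c a1) s1) (smooth_nearZ (c a2) s2))
  (smooth_nearZ (c a3) s3).
by apply: smooth_near_eq h; apply: near_all => x; rewrite eloc_combination.
Qed.

Lemma smooth_endfield_eq p A B : (\forall r \near p, A r = B r) ->
  smooth_endfield p A -> smooth_endfield p B.
Proof.
move=> AB; have h := unchart_near (dom_self p) AB.
apply: (@smooth_near_eq _ _ _ _ (eloc p A)).
by apply: near_mono h => x e; rewrite /eloc e.
Qed.

Lemma twistor_at (q : M) : exists z, base z = q.
Proof.
have [J1 [J2 [J3 [adm eQ]]]] := twistor_frame_at hQ q.
have [e1 _ _ _ _] := adm.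
have Q1 : Q q J1 by rewrite eQ; exists 1, 0, 0; rewrite scale1r !scale0r !addr0.
by exists (mk_twistor Q1 e1).
Qed.

(** The sections that define horizontal lifts are global maps; away from [q] the
    values are arbitrary points of the fibres. *)
Lemma extend_section q (A : endfield M) :
  (\forall r \near q, Q r (A r) /\ A r *m A r = - 1%:M) ->
  exists s : M -> tw, (forall r, base (s r) = r) /\
    \forall r \near q, fib (s r) = A r.
Proof.
move=> hA.
have /choice[s hs] : forall r, exists z, base z = r /\
    (Q r (A r) /\ A r *m A r = - 1%:M -> fib z = A r).
  move=> r; have [h|nh] := pselect (Q r (A r) /\ A r *m A r = - 1%:M).
    by exists (mk_twistor h.1 h.2).
  by have [z bz] := twistor_at r; exists z.
exists s; split=> [r|]; first exact: (hs r).1.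
by apply: near_mono hA => r /(hs r).2.
Qed.

(** The connection preserves Q, and differentiating A^2 = -1 gives the
    anticommutation. *)
Lemma covariant_derivative_vertical z (A : endfield M) (Y : 'cV[R]_m) :
  smooth_endfield (base z) A -> A (base z) = fib z ->
  (\forall r \near base z, Q r (A r) /\ A r *m A r = - 1%:M) ->
  vertical z (nabla_end nabla (ext (base z) Y) A (base z)).
Proof.
set q := base z => sA Az hA; have qq := dom_self q.
have sE := smooth_ext Y qq.
split.
  by apply: (hnabla.2) => //; apply: near_mono hA => r [].
have h := nabla_end_center Y hnabla.1 sA; cbv zeta in h.
set x := chart q q in h; set G := christoffel _ _ _ _ in h.
have eA : eloc q A x = fib z by rewrite eloc_center.
rewrite Az in h.
have [_ JJ] := twistorP z.
have sq : \forall x' \near x, - 1%:M = eloc q A x' *m eloc q A x'.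
  apply: near_mono2 (chart_near qq) (unchart_near qq hA) => x' [qx' _] [_ e].
  by rewrite /eloc (conj_mulmx_mul _ _ (tcoord_unit qx')) e mulmxN mulNmx mulmx1 (mulmxV (tcoord_unit qx')).
have dA := smooth_near_diff sA.
have := near_eq_derive Y sq; rewrite derive_cst (derive_mulmx Y dA dA) -/x eA => dsq.
rewrite h mulmxDl mulmxDr addrACA [X in X + _ = 0]addrC.
rewrite (_ : fib z *m _ + _ = 0); last by rewrite addrC -dsq.
by rewrite add0r mulmxBl mulmxBr -!mulmxA JJ !mulmxA JJ mulmxN mulNmx mulmx1 mul1mx addrA subrK subrr.
Qed.

(** A section with constant coordinates on a local frame of Q has a covariant
    derivative K along [Y] that may be nonzero, but is vertical. The section is
    rotated by [cayley] with a parameter [tau] that has derivative 1 along [Y],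
    and with 2 B = - K at the base point: this cancels the derivative and keeps
    the values in Z. *)
Lemma hlift_exists z (Y : 'cV[R]_m) : exists xi, is_hlift nabla z Y xi.
Proof.
set q := base z; have qq := dom_self q.
have [J1 [J2 [J3 [s1 s2 s3 fr]]]] := twistor_frame hQ q.
have [adm eQ] := near_self fr.
have [QJ JJ] := twistorP z.
have [a1 [a2 [a3 eJ]]] : span3 (J1 q) (J2 q) (J3 q) (fib z) by rewrite -eQ.
pose A : endfield M := fun r => a1 *: J1 r + a2 *: J2 r + a3 *: J3 r.
have sA : smooth_endfield q A by exact: smooth_endfield_comb.
have Az : A q = fib z by exact: esym eJ.
have na : a1 * a1 + a2 * a2 + a3 * a3 = 1.
  have := JJ; rewrite eJ (quat_mul adm) => /matrixP/(_ (Ordinal m0) (Ordinal m0)).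
  by rewrite !mxE eqxx /=; move=> h; lra.
have spanc (c1 c2 c3 : R) r : span3 (J1 r) (J2 r) (J3 r) (c1 *: J1 r + c2 *: J2 r + c3 *: J3 r).
  by exists c1, c2, c3.
have sqr (c1 c2 c3 : R) r : admissible (J1 r) (J2 r) (J3 r) ->
   (c1 *: J1 r + c2 *: J2 r + c3 *: J3 r) *m (c1 *: J1 r + c2 *: J2 r + c3 *: J3 r) =
   - ((c1 * c1 + c2 * c2 + c3 * c3) *: 1%:M).
  by move=> ad; rewrite (quat_mul ad); apply/matrixP => i j; rewrite !mxE; ring.
have hA : \forall r \near q, Q r (A r) /\ A r *m A r = - 1%:M.
  apply: near_mono fr => r [ad eQr]; split; first by rewrite eQr; exact: spanc.
  by rewrite sqr// na scale1r.
have [QK antiK] := covariant_derivative_vertical Y sA Az hA.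
set K := nabla_end _ _ _ _ in QK antiK.
have [k1 [k2 [k3 eK]]] : span3 (J1 q) (J2 q) (J3 q) K by rewrite -eQ.
pose w1 := - (2^-1 * k1); pose w2 := - (2^-1 * k2); pose w3 := - (2^-1 * k3).
pose B : endfield M := fun r => w1 *: J1 r + w2 *: J2 r + w3 *: J3 r.
have sB : smooth_endfield q B by exact: smooth_endfield_comb.
have eB : 2 *: B q = - K.
  by rewrite /B eK /w1 /w2 /w3; apply/matrixP => i j; rewrite !mxE; field.
have aw : a1 * w1 + a2 * w2 + a3 * w3 = 0.
  move: antiK; rewrite -/q addrC eJ eK => /(quat_anticomm m0 _ _ _ _ _ _ adm) e.
  by rewrite /w1 /w2 /w3; lra.
pose r0 := w1 * w1 + w2 * w2 + w3 * w3.
have r0_ge : 0 <= r0 by rewrite /r0 -!expr2 !addr_ge0// sqr_ge0.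
set x := chart q q.
have [tau [st t0 tauY]] := dual_coordinate x Y.
pose S : endfield M := fun r => cayley r0 (tau (chart q r)) (A r) (B r).
have hS : \forall r \near q, Q r (S r) /\ S r *m S r = - 1%:M.
  apply: near_mono2 fr hA => r [ad eQr] [_ AA]; split.
    by rewrite eQr; apply: cayley_span; exact: spanc.
  apply: cayley_sqr => //; first exact: sqr.
  by apply/(quat_anticomm m0 _ _ _ _ _ _ ad).
have [s [bs fs]] := extend_section hS.
have fs' : \forall r \near q, S r = fib (s r).
  by apply: near_mono fs => r ->.
have elS : \forall x' \near x, cayley r0 (tau x') (eloc q A x') (eloc q B x') = eloc q S x'.
  apply: near_mono (chart_near qq) => x' [qx' e].
  by rewrite /eloc /S e cayley_mul.
have sS : smooth_endfield q S.
  by apply: smooth_near_eq elS _; exact: cayley_smooth.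
have sfs : smooth_endfield q (@fib _ _ _ Q \o s) by exact: smooth_endfield_eq fs' sS.
exists (at_smooth (@twistor_smooth _ _ _ Q) z (fun f => dirder (base z) Y (f \o s))).
exists s; split; [exact: bs| |exact: sfs| |by []].
  apply: twistor_eq; first exact: bs.
  by rewrite -/q (near_self fs) /S -/x t0 cayley0.
have h := nabla_end_center Y hnabla.1 sfs; cbv zeta in h.
have hK := nabla_end_center Y hnabla.1 sA; cbv zeta in hK.
apply: etrans h _; rewrite -/K -/x in hK *.
rewrite /= (near_self fs).
have -> : S q = A q by rewrite /S -/x t0 cayley0.
have elS' : \forall x' \near x, eloc q (@fib _ _ _ Q \o s) x' =
    cayley r0 (tau x') (eloc q A x') (eloc q B x').
  apply: near_mono2 elS (unchart_near qq fs') => x' -> e.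
  by rewrite /eloc /= e.
rewrite (near_eq_derive Y elS') (cayley_derive Y r0_ge st sA sB t0) eloc_center.
rewrite addrAC -hK.
(* For Y = 0 the rotation contributes nothing, and the derivative is 0 anyway. *)
case: tauY => [Y0|->]; last by rewrite mulr1 eB subrr.
rewrite Y0 derive0 mulr0 scale0r addr0 hK Y0 derive0 add0r.
have := christoffel_linear nabla q x; set G := christoffel _ _ _.
by move=> /linear_scaleE/(_ 0 0); rewrite !scale0r => ->; rewrite mul0mx mulmx0 subrr.
Qed.

End HorizontalLifts.

(** * The almost complex structure in a chart *)

Section LocalModel.
Context {R : realType} {m : nat}.
Notation V := 'cV[R]_m.
Notation E := ('cV[R]_m * 'M[R]_m)%type.
Variable Gam : V -> V -> 'M[R]_m.

Definition comm (G A : 'M[R]_m) : 'M[R]_m := G *m A - A *m G.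

(** The almost complex structure I_1 in a chart. The vertical part of [v] is
    v.2 + [Gam v.1, A] where A = y.2; it is multiplied by A, and the horizontal part is
    replaced by the horizontal vector over A v.1. The formula is smooth on the
    whole of [E], although its geometric meaning is limited to Z. *)
Definition acs_local (y v : E) : E :=
  (y.2 *m v.1, y.2 *m (v.2 + comm (Gam y.1 v.1) y.2) - comm (Gam y.1 (y.2 *m v.1)) y.2).

Hypothesis Glin : forall x, linear (Gam x).

Lemma comm_lin (A : 'M[R]_m) : linear (fun G => comm G A).
Proof.
move=> a u v; rewrite /comm mulmxDl mulmxDr -scalemxAl -scalemxAr scalerBr.
by rewrite opprD addrACA.
Qed.

Lemma acs_local_linear y : linear (acs_local y).
Proof.
move=> a [u1 u2] [v1 v2]; rewrite /acs_local /=.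
have e1 : Gam y.1 (a *: u1 + v1) = a *: Gam y.1 u1 + Gam y.1 v1 by exact: Glin.
have e2 : y.2 *m (a *: u1 + v1) = a *: (y.2 *m u1) + y.2 *m v1.
  by rewrite mulmxDr -scalemxAr.
rewrite e1 e2 Glin !(comm_lin y.2); apply/pair_equal_spec; split=> //=.
by rewrite addrACA -scalerDr mulmxDr -scalemxAr opprD addrACA -scalerBr.
Qed.

Lemma smooth_near_gam (y0 : E) (w : E -> V) :
  (forall u, smooth_near y0.1 (fun x => Gam x u)) -> smooth_near y0 w ->
  smooth_near y0 (fun y => Gam y.1 (w y)).
Proof.
move=> sG sw; have s1 : smooth_near y0 (fun y : E => y.1) by exact: smooth_near_proj1.
apply: (smooth_near_family (L := fun (y : E) v => Gam y.1 v)) => //.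
  exact: near_all.
by move=> v; exact: (smooth_near_comp s1 (sG v)).
Qed.

Lemma smooth_near_acs_local (y0 : E) (w : E -> E) :
  (forall u, smooth_near y0.1 (fun x => Gam x u)) -> smooth_near y0 w ->
  smooth_near y0 (fun y => acs_local y (w y)).
Proof.
move=> sG sw.
have s2 : smooth_near y0 (fun y : E => y.2) by exact: smooth_near_proj2.
have w1 : smooth_near y0 (fun y => (w y).1) by exact: smooth_near_fst.
have w2 : smooth_near y0 (fun y => (w y).2) by exact: smooth_near_snd.
have sGw (u : E -> V) : smooth_near y0 u -> smooth_near y0 (fun y => Gam y.1 (u y)).
  exact: smooth_near_gam.
have sc (G : E -> 'M[R]_m) : smooth_near y0 G -> smooth_near y0 (fun y => comm (G y) y.2).
  by move=> sg; apply: smooth_nearB; exact: smooth_near_mulmx.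
have sA := smooth_near_mulmx s2 w1.
apply: smooth_near_pair => //; apply: smooth_nearB; last by apply: sc; exact: sGw.
apply: smooth_near_mulmx => //; apply: smooth_nearD => //.
by apply: sc; exact: sGw.
Qed.

End LocalModel.

Section TwistorFields.
Context {R : realType} {m : nat} {M : manifold R m} {Q : M -> set 'M[R]_m}.
Variable nabla : vfield M -> vfield M -> vfield M.
Hypothesis hnabla : quaternionic_connection Q nabla.
Hypothesis m0 : (0 < m)%N.
Hypothesis hQ : almost_quaternionic Q.
Notation E := ('cV[R]_m * 'M[R]_m)%type.
Notation tw := (twistor Q).
Implicit Types (p q : M) (z : tw).
Let hn := hnabla.1.

(** [vertical_of_represents] transported from the chart at [base z] to the chart [p]. *)
Lemma vertical_change p z C xi : dom p (base z) -> represents p z (0, C) xi ->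
  exists2 W, vertical z W & tcoord p (base z) *m W *m invmx (tcoord p (base z)) = C.
Proof.
set q := base z => pq r; have qq := dom_self q; set D := tcoord p q.
have uD : D \in unitmx := tcoord_unit pq.
have eD : jac q p (chart q q) = D := esym (tcoordE p q).
have eD' : jac p q (chart p q) = invmx D by rewrite -eD; exact: esym (jac_inv qq pq).
exists (invmx D *m C *m D); last by rewrite !mulmxA (mulmxV uD) mul1mx (mulmxK uD).
apply: (@vertical_of_represents _ _ _ _ m0 hQ _ _ xi); rewrite -/q.
have := represents_change pq qq r.
rewrite (_ : 'D_(0, C) _ _ = (0, invmx D *m C *m D))//.
apply: derive_line_unique; first exact: smooth_near_diff (chart_change_smooth pq qq).
move=> t; have e1 : (end_coord p z).1 = chart p q by [].
rewrite /chart_change /= -/q scaler0 addr0 (transE q pq) eD eD'.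
apply/pair_equal_spec; split; first by rewrite /= scaler0 addr0.
by rewrite /= mulmxDr mulmxDl -scalemxAr -scalemxAl.
Qed.

Lemma I1_rel_represents p z v xi eta : dom p (base z) -> represents p z v xi ->
  I1_rel nabla z xi eta ->
  represents p z (acs_local (christoffel nabla p) (end_coord p z) v) eta.
Proof.
move=> pz r [W [Y [xiv [xih [etav [etah [vW [lv lh] [lv' lh'] exi eeta]]]]]]].
have rv := vlift_represents pz lv; have rh := hlift_represents hn pz lh.
have rv' := vlift_represents pz lv'; have rh' := hlift_represents hn pz lh'.
have rx := representsD rv rh; rewrite -exi in rx.
rewrite eeta (represents_inj r rx).
have := representsD rv' rh'; cbv zeta.
set D := tcoord p (base z); set G := christoffel nabla p _.
have uD : D \in unitmx := tcoord_unit pz.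
have eA : (end_coord p z).2 = D *m fib z *m invmx D by [].
set A := (end_coord p z).2 in eA *.
have eY : D *m (fib z *m Y) = A *m (D *m Y) by rewrite eA conj_mulmx.
have eW : D *m (fib z *m W) *m invmx D = A *m (D *m W *m invmx D).
  by rewrite eA conj_mulmx_mul.
rewrite eY eW => h.
have -> // : acs_local (christoffel nabla p) (end_coord p z)
   ((0, D *m W *m invmx D) + (D *m Y, - (G (D *m Y) *m A - A *m G (D *m Y)))) =
   (0, A *m (D *m W *m invmx D)) +
   (A *m (D *m Y), - (G (A *m (D *m Y)) *m A - A *m G (A *m (D *m Y)))).
rewrite /acs_local /= -/A -/G !add0r; apply/pair_equal_spec; split; first by rewrite /= add0r.
by rewrite /= /comm subrK.
Qed.

(** The decomposition that defines [I1] exists: subtracting from [xi] the horizontal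
    lift of its projection leaves a tangent vector with zero projection, which
    is vertical. *)
Lemma I1_represents p z v xi : dom p (base z) -> represents p z v xi ->
  represents p z (acs_local (christoffel nabla p) (end_coord p z) v) (I1 nabla z xi).
Proof.
move=> pz r; apply: (I1_rel_represents pz r); rewrite /I1.
set D := tcoord p (base z); have uD : D \in unitmx := tcoord_unit pz.
have [xih lh] := hlift_exists hnabla m0 hQ z (invmx D *m v.1).
have rh := hlift_represents hn pz lh.
have rC := representsB r rh; cbv zeta in rC, rh.
have eu : D *m (invmx D *m v.1) = v.1 := mulKVmx uD _.
rewrite -/D eu in rC rh.
pose G := christoffel nabla p (chart p (base z)) v.1.
pose H := - (G *m (end_coord p z).2 - (end_coord p z).2 *m G).
rewrite -/G -/H in rC rh.
have {rC} rC : represents p z (0, v.2 - H) (fun f => xi f - xih f).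
  have e : (0, v.2 - H) = v - (v.1, H) by apply/pair_equal_spec; rewrite /= subrr.
  by rewrite e; exact: rC.
have [W vW eW] := vertical_change pz rC.
have [xiv lv] := vlift_exists hQ vW.
have rv := vlift_represents pz lv; cbv zeta in rv; rewrite eW in rv.
have [etav lv'] := vlift_exists hQ (vertical_mul hQ vW).
have [etah lh'] := hlift_exists hnabla m0 hQ z (fib z *m (invmx D *m v.1)).
suff ex : I1_rel nabla z xi (fun f => etav f + etah f) by exact: (xgetPex (fun=> 0) (ex_intro _ _ ex)).
exists W, (invmx D *m v.1), xiv, xih, etav, etah; split; [exact: vW|by []|by []| |by []].
apply: (represents_unique pz r).
have e : v = (0, v.2 - H) + (v.1, H).
  by rewrite [LHS]surjective_pairing; apply/pair_equal_spec; rewrite /= add0r subrK.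
by rewrite e; exact: representsD rv rh.
Qed.

Definition field_represents p z (u : E -> E) (U : tw -> @oper R tw) : Prop :=
  smooth_near (end_coord p z) u /\
  tnear p z (fun z' => represents p z' (u (end_coord p z')) (U z')).

(** The components are the functions obtained by applying the field to the
    coordinates; these are smooth on Z, so they extend to smooth functions on [E]. *)
Lemma smooth_vf_represents p z (U : tw -> @oper R tw) : dom p (base z) ->
  smooth_vf (@twistor_smooth _ _ _ Q) z U -> exists u, field_represents p z u U.
Proof.
move=> pz [tU sU].
have /choice[g hg] : forall i : fidx E, exists g,
    coord_expr p z (fun z' => U z' (fun z'' => fcoord i (end_coord p z''))) g.
  move=> i; apply/(twistor_smoothP _ pz); apply: sU.
  exact: coord_expr_smooth pz (coord_expr_coord (smooth_near_fcoord i (end_coord p z))).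
exists (fun y => \sum_i g i y *: fvec i); split.
  by apply: smooth_near_sum => i; apply: smooth_nearZ; [exact: (hg i).1|exact: smooth_near_cst].
apply: tnear_mono (tnear_forall (fun i => (hg i).2)) => z' pz' h.
have [c [cs c0 eU]] := tU z'.
have r := curve_represents pz' cs c0; rewrite -eU in r.
set v := 'D__ _ _ in r.
have <- // : v = \sum_i g i (end_coord p z') *: fvec i.
rewrite (frameE v); apply: eq_bigr => i _.
by rewrite -(represents_coord i r) h.
Qed.

Lemma field_represents_smooth p z u U f g : field_represents p z u U ->
  coord_expr p z f g ->
  coord_expr p z (fun z' => U z' f) (fun y => 'D_(u y) g y).
Proof.
move=> [su r] fg; split; first exact: (smooth_near_derive_dir fg.1 su).
move: r (coord_expr_near fg); apply: tnear_mono2 => z' _ [_ r] fg'.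
exact: r.
Qed.

Lemma bracket_represents p z u w (U W : tw -> @oper R tw) : dom p (base z) ->
  field_represents p z u U -> field_represents p z w W ->
  represents p z (vf_bracket u w (end_coord p z))
    (bracket (@twistor_smooth _ _ _ Q) U W z).
Proof.
move=> pz hU hW; split=> [f nf|f g fg]; first by rewrite /bracket /at_smooth asboolF.
rewrite /bracket /at_smooth asboolT; last exact: coord_expr_smooth pz fg.
have rU := tnear_self pz hU.2; have rW := tnear_self pz hW.2.
rewrite (rU.2 _ _ (field_represents_smooth hW fg)).
rewrite (rW.2 _ _ (field_represents_smooth hU fg)).
exact: derive_commutator fg.1 hU.1 hW.1.
Qed.

Lemma field_represents_I1 p z u U : dom p (base z) -> field_represents p z u U ->
  field_represents p z (fun y => acs_local (christoffel nabla p) y (u y))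
    (fun z' => I1 nabla z' (U z')).
Proof.
move=> pz [su r]; split.
  apply: smooth_near_acs_local => //; first exact: christoffel_linear.
  by move=> v; exact: christoffel_smooth.
by apply: tnear_mono r => z' pz' r; exact: I1_represents.
Qed.

Definition local_nijenhuis (I : E -> E -> E) (u w : E -> E) (y : E) : E :=
  let Iu y := I y (u y) in let Iw y := I y (w y) in
  vf_bracket Iu Iw y - vf_bracket u w y
  - I y (vf_bracket Iu w y) - I y (vf_bracket u Iw y).

Lemma nijenhuis_represents p z u w U W : dom p (base z) ->
  field_represents p z u U -> field_represents p z w W ->
  represents p z (local_nijenhuis (acs_local (christoffel nabla p)) u w (end_coord p z))
    (nijenhuis (@twistor_smooth _ _ _ Q) (I1 nabla) U W z).
Proof.
move=> pz hU hW.
have hIU := field_represents_I1 pz hU; have hIW := field_represents_I1 pz hW.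
have r1 := bracket_represents pz hIU hIW.
have r2 := bracket_represents pz hU hW.
have r3 := I1_represents pz (bracket_represents pz hIU hW).
have r4 := I1_represents pz (bracket_represents pz hU hIW).
exact: representsB (representsB (representsB r1 r2) r3) r4.
Qed.

End TwistorFields.

(** * The Nijenhuis tensor in a chart *)

Section NoncommutativeIdentity.
Context {R : realType} {m : nat}.
Implicit Types A B C D : 'M[R]_m.

(** The algebra behind [nijenhuis_tensor2]: [g], [h], [g'], [h'] stand for the
    Christoffel matrices of u, w, a u, a w, the letters [t1] to [t8] for derivatives
    of Christoffel matrices, and [c], [e] for the vertical parts of the two
    vectors. Moving [a] to the left of [c] and [e] and using a^2 = -1 gives
    normal forms, which agree as sums of monomials. *)
Lemma vertical_identity (a c e g h g' h' t1 t2 t3 t4 t5 t6 t7 t8 : 'M[R]_m) :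
  a *m a = - 1%:M -> c *m a = - (a *m c) -> e *m a = - (a *m e) ->
  let b := c - comm g a in let d := e - comm h a in
  let bh := a *m c - comm g' a in let dh := a *m e - comm h' a in
  (bh *m e + a *m (comm t3 a + comm h bh) - (comm t5 a + comm h' bh))
  - (dh *m c + a *m (comm t4 a + comm g dh) - (comm t6 a + comm g' dh))
  + a *m (d *m c + a *m (comm t2 a + comm g d) - (comm t8 a + comm g' d))
  - a *m (b *m e + a *m (comm t1 a + comm h b) - (comm t7 a + comm h' b))
  = comm ((t1 - t2 + comm g h) - (t5 - t6 + comm g' h')) a
    + a *m comm ((t3 - t8 + comm g' h) + (t7 - t4 + comm g h')) a.
Proof.
move=> aa ca ea b d bh dh; rewrite /b /d /bh /dh {b d bh dh} /comm.
have aax (x : 'M[R]_m) : a *m (a *m x) = - x by rewrite mulmxA aa mulNmx mul1mx.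
have cax (x : 'M[R]_m) : c *m (a *m x) = - (a *m (c *m x)) by rewrite mulmxA ca mulNmx mulmxA.
have eax (x : 'M[R]_m) : e *m (a *m x) = - (a *m (e *m x)) by rewrite mulmxA ea mulNmx mulmxA.
rewrite !(mulmxDl, mulmxDr, mulmxN, mulNmx, opprD, opprK).
rewrite -!mulmxA.
rewrite !(aax, cax, eax, aa, ca, ea, mulmxN, mulNmx, opprK, mulmx1).
by mx_ring.
Qed.

End NoncommutativeIdentity.

Section LocalNijenhuis.
Context {R : realType} {m : nat}.
Notation V := 'cV[R]_m.
Notation E := ('cV[R]_m * 'M[R]_m)%type.
Variable Gam : V -> V -> 'M[R]_m.
Hypothesis Glin : forall x, linear (Gam x).
Variables (x : V) (a : 'M[R]_m).
Hypothesis Gs : forall u, smooth_near x (fun x' => Gam x' u).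
Let y0 : E := (x, a).

Definition dgam (d u : V) : 'M[R]_m := 'D_d (fun x' => Gam x' u) x.

Lemma derive_gam (w : E -> V) d : smooth_near y0 w ->
  'D_d (fun y => Gam y.1 (w y)) y0 = dgam d.1 (w y0) + Gam x ('D_d w y0).
Proof.
move=> sw.
have s1 : smooth_near y0 (fun y : E => y.1) by exact: smooth_near_proj1.
have L1 : \forall y \near y0, linear (fun v => Gam y.1 v) by exact: near_all.
have L2 u : smooth_near y0 (fun y : E => Gam y.1 u) by exact: (smooth_near_comp s1 (Gs u)).
(* The derivative along d of a function of y.1 is its derivative along d.1 by
   conversion, because they have the same difference quotients. *)
by rewrite (derive_family (L := fun (y : E) v => Gam y.1 v) d L1 L2 sw).
Qed.

Lemma derive_comm (G B : E -> 'M[R]_m) d : smooth_near y0 G -> smooth_near y0 B ->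
  'D_d (fun y => comm (G y) (B y)) y0 = comm ('D_d G y0) (B y0) + comm (G y0) ('D_d B y0).
Proof.
move=> sG sB; have dG := smooth_near_diff sG; have dB := smooth_near_diff sB.
have s1 := smooth_near_diff (smooth_near_mulmx sG sB).
have s2 := smooth_near_diff (smooth_near_mulmx sB sG).
rewrite /comm (derive_sub d s1 s2) (derive_mulmx d dG dB) (derive_mulmx d dB dG).
by rewrite opprD [X in _ + X = _]addrC addrACA.
Qed.

Definition dacs (d v : E) : E :=
  (d.2 *m v.1,
   d.2 *m (v.2 + comm (Gam x v.1) a) +
   a *m (comm (dgam d.1 v.1) a + comm (Gam x v.1) d.2) -
   (comm (dgam d.1 (a *m v.1) + Gam x (d.2 *m v.1)) a + comm (Gam x (a *m v.1)) d.2)).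

Lemma derive_acs d v : 'D_d (fun y => acs_local Gam y v) y0 = dacs d v.
Proof.
have sy : smooth_near y0 (fun y : E => acs_local Gam y v).
  have Gs' : forall u, smooth_near y0.1 (fun x' => Gam x' u) := Gs.
  exact: (smooth_near_acs_local (w := fun=> v) Glin Gs' (smooth_near_cst y0 v)).
have s2 : smooth_near y0 (fun y : E => y.2) by exact: smooth_near_proj2.
have l2 : linear (fun y : E => y.2) by [].
have e2 : 'D_d (fun y : E => y.2) y0 = d.2 := derive_linear y0 d l2.
have sc (w : V) : smooth_near y0 (fun=> w) by exact: smooth_near_cst.
have scm (w : 'M[R]_m) : smooth_near y0 (fun=> w) by exact: smooth_near_cst.
have d2 := smooth_near_diff s2.
have dav (w : V) : 'D_d (fun y : E => y.2 *m w) y0 = d.2 *m w.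
  by rewrite derive_mulmx ?derive_cst ?e2 ?mulmx0 ?addr0//; exact: smooth_near_diff.
have sav : smooth_near y0 (fun y : E => y.2 *m v.1) by exact: smooth_near_mulmx.
have sG (w : E -> V) : smooth_near y0 w -> smooth_near y0 (fun y : E => Gam y.1 (w y)).
  exact: (smooth_near_gam Glin (Gs : forall u, smooth_near y0.1 (fun x' => Gam x' u))).
have sC (G : E -> 'M[R]_m) : smooth_near y0 G -> smooth_near y0 (fun y => comm (G y) y.2).
  by move=> sg; apply: smooth_nearB; exact: smooth_near_mulmx.
have sG1 := sG _ (sc v.1); have sG2 := sG _ sav.
rewrite (derive_pair d (smooth_near_diff sy)) /dacs; congr (_, _); first exact: dav.
have s3 := smooth_nearD (scm v.2) (sC _ sG1).
have s4 := smooth_near_mulmx s2 s3.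
apply: etrans (derive_sub d (smooth_near_diff s4) (smooth_near_diff (sC _ sG2))) _.
rewrite (derive_mulmx d d2 (smooth_near_diff s3)) e2.
have -> : 'D_d (fun y : E => v.2 + comm (Gam y.1 v.1) y.2) y0 =
    comm (dgam d.1 v.1) a + comm (Gam x v.1) d.2.
  rewrite (derive_add d (smooth_near_diff (scm v.2)) (smooth_near_diff (sC _ sG1))).
  rewrite derive_cst add0r (derive_comm d sG1 s2) e2 (derive_gam d (sc v.1)).
  by rewrite derive_cst -[X in _ + Gam x X](scale0r (0 : V)) (linear_scaleE (Glin x)) scale0r addr0.
rewrite (derive_comm d sG2 s2) e2 (derive_gam d sav) dav.
by [].
Qed.

Hypothesis aa : a *m a = - 1%:M.

Lemma acs_local_sqr v : acs_local Gam y0 (acs_local Gam y0 v) = - v.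
Proof.
have aax n (w : 'M[R]_(m, n)) : a *m (a *m w) = - w by rewrite mulmxA aa mulNmx mul1mx.
case: v => u B; rewrite /acs_local /=; apply/pair_equal_spec; split=> /=; first exact: aax.
rewrite subrK !mulmxDr mulmxN !aax.
have -> : Gam x (- u) = - Gam x u.
  by have := linear_scaleE (Glin x) (-1) u; rewrite !scaleN1r.
rewrite /comm !(mulNmx, mulmxN) opprB opprK.
by mx_ring.
Qed.

(** The Nijenhuis tensor of a field I of complex structures on a vector space,
    (D_{I u} I) w - (D_{I w} I) u + I (D_w I) u - I (D_u I) w. *)
Definition nijenhuis_tensor (u w : E) : E :=
  let I := acs_local Gam y0 in
  dacs (I u) w - dacs (I w) u + I (dacs w u) - I (dacs u w).

(** The derivatives of the fields cancel because I^2 = -1 at the point. *)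
Lemma local_nijenhuisE (u w : E -> E) : smooth_near y0 u -> smooth_near y0 w ->
  local_nijenhuis (acs_local Gam) u w y0 = nijenhuis_tensor (u y0) (w y0).
Proof.
move=> su sw.
have Gs' : forall v, smooth_near y0.1 (fun x' => Gam x' v) := Gs.
have Il : \forall y \near y0, linear (fun v => acs_local Gam y v).
  by apply: near_all => y; exact: acs_local_linear.
have Is v : smooth_near y0 (fun y => acs_local Gam y v).
  exact: (smooth_near_acs_local (w := fun=> v) Glin Gs' (smooth_near_cst y0 v)).
have D (v : E -> E) d : smooth_near y0 v ->
    'D_d (fun y => acs_local Gam y (v y)) y0 = dacs d (v y0) + acs_local Gam y0 ('D_d v y0).
  move=> sv; apply: etrans (derive_family d Il Is sv) _.
  by rewrite derive_acs.
have I0l := acs_local_linear Glin y0.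
have ID p q : acs_local Gam y0 (p + q) = acs_local Gam y0 p + acs_local Gam y0 q.
  by have := I0l 1 p q; rewrite !scale1r.
have IN p : acs_local Gam y0 (- p) = - acs_local Gam y0 p.
  by have := linear_scaleE I0l (-1) p; rewrite !scaleN1r.
rewrite /local_nijenhuis /vf_bracket !(D _ _ su) !(D _ _ sw) /nijenhuis_tensor.
have II := acs_local_sqr; cbv zeta.
move: (acs_local Gam y0) ID IN II (dacs) => I ID IN II DI {D I0l}.
move: ('D_(I (u y0)) w y0) ('D_(I (w y0)) u y0) ('D_(u y0) w y0) ('D_(w y0) u y0).
move=> d1 d2 d3 d4; rewrite !(ID, IN) !II.
move: (I d1) (I d2) (I (DI (w y0) (u y0))) (I (DI (u y0) (w y0))) => [p1 q1] [p2 q2] [p3 q3] [p4 q4].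
move: (DI (I (u y0)) (w y0)) (DI (I (w y0)) (u y0)) d3 d4 => [p5 q5] [p6 q6] [p7 q7] [p8 q8].
by apply/pair_equal_spec; split; rewrite /=; mx_ring.
Qed.

Definition ctorsion (u w : V) : V := Gam x u *m w - Gam x w *m u.

Definition curvature (u w : V) : 'M[R]_m :=
  dgam u w - dgam w u + comm (Gam x u) (Gam x w).

(** Four times the (0,2)-part of [T] with respect to [a]; without the denominator,
    identities about it hold by ring arithmetic. *)
Definition tau (T : V -> V -> V) (u w : V) : V :=
  T (a *m u) (a *m w) - T u w - a *m T (a *m u) w - a *m T u (a *m w).

(** The tensor F, the vertical part of the Nijenhuis tensor of I_1. *)
Definition vertical_part (u w : V) : 'M[R]_m :=
  comm (curvature u w - curvature (a *m u) (a *m w)) a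
  + a *m comm (curvature (a *m u) w + curvature u (a *m w)) a.

Lemma nijenhuis_tensor1 u w : (nijenhuis_tensor u w).1 = - tau ctorsion u.1 w.1.
Proof.
have aax n (v : 'M[R]_(m, n)) : a *m (a *m v) = - v by rewrite mulmxA aa mulNmx mul1mx.
case: u w => [u B] [w D]; rewrite /nijenhuis_tensor /dacs /acs_local /tau /ctorsion /comm /=.
rewrite !(mulmxDl, mulmxDr, mulmxN, mulNmx, opprD, opprK) -!mulmxA !(aax, mulmxN, opprK).
by mx_ring.
Qed.

Lemma GamD x' u v : Gam x' (u + v) = Gam x' u + Gam x' v.
Proof. by have := Glin x' 1 u v; rewrite !scale1r. Qed.

Lemma GamN x' u : Gam x' (- u) = - Gam x' u.
Proof. by have := linear_scaleE (Glin x') (-1) u; rewrite !scaleN1r. Qed.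

Lemma commDl (G G' A : 'M[R]_m) : comm (G + G') A = comm G A + comm G' A.
Proof. by have := comm_lin A 1 G G'; rewrite !scale1r. Qed.

Lemma commNl (G A : 'M[R]_m) : comm (- G) A = - comm G A.
Proof. by have := linear_scaleE (comm_lin A) (-1) G; rewrite !scaleN1r. Qed.

(** The vertical parts [c] and [e] of vectors tangent to the twistor space
    anticommute with [a]; the terms in which they occur then cancel. *)
Lemma nijenhuis_tensor2 u w :
  let c := u.2 + comm (Gam x u.1) a in let e := w.2 + comm (Gam x w.1) a in
  c *m a + a *m c = 0 -> e *m a + a *m e = 0 ->
  (nijenhuis_tensor u w).2 + comm (Gam x (nijenhuis_tensor u w).1) a
  = vertical_part u.1 w.1.
Proof.
case: u w => [u B] [w D] c e /eqP; rewrite addr_eq0 => /eqP ca /eqP; rewrite addr_eq0 => /eqP ea.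
rewrite /= in c e ca ea.
have eB : c - comm (Gam x u) a = B by rewrite /c addrK.
have eD : e - comm (Gam x w) a = D by rewrite /e addrK.
have := vertical_identity (Gam x u) (Gam x w) (Gam x (a *m u)) (Gam x (a *m w))
  (dgam u w) (dgam w u) (dgam (a *m u) w) (dgam (a *m w) u) (dgam (a *m u) (a *m w))
  (dgam (a *m w) (a *m u)) (dgam u (a *m w)) (dgam w (a *m u)) aa ca ea.
cbv zeta; rewrite eB eD => vi.
rewrite /vertical_part /curvature /= -vi {vi eB eD}.
rewrite /nijenhuis_tensor /dacs /acs_local /= -/c -/e.
have CD (G G' : 'M[R]_m) : comm (G + G') a = comm G a + comm G' a := commDl G G' a.
have CN (G : 'M[R]_m) : comm (- G) a = - comm G a := commNl G a.
clearbody c e; clear ca ea.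
move: (@comm R m) CD CN => K CD CN.
rewrite !(GamD, GamN) !(CD, CN) !(mulmxDr, mulmxN).
apply/matrixP => i j; rewrite !(mx_entryD, mx_entryN).
(* Only the additive structure is left to compare. *)
move: (@mulmx _ m m m) (@mulmx _ m m 1) (@dgam) => mu mv dg.
by ring.
Qed.

End LocalNijenhuis.

(** * The Bianchi identity *)

Section Bianchi.
Context {R : realType} {m : nat}.
Notation V := 'cV[R]_m.
Variable a : 'M[R]_m.
Hypothesis aa : a *m a = - 1%:M.
Implicit Types (u v w : V) (T : V -> V -> V) (h : V -> V -> V -> V).

Let aax n (v : 'M[R]_(m, n)) : a *m (a *m v) = - v.
Proof. by rewrite mulmxA aa mulNmx mul1mx. Qed.

Definition cyclic h u v w := h u v w + h v w u + h w u v.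

(** The trilinear analogue of [tau]. Over the complex numbers, both keep, up to a
    factor, the part for which all arguments are eigenvectors of [a] for one
    eigenvalue, i or - i, and the value is an eigenvector for the other one. *)
Definition tau3 h u v w :=
  h (a *m u) (a *m v) (a *m w) - h (a *m u) v w - h u (a *m v) w - h u v (a *m w)
  + a *m h u v w
  - a *m (h (a *m u) (a *m v) w + h (a *m u) v (a *m w) + h u (a *m v) (a *m w)).

Lemma tau3_cyclic h u v w : tau3 (cyclic h) u v w =
  cyclic (fun u v w => tau a (h (a *m u)) v w - a *m tau a (h u) v w) u v w.
Proof.
rewrite /tau3 /cyclic /tau !(mulmxDr, mulmxN, aax, opprD, opprK).
by mx_ring.
Qed.

Lemma tauD T T' v w : tau a (fun v w => T v w + T' v w) v w = tau a T v w + tau a T' v w.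
Proof.
rewrite /tau !mulmxDr.
by mx_ring.
Qed.

(** When [tau T] vanishes, [T (a v) (a w)] is [T v w + a s] with the [s] below, and
    all terms then combine into [tau T s u]. *)
Lemma tau_torsion_torsion T u v w :
  (forall v v' w, T (v + v') w = T v w + T v' w) ->
  (forall v w, tau a T v w = 0) ->
  tau a (fun v w => T (T v w) (a *m u)) v w - a *m tau a (fun v w => T (T v w) u) v w = 0.
Proof.
move=> TD T0; pose s := T (a *m v) w + T v (a *m w).
have ep : T (a *m v) (a *m w) = T v w + a *m s.
  rewrite /s mulmxDr; apply/eqP; rewrite -subr_eq0 -[X in _ == X](T0 v w); apply/eqP.
  by rewrite /tau opprD addrA opprD addrA.
rewrite -[RHS](T0 s u) /tau ep !TD !(mulmxDr, mulmxN, aax, opprD, opprK).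
by mx_ring.
Qed.

Variable Gam : V -> V -> 'M[R]_m.
Hypothesis Glin : forall x, linear (Gam x).
Variable x : V.
Hypothesis Gs : forall u, smooth_near x (fun x' => Gam x' u).
Notation T := (ctorsion Gam x).

Definition dtorsion u v w : V := dgam Gam x u v *m w - dgam Gam x u w *m v.

Definition nabla_torsion u v w : V :=
  dtorsion u v w + Gam x u *m T v w - T (Gam x u *m v) w - T v (Gam x u *m w).

Lemma torsionDl v v' w : T (v + v') w = T v w + T v' w.
Proof. by rewrite /ctorsion (GamD Glin) mulmxDl mulmxDr opprD addrACA. Qed.

Lemma torsionDr v w w' : T v (w + w') = T v w + T v w'.
Proof. by rewrite /ctorsion (GamD Glin) mulmxDl mulmxDr opprD addrACA. Qed.

Lemma torsionNl v w : T (- v) w = - T v w.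
Proof. by rewrite /ctorsion (GamN Glin) mulNmx mulmxN opprB opprK addrC. Qed.

Lemma torsionNr v w : T v (- w) = - T v w.
Proof. by rewrite /ctorsion (GamN Glin) mulNmx mulmxN opprB opprK addrC. Qed.

(** The first Bianchi identity for a connection with torsion; once everything is
    expressed by Christoffel matrices and their derivatives, it is an identity of
    polynomials. *)
Lemma bianchi u v w :
  curvature Gam x u v *m w + curvature Gam x v w *m u + curvature Gam x w u *m v
  = cyclic (fun u v w => nabla_torsion u v w + T (T v w) u) u v w.
Proof.
rewrite /cyclic /nabla_torsion /curvature /dtorsion /ctorsion /comm.
rewrite !(GamD Glin, GamN Glin) !(mulmxDl, mulmxDr, mulNmx, mulmxN, opprD, opprK) -!mulmxA.
apply/matrixP => i j; rewrite !(mx_entryD, mx_entryN).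
move: (@mulmx _ m m 1) (@dgam) => mu dg.
by ring.
Qed.

Lemma vertical_part_cyclic u v w :
  vertical_part Gam x a u v *m w + vertical_part Gam x a v w *m u + vertical_part Gam x a w u *m v
  = - tau3 (fun u v w => curvature Gam x u v *m w + curvature Gam x v w *m u +
                         curvature Gam x w u *m v) u v w.
Proof.
rewrite /vertical_part /tau3 /comm; move: (curvature Gam x) => K.
rewrite !(mulmxDl, mulmxDr, mulNmx, mulmxN, opprD, opprK) -!mulmxA !aax.
rewrite !(mulmxDl, mulmxDr, mulNmx, mulmxN, opprD, opprK).
by mx_ring.
Qed.

(** The derivative of [tau] applied to the torsion when the point moves in the
    direction of the horizontal vector (u, - [Gam u, a]). *)
Definition dtau u v w : V :=
  let d := comm (Gam x u) a in
  dtorsion u (a *m v) (a *m w) - T (d *m v) (a *m w) - T (a *m v) (d *m w)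
  - dtorsion u v w
  - (- (d *m T (a *m v) w) + a *m (dtorsion u (a *m v) w - T (d *m v) w))
  - (- (d *m T v (a *m w)) + a *m (dtorsion u v (a *m w) - T v (d *m w))).

(** Horizontal directions move [a] by parallel transport, so covariant
    differentiation of the torsion commutes with [tau]. *)
Lemma tau_nabla_torsion u v w : tau a (nabla_torsion u) v w =
  dtau u v w + Gam x u *m tau a T v w - tau a T (Gam x u *m v) w - tau a T v (Gam x u *m w).
Proof.
rewrite /dtau /tau /nabla_torsion /comm !(mulmxDl, mulNmx) -!mulmxA.
have t1 := torsionDl; have t2 := torsionDr; have t3 := torsionNl; have t4 := torsionNr.
move: (dtorsion) (ctorsion Gam x) t1 t2 t3 t4 => dT U t1 t2 t3 t4.
rewrite !(t1, t2, t3, t4) !(mulmxDr, mulmxN, opprD, opprK).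
by mx_ring.
Qed.

(** The cyclic sum is - [tau3] of the cyclic sum of the curvature, which the Bianchi
    identity expresses by the torsion. By [tau3_cyclic] it is enough that [tau]
    kills the covariant derivative of the torsion, which is
    [tau_nabla_torsion], and that the terms with T(T, .) cancel, which is
    [tau_torsion_torsion]. *)
Lemma vertical_part_bianchi u v w :
  (forall v w, tau a T v w = 0) -> (forall u v w, dtau u v w = 0) ->
  vertical_part Gam x a u v *m w + vertical_part Gam x a v w *m u + vertical_part Gam x a w u *m v
  = 0.
Proof.
move=> t0 d0; rewrite vertical_part_cyclic.
have tN u' v' w' : tau a (nabla_torsion u') v' w' = 0.
  by rewrite tau_nabla_torsion d0 !t0 mulmx0 !subr0 addr0.
have -> : tau3 (fun u v w => curvature Gam x u v *m w + curvature Gam x v w *m u +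
                         curvature Gam x w u *m v) u v w =
   tau3 (cyclic (fun u v w => nabla_torsion u v w + T (T v w) u)) u v w.
  by rewrite /tau3 !bianchi.
rewrite tau3_cyclic /cyclic.
have key u' v' w' : tau a (fun v w => nabla_torsion (a *m u') v w + T (T v w) (a *m u')) v' w'
    - a *m tau a (fun v w => nabla_torsion u' v w + T (T v w) u') v' w' = 0.
  rewrite (tauD (nabla_torsion (a *m u')) (fun v w => T (T v w) (a *m u'))).
  rewrite (tauD (nabla_torsion u') (fun v w => T (T v w) u')) !tN !add0r.
  exact: tau_torsion_torsion torsionDl t0.
apply: etrans (congr1 -%R (congr2 +%R (congr2 +%R (key u v w) (key v w u)) (key w u v))) _.
by rewrite !addr0 oppr0.
Qed.

End Bianchi.

(** * Endomorphisms of small image, and the torsion in a chart *)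

Section RankArgument.
Context {R : realType} {m : nat}.
Variables (J1 J2 J3 : 'M[R]_m).
Hypothesis adm : admissible J1 J2 J3.

Lemma span3_unit X : span3 J1 J2 J3 X -> X = 0 \/ X \in unitmx.
Proof.
move=> [a1 [a2 [a3 ->]]]; set r := a1 * a1 + a2 * a2 + a3 * a3.
have [r0|r0] := eqVneq r 0.
  have [h1 h2 h3] : [/\ 0 <= a1 ^+ 2, 0 <= a2 ^+ 2 & 0 <= a3 ^+ 2] by rewrite !sqr_ge0.
  rewrite /r -!expr2 in r0.
  have e1 : a1 = 0 by apply/eqP; rewrite -sqrf_eq0; apply/eqP; lra.
  have e2 : a2 = 0 by apply/eqP; rewrite -sqrf_eq0; apply/eqP; lra.
  have e3 : a3 = 0 by apply/eqP; rewrite -sqrf_eq0; apply/eqP; lra.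
  by left; rewrite e1 e2 e3 !scale0r !addr0.
right; set Y := (X in X \in _).
have XX : Y *m (- r^-1 *: Y) = 1%:M.
  rewrite -scalemxAr /Y (quat_mul adm) -/r.
  by apply/matrixP => i j; rewrite !mxE; field.
by case: (mulmx1_unit XX).
Qed.

Lemma span3_column (u : 'cV[R]_m) X : span3 J1 J2 J3 X ->
  exists c : 'M[R]_(1 + (1 + 1), 1),
    X *m u = row_mx (J1 *m u) (row_mx (J2 *m u) (J3 *m u)) *m c.
Proof.
move=> [a1 [a2 [a3 ->]]]; exists (col_mx a1%:M (col_mx a2%:M a3%:M)).
by rewrite !mul_row_col !mul_mx_scalar !mulmxDl -!scalemxAl addrA.
Qed.

(** A nonzero [X] in the span is invertible, its square being a negative multiple of
    the identity; but its image is contained in the span of the six vectors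
    [J_k *m u] and [J_k *m v]. *)
Lemma span3_small_image (u v : 'cV[R]_m) X : (6 < m)%N -> span3 J1 J2 J3 X ->
  (forall w, exists Y Z, [/\ span3 J1 J2 J3 Y, span3 J1 J2 J3 Z &
     X *m w = Y *m u + Z *m v]) -> X = 0.
Proof.
move=> m6 sX h; case: (span3_unit sX) => // uX; exfalso.
pose col3 (u : 'cV[R]_m) := row_mx (J1 *m u) (row_mx (J2 *m u) (J3 *m u)).
pose K := row_mx (col3 u) (col3 v).
have sub : (X^T <= K^T)%MS.
  apply/row_subP => i.
  have [Y [Z [sY sZ e]]] := h (delta_mx i 0).
  have [c ec] := span3_column u sY; have [d ed] := span3_column v sZ.
  apply/submxP; exists (col_mx c d)^T.
  by rewrite -trmx_mul mul_row_col /col3 -ec -ed -e -colE tr_col.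
have := mxrankS sub; rewrite !mxrank_tr (mxrank_unit uX) => h1.
by have := leq_trans h1 (rank_leq_col K); rewrite leqNgt m6.
Qed.

End RankArgument.

Section TorsionCharts.
Context {R : realType} {m : nat} {M : manifold R m}.
Variable nabla : vfield M -> vfield M -> vfield M.
Hypothesis hn : is_connection nabla.
Implicit Types (p q : M) (u v : 'cV[R]_m).

Lemma lie_bracket_ext q u v : lie_bracket (ext q u) (ext q v) q = 0.
Proof.
have h w d : 'D_d (vloc q (ext q w)) (chart q q) = 0.
  rewrite -(derive_cst w (chart q q) d); apply: near_eq_derive.
  exact: vloc_ext (dom_self q).
by rewrite /lie_bracket (h v) (h u) subrr.
Qed.

(** In the chart [p], the field [ext q v] is the derivative along [v] of the change of
    charts, so that a derivative of it is a second derivative of this change. *)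
Lemma derive_vloc_ext p q u v : dom p q ->
  'D_(tcoord p q *m u) (vloc p (ext q v)) (chart p q) =
  'D_u (fun y => 'D_v (trans q p) y) (chart q q).
Proof.
move=> pq; have qq := dom_self q.
have s1 := trans_smooth pq qq; have s2 := trans_smooth qq pq.
have e : \forall x \near chart p q, vloc p (ext q v) x = ((fun y => 'D_v (trans q p) y) \o trans p q) x.
  have sd := smooth_near_near s2; rewrite -(transE q pq) in sd.
  have h2 := smooth_near_preimage s1 sd.
  have ve := vloc_ext v qq; rewrite -(transE q pq) in ve.
  have h3 := smooth_near_preimage s1 ve.
  have h4 : \forall x \near chart p q, smooth_near (trans p q x) (trans q p) /\
     vloc q (ext q v) (trans p q x) = v.
    by apply: near_mono2 h2 h3 => x.
  apply: near_mono2 (vloc_chart (ext q v) qq pq) h4 => x -> [/smooth_near_diff d ->].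
  by rewrite (jacE v d).
rewrite (near_eq_derive _ e).
have d1 := smooth_near_diff s1.
have d2 := smooth_near_diff (smooth_near_derive v s2); rewrite -(transE q pq) in d2.
apply: etrans (derive_comp _ d1 d2) _.
rewrite -(jacE _ d1) (transE q pq) tcoordE mulmxA (jac_comp qq pq qq) (jac_id qq) mul1mx.
by [].
Qed.

(** The derivatives of the extended fields cancel by Schwarz's theorem, in the form
    of [derive_vloc_ext]. *)
Lemma torsion_chart p q u v : dom p q ->
  tcoord p q *m torsion nabla q u v =
  ctorsion (christoffel nabla p) (chart p q) (tcoord p q *m u) (tcoord p q *m v).
Proof.
move=> pq; have qq := dom_self q.
have sE w := smooth_ext w qq.
rewrite /torsion lie_bracket_ext subr0 mulmxBr.
rewrite (connE hn pq (sE u) (sE v)) (connE hn pq (sE v) (sE u)).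
rewrite !(vloc_ext_center _ pq) !derive_vloc_ext// (schwarz_mx u v (trans_smooth qq pq)).
by rewrite opprD addrACA subrr add0r.
Qed.

End TorsionCharts.

(** * Integrability and torsion *)

Section HorizontalDerivative.
Context {R : realType} {m : nat}.
Notation V := 'cV[R]_m.
Notation E := ('cV[R]_m * 'M[R]_m)%type.
Variable Gam : V -> V -> 'M[R]_m.
Hypothesis Glin : forall x, linear (Gam x).
Variables (x : V) (a : 'M[R]_m).
Hypothesis Gs : forall u, smooth_near x (fun x' => Gam x' u).
Let y0 : E := (x, a).

Lemma smooth_torsion (p q : E -> V) : smooth_near y0 p -> smooth_near y0 q ->
  smooth_near y0 (fun y => ctorsion Gam y.1 (p y) (q y)).
Proof.
move=> sp sq.
have sG (w : E -> V) : smooth_near y0 w -> smooth_near y0 (fun y : E => Gam y.1 (w y)).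
  exact: (smooth_near_gam Glin (Gs : forall u, smooth_near y0.1 (fun x' => Gam x' u))).
exact: smooth_nearB (smooth_near_mulmx (sG _ sp) sq) (smooth_near_mulmx (sG _ sq) sp).
Qed.

Lemma derive_torsion (p q : E -> V) d : smooth_near y0 p -> smooth_near y0 q ->
  'D_d (fun y => ctorsion Gam y.1 (p y) (q y)) y0 =
  dtorsion Gam x d.1 (p y0) (q y0) + ctorsion Gam x ('D_d p y0) (q y0)
  + ctorsion Gam x (p y0) ('D_d q y0).
Proof.
move=> sp sq.
have sG (w : E -> V) : smooth_near y0 w -> smooth_near y0 (fun y : E => Gam y.1 (w y)).
  exact: (smooth_near_gam Glin (Gs : forall u, smooth_near y0.1 (fun x' => Gam x' u))).
have sGp := sG _ sp; have sGq := sG _ sq.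
rewrite /ctorsion (derive_sub d (smooth_near_diff (smooth_near_mulmx sGp sq))
  (smooth_near_diff (smooth_near_mulmx sGq sp))).
rewrite (derive_mulmx d (smooth_near_diff sGp) (smooth_near_diff sq)).
rewrite (derive_mulmx d (smooth_near_diff sGq) (smooth_near_diff sp)).
rewrite (derive_gam Glin Gs d sp) (derive_gam Glin Gs d sq) /dtorsion.
rewrite !mulmxDl.
by mx_ring.
Qed.

Definition tau_field (v w : V) (y : E) : V := tau y.2 (ctorsion Gam y.1) v w.

Lemma tau_field_smooth v w : smooth_near y0 (tau_field v w).
Proof.
have s2 : smooth_near y0 (fun y : E => y.2) by exact: smooth_near_proj2.
have sc (v' : V) : smooth_near y0 (fun=> v') by exact: smooth_near_cst.
have sa v' : smooth_near y0 (fun y : E => y.2 *m v') := smooth_near_mulmx s2 (sc v').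
have h1 := smooth_torsion (sa v) (sa w); have h2 := smooth_torsion (sc v) (sc w).
have h3 := smooth_near_mulmx s2 (smooth_torsion (sa v) (sc w)).
have h4 := smooth_near_mulmx s2 (smooth_torsion (sc v) (sa w)).
exact: smooth_nearB (smooth_nearB (smooth_nearB h1 h2) h3) h4.
Qed.

Lemma tau_field_derive u v w :
  'D_(u, - comm (Gam x u) a) (tau_field v w) y0 = dtau a Gam x u v w.
Proof.
set d : E := (u, _).
have s2 : smooth_near y0 (fun y : E => y.2) by exact: smooth_near_proj2.
have l2 : linear (fun y : E => y.2) by [].
have e2 : 'D_d (fun y : E => y.2) y0 = d.2 := derive_linear y0 d l2.
have sc (v' : V) : smooth_near y0 (fun=> v') by exact: smooth_near_cst.
have sa v' : smooth_near y0 (fun y : E => y.2 *m v') := smooth_near_mulmx s2 (sc v').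
have h1 := smooth_torsion (sa v) (sa w); have h2 := smooth_torsion (sc v) (sc w).
have t3 := smooth_torsion (sa v) (sc w); have t4 := smooth_torsion (sc v) (sa w).
have h3 := smooth_near_mulmx s2 t3; have h4 := smooth_near_mulmx s2 t4.
have D2 := smooth_near_diff s2.
have da (z : V) : 'D_d (fun y : E => y.2 *m z) y0 = - (comm (Gam x u) a *m z).
  rewrite (derive_mulmx d D2 (smooth_near_diff (sc z))) derive_cst e2 mulmx0 addr0.
  by rewrite mulNmx.
rewrite /tau_field /tau (derive_sub d (smooth_near_diff (smooth_nearB (smooth_nearB h1 h2) h3))
  (smooth_near_diff h4)).
rewrite (derive_sub d (smooth_near_diff (smooth_nearB h1 h2)) (smooth_near_diff h3)).
rewrite (derive_sub d (smooth_near_diff h1) (smooth_near_diff h2)).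
rewrite (derive_mulmx d D2 (smooth_near_diff t3)) (derive_mulmx d D2 (smooth_near_diff t4)).
rewrite (derive_torsion d (sa v) (sa w)) (derive_torsion d (sc v) (sc w)).
rewrite (derive_torsion d (sa v) (sc w)) (derive_torsion d (sc v) (sa w)).
rewrite !da !derive_cst e2 /dtau.
have T0l z : ctorsion Gam x 0 z = 0.
  by have := torsionNl Glin x 0 z; rewrite oppr0 => /eqP;
    rewrite -addr_eq0 -mulr2n -scaler_nat scaler_eq0 pnatr_eq0 /= => /eqP.
have T0r z : ctorsion Gam x z 0 = 0.
  by have := torsionNr Glin x z 0; rewrite oppr0 => /eqP;
    rewrite -addr_eq0 -mulr2n -scaler_nat scaler_eq0 pnatr_eq0 /= => /eqP.
have tNl := torsionNl Glin x; have tNr := torsionNr Glin x.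
rewrite /d /y0 /=.
move: (ctorsion Gam x) (dtorsion Gam x u) T0l T0r tNl tNr => T dT T0l T0r tNl tNr.
move: (comm _ _) => c.
by rewrite !(T0l, T0r, addr0, tNl, tNr, mulNmx).
Qed.

End HorizontalDerivative.

Lemma tau_transport (R : realType) m (D A J : 'M[R]_m) (T S : 'cV[R]_m -> 'cV[R]_m -> 'cV[R]_m) u v :
  (forall w : 'cV[R]_m, A *m (D *m w) = D *m (J *m w)) ->
  (forall w w', T (D *m w) (D *m w') = D *m S w w') ->
  tau A T (D *m u) (D *m v) = D *m tau J S u v.
Proof. by move=> eA eT; rewrite /tau !eA !eT !eA !mulmxBr. Qed.

Section Main.
Context {R : realType} {m : nat} {M : manifold R m} {Q : M -> set 'M[R]_m}.
Variable nabla : vfield M -> vfield M -> vfield M.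
Hypothesis hnabla : quaternionic_connection Q nabla.
Hypothesis m0 : (0 < m)%N.
Hypothesis hQ : almost_quaternionic Q.
Notation V := 'cV[R]_m.
Notation E := ('cV[R]_m * 'M[R]_m)%type.
Notation tw := (twistor Q).
Implicit Types (p q : M) (z : tw) (u v w : V).
Let hn := hnabla.1.
Notation Gam p := (christoffel nabla p).

Lemma gam_linear p x : linear (Gam p x).
Proof. exact: christoffel_linear. Qed.

Lemma gam_smooth p z : dom p (base z) ->
  forall u, smooth_near (end_coord p z).1 (fun x' => Gam p x' u).
Proof. by move=> pz u; exact: christoffel_smooth. Qed.

Lemma tangent0 z : tangent (@twistor_smooth _ _ _ Q) z (fun=> 0).
Proof.
exists (fun=> z); split.
- move=> f _; exact: smooth_near_cst.
- by [].
- apply/funext => f; rewrite /velocity /at_smooth; case: asboolP => [_|//].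
  by rewrite -[LHS](derive_cst (f z) (0 : R) (1 : R)).
Qed.

Definition horizontal_vector p u (y : E) : E := (u, - comm (Gam p y.1 u) y.2).

(** The horizontal lift of the constant field [u] of the chart [p], put equal to 0 over
    the points outside of the domain of the chart. *)
Lemma horizontal_field p z u : dom p (base z) -> exists U,
  smooth_vf (@twistor_smooth _ _ _ Q) z U /\
  field_represents p z (horizontal_vector p u) U.
Proof.
move=> pz.
pose lift z' : set (@oper R tw) :=
  [set xi | dom p (base z') /\ is_hlift nabla z' (invmx (tcoord p (base z')) *m u) xi].
pose U z' := xget (fun=> 0) (lift z').
have s1 : smooth_near (end_coord p z) (fun y : E => y.1) by exact: smooth_near_proj1.
have s2 : smooth_near (end_coord p z) (fun y : E => y.2) by exact: smooth_near_proj2.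
have sG : smooth_near (end_coord p z) (fun y : E => Gam p y.1 u).
  exact: (smooth_near_comp s1 (gam_smooth pz u)).
have su : smooth_near (end_coord p z) (fun=> u) by exact: smooth_near_cst.
have rU : field_represents p z (horizontal_vector p u) U.
  split.
    apply: (smooth_near_pair su); apply: smooth_nearN.
    exact: smooth_nearB (smooth_near_mulmx sG s2) (smooth_near_mulmx s2 sG).
  apply: tnear_all => z' pz'.
  have [xi lxi] := hlift_exists hnabla m0 hQ z' (invmx (tcoord p (base z')) *m u).
  have [_ lU] : lift z' (U z').
    by apply: (xgetPex (fun=> 0)); exists xi.
  have := hlift_represents hn pz' lU; cbv zeta.
  by rewrite (mulKVmx (tcoord_unit pz')).
exists U; split=> //; split.
  move=> z'; rewrite /U; case: xgetP => [xi _ [_ l]|_]; first exact: hlift_tangent l.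
  exact: tangent0.
move=> f /(twistor_smoothP f pz)[g fg].
exact: coord_expr_smooth pz (field_represents_smooth rU fg).
Qed.

(** It is what remains when the horizontal lift of the projection is subtracted. *)
Lemma represents_vertical_part p z (v : E) xi : dom p (base z) -> represents p z v xi ->
  exists2 W, vertical z W &
    tcoord p (base z) *m W *m invmx (tcoord p (base z)) =
    v.2 + comm (Gam p (end_coord p z).1 v.1) (end_coord p z).2.
Proof.
move=> pz r; set D := tcoord p (base z); have uD : D \in unitmx := tcoord_unit pz.
have [xih lh] := hlift_exists hnabla m0 hQ z (invmx D *m v.1).
have rh := hlift_represents hn pz lh; cbv zeta in rh.
rewrite -/D (mulKVmx uD) in rh.
have rC := representsB r rh.
apply: (vertical_change m0 hQ pz (xi := fun f => xi f - xih f)).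
set H := - _ in rC.
move: rC; rewrite [X in represents _ _ X _](_ : _ =
  (0, v.2 + comm (Gam p (end_coord p z).1 v.1) (end_coord p z).2))//.
by apply/pair_equal_spec; rewrite /= subrr opprK.
Qed.

(** By [nijenhuis_tensor2] it is the vertical part of a tangent vector of Z: the value
    of the Nijenhuis tensor on two horizontal fields. *)
Lemma vertical_part_vertical z u w (p := base z) :
  vertical z (vertical_part (Gam p) (chart p p) (fib z) u w).
Proof.
have pz : dom p (base z) := dom_self p.
have ez : end_coord p z = (chart p p, fib z) := end_coord_base z.
have [_ JJ] := twistorP z.
have [U [_ rU]] := horizontal_field u pz; have [W [_ rW]] := horizontal_field w pz.
have rN := nijenhuis_represents hnabla m0 hQ pz rU rW.
have Gs := gam_smooth pz.
rewrite ez in Gs.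
have su := rU.1; have sw := rW.1; rewrite ez in su sw.
rewrite ez (local_nijenhuisE (gam_linear p) Gs JJ su sw) in rN.
have cv v : let h := horizontal_vector p v (chart p p, fib z) in
    let c := h.2 + comm (Gam p (chart p p) h.1) (fib z) in
    c *m fib z + fib z *m c = 0.
  by rewrite /= addNr mul0mx mulmx0 addr0.
have N2 := nijenhuis_tensor2 (gam_linear p) JJ (cv u) (cv w).
have [C vC eC] := represents_vertical_part pz rN.
rewrite ez tcoord_id invmx1 mul1mx mulmx1 in eC.
by rewrite -[vertical_part _ _ _ _ _](etrans eC N2).
Qed.

Lemma represents_zero p z xi : represents p z 0 xi -> dom p (base z) -> xi = (fun=> 0).
Proof.
move=> r pz; apply: (represents_unique pz r); split=> // f g _.
by rewrite derive0.
Qed.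

(** The projection to M of the Nijenhuis tensor of two horizontal fields is
    - [tau] of the torsion. *)
Lemma torsion02_of_integrable :
  acs_integrable (twistor_smooth (Q := Q)) (I1 (Q := Q) nabla) ->
  forall p J, Q p J -> J *m J = - 1%:M ->
    forall u v, part02 J (torsion nabla p) u v = 0.
Proof.
move=> integ p J QJ JJ u v.
pose z := mk_twistor QJ JJ; have pz : dom p (base z) := dom_self p.
have ez : end_coord p z = (chart p p, J) := end_coord_base z.
have [U [sU rU]] := horizontal_field u pz; have [W [sW rW]] := horizontal_field v pz.
have rN := nijenhuis_represents hnabla m0 hQ pz rU rW.
have Gs := gam_smooth pz; rewrite ez in Gs.
have su := rU.1; have sw := rW.1; rewrite ez in su sw.
rewrite ez (local_nijenhuisE (gam_linear p) Gs JJ su sw) in rN.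
have N0 : nijenhuis (twistor_smooth (Q := Q)) (I1 nabla) U W z = (fun=> 0).
  by apply/funext => f; exact: integ.
rewrite N0 in rN.
have r0 : represents p z 0 (fun=> 0).
  by split=> // f g _; rewrite derive0.
have := congr1 fst (represents_inj rN r0).
rewrite nijenhuis_tensor1//= => /eqP; rewrite oppr_eq0 => /eqP t0.
rewrite /part02.
have eT (w w' : V) : torsion nabla p w w' = ctorsion (Gam p) (chart p p) w w'.
  by have := torsion_chart hn w w' (dom_self p); rewrite tcoord_id !mul1mx.
by move: t0; rewrite /tau !eT => ->; rewrite scaler0.
Qed.

Hypothesis m6 : (6 < m)%N.
Hypothesis hT : forall p J, Q p J -> J *m J = - 1%:M ->
  forall u v, part02 J (torsion nabla p) u v = 0.

Lemma tau_torsion0 p z u v : dom p (base z) ->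
  tau (end_coord p z).2 (ctorsion (Gam p) (end_coord p z).1) u v = 0.
Proof.
move=> pz; have [QJ JJ] := twistorP z.
set D := tcoord p (base z); have uD : D \in unitmx := tcoord_unit pz.
rewrite -(mulKVmx uD u) -(mulKVmx uD v); set u' := invmx D *m u; set v' := invmx D *m v.
have eA (w : V) : (end_coord p z).2 *m (D *m w) = D *m (fib z *m w).
  exact: conj_mulmx.
have eT (w w' : V) : ctorsion (Gam p) (end_coord p z).1 (D *m w) (D *m w') =
    D *m torsion nabla (base z) w w'.
  exact: esym (torsion_chart hn _ _ pz).
rewrite (tau_transport _ _ eA eT).
have := hT QJ JJ u' v'; rewrite /part02 => /eqP; rewrite scaler_eq0 invr_eq0 pnatr_eq0 /=.
by rewrite /tau => /eqP ->; rewrite mulmx0.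
Qed.

(** [dtau] vanishes because horizontal vectors are tangent to the twistor space, on
    which [tau_field] is zero. Then [vertical_part_bianchi] writes the image of
    [w] as the sum of an element of Q applied to [u] and one applied to [v], for
    every [w], and [span3_small_image] applies. *)
Lemma vertical_part0 z u v (p := base z) :
  vertical_part (Gam p) (chart p p) (fib z) u v = 0.
Proof.
have pz : dom p (base z) := dom_self p.
have ez : end_coord p z = (chart p p, fib z) := end_coord_base z.
have [_ JJ] := twistorP z.
have Gs := gam_smooth pz; rewrite ez in Gs.
have Gl := gam_linear p.
have t0 v' w : tau (fib z) (ctorsion (Gam p) (chart p p)) v' w = 0.
  by have := tau_torsion0 v' w pz; rewrite ez.
have d0 u' v' w : dtau (fib z) (Gam p) (chart p p) u' v' w = 0.
  rewrite -(tau_field_derive Gl _ Gs).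
  have [X [_ rX]] := horizontal_field u' pz.
  have r := tnear_self pz rX.2; rewrite ez in r.
  have st : smooth_near (chart p p, fib z) (tau_field (Gam p) v' w).
    by apply: tau_field_smooth; [exact: Gl|exact: Gs].
  rewrite -ez in st *; apply: (represents_tangent r st).
  by apply: tnear_all => z' pz'; exact: tau_torsion0.
have [J1 [J2 [J3 [adm eQ]]]] := twistor_frame_at hQ p.
have Fs u' v' : span3 J1 J2 J3 (vertical_part (Gam p) (chart p p) (fib z) u' v').
  by rewrite -eQ; exact: (vertical_part_vertical z u' v').1.
apply: (span3_small_image adm (u := u) (v := v) m6 (Fs u v)) => w.
exists (- vertical_part (Gam p) (chart p p) (fib z) v w),
  (- vertical_part (Gam p) (chart p p) (fib z) w u).
have sN X : span3 J1 J2 J3 X -> span3 J1 J2 J3 (- X).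
  move=> sX; rewrite -[- X]addr0 -scaleN1r; apply: span3_lin => //.
  by exists 0, 0, 0; rewrite !scale0r !addr0.
split; [exact: sN|exact: sN|].
have b := vertical_part_bianchi JJ Gl u v w t0 d0.
have neg (x y t : V) : x + y + t = 0 -> x = - y - t.
  by move=> /eqP; rewrite -addrA addr_eq0 opprD => /eqP.
exact: etrans (neg _ _ _ b) (congr2 +%R (esym (mulNmx _ _)) (esym (mulNmx _ _))).
Qed.

(** The projection of the Nijenhuis tensor vanishes by [tau_torsion0], and its
    vertical part by [vertical_part0]. *)
Lemma integrable_of_torsion02 :
  acs_integrable (twistor_smooth (Q := Q)) (I1 (Q := Q) nabla).
Proof.
move=> z U W sU sW f.
set p := base z; have pz : dom p (base z) := dom_self p.
have ez : end_coord p z = (chart p p, fib z) := end_coord_base z.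
have [_ JJ] := twistorP z.
have Gs := gam_smooth pz; rewrite ez in Gs.
have Gl := gam_linear p.
have t0 v w : tau (fib z) (ctorsion (Gam p) (chart p p)) v w = 0.
  by have := tau_torsion0 v w pz; rewrite ez.
have [u ru] := smooth_vf_represents pz sU; have [w rw] := smooth_vf_represents pz sW.
have rN := nijenhuis_represents hnabla m0 hQ pz ru rw.
have su := ru.1; have sw := rw.1; rewrite ez in su sw.
rewrite ez (local_nijenhuisE Gl Gs JJ su sw) in rN.
have vert (X : E) xi : represents p z X xi ->
    let c := X.2 + comm (Gam p (chart p p) X.1) (fib z) in c *m fib z + fib z *m c = 0.
  move=> r; have [C [_ vC]] := represents_vertical_part pz r.
  by rewrite ez tcoord_id invmx1 mul1mx mulmx1 /= => <-.
have vu := vert _ _ (tnear_self pz ru.2); have vw := vert _ _ (tnear_self pz rw.2).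
rewrite ez in vu vw.
have N1 : (nijenhuis_tensor (Gam p) (chart p p) (fib z) (u (chart p p, fib z)) (w (chart p p, fib z))).1 = 0.
  by rewrite nijenhuis_tensor1// t0 oppr0.
have N2 := nijenhuis_tensor2 Gl JJ vu vw; rewrite vertical_part0 N1 in N2.
have N0 : nijenhuis_tensor (Gam p) (chart p p) (fib z) (u (chart p p, fib z)) (w (chart p p, fib z)) = 0.
  rewrite [LHS]surjective_pairing N1; apply/pair_equal_spec; split=> //.
  rewrite -[RHS]N2 -[LHS]addr0; congr (_ + _).
  have G0 : Gam p (chart p p) 0 = 0.
    by have := linear_scaleE (Gl (chart p p)) 0 0; rewrite !scale0r.
  by rewrite G0 /comm mul0mx mulmx0 subrr.
by rewrite N0 in rN; rewrite (represents_zero rN pz).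
Qed.

End Main.

Local Close Scope classical_set_scope.

Theorem theorem3p7 (R : realType) (n : nat) (hn : (2 <= n)%N)
    (M : manifold R (4 * n)%N) (Q : M -> set 'M[R]_(4 * n)%N)
    (hQ : almost_quaternionic Q)
    (nabla : vfield M -> vfield M -> vfield M)
    (hnabla : quaternionic_connection Q nabla) :
  acs_integrable (twistor_smooth (Q := Q)) (I1 (Q := Q) nabla)
  <->
  (forall (p : M) (J : 'M[R]_(4 * n)%N), Q p J -> J *m J = - 1%:M ->
     forall u v : 'cV[R]_(4 * n)%N, part02 J (torsion nabla p) u v = 0).
Proof.
have h6 : (6 < 4 * n)%N by apply: leq_trans (leq_mul (leqnn 4) hn).
have h0 : (0 < 4 * n)%N by apply: leq_trans h6.
split; first exact: (torsion02_of_integrable hnabla h0 hQ).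
exact: (integrable_of_torsion02 hnabla h0 hQ h6).
Qed.
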